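(* Let $n\ge 2$ be an integer. Suppose that $L$ is an origin-symmetric complex convex body in $\mathbb{R}^{2n}$ and $\gamma$ is an arbitrary measure on $\mathbb{R}^{2n}$ with even continuous (non-negative) density $g$. Then $$\gamma(L)\ \le\ 2n\,\frac{n}{n-1}\,d_n\,\max_{\xi\in S^{2n-1}}\gamma(L\cap H_\xi)\ |L|^{\frac1n},$$ where $d_n=|B_2^{2n}|^{\frac{n-1}{n}}/|B_2^{2n-2}|$.
   Context: $\mathbb{C}^n$ is identified with $\mathbb{R}^{2n}$ via $(\xi_{11}+i\xi_{12},\dots,\xi_{n1}+i\xi_{n2})\mapsto(\xi_{11},\xi_{12},\dots,\xi_{n1},\xi_{n2})$. For $\theta\in[0,2\pi]$ and $\xi\in\mathbb{R}^{2n}$, $R_\theta\xi=(R_\theta(\xi_{11},\xi_{12}),\dots,R_\theta(\xi_{n1},\xi_{n2}))$, where on $\mathbb{R}^2$ the map $R_\theta$ is the counterclockwise rotation by the angle $\theta$ about the origin. A convex body is a compact convex set with non-empty interior. An origin-symmetric convex body $L$ in $\mathbb{R}^{2n}$ is called a complex convex body if it is invariant under all $R_\theta$, i.e. $\|\xi\|_L=\|R_\theta\xi\|_L$ for all $\xi\in\mathbb{R}^{2n}$, $\theta\in[0,2\pi]$, where $\|x\|_L=\min\{a\ge 0: x\in aL\}$ (equivalently, $L$ is the unit ball of a norm on $\mathbb{C}^n$). For $\xi\in S^{2n-1}$ (a unit vector of $\mathbb{C}^n$), $H_\xi=\{z\in\mathbb{C}^n:\ \sum_{k=1}^n z_k\overline{\xi_k}=0\}$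 is the complex hyperplane perpendicular to $\xi$, regarded as a $(2n-2)$-dimensional subspace of $\mathbb{R}^{2n}$. $|\cdot|$ is volume of the appropriate dimension and $B_2^m$ is the unit Euclidean ball in $\mathbb{R}^m$. That $\gamma$ has density $g$ means $\gamma(B)=\int_B g(x)\,dx$ for Borel sets $B$; even means $g(-x)=g(x)$; $\gamma(L\cap H_\xi)=\int_{L\cap H_\xi}g$ with respect to $(2n-2)$-dimensional Lebesgue measure on $H_\xi$. The density $g$ is not assumed to be $R_\theta$-invariant. *)

(* Defs.v *)
From HB Require Import structures.
From mathcomp Require Import all_boot all_order all_algebra.
From mathcomp Require Import complex ring.
From mathcomp Require Import all_classical all_reals all_analysis.
From mathcomp Require Import measurable_realfun.

Set Implicit Arguments.
Unset Strict Implicit.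
Unset Printing Implicit Defensive.

Import Order.TTheory GRing.Theory Num.Theory.
Import numFieldNormedType.Exports.

Local Open Scope classical_set_scope.
Local Open Scope ring_scope.

(* R^m with its Borel sigma-algebra; the carrier is convertible to 'rV[R]_m. *)
Notation borel_rV R m := (g_sigma_algebraType (@open 'rV[R]_m)).

Section LebesgueMeasure.
Variable R : realType.

Lemma open_rat_boxes m (U : set 'rV[R]_m) : open U ->
  let box (p : 'rV[rat]_m * rat) : set 'rV[R]_m :=
    [set x | forall i, `|x 0 i - ratr (p.1 0 i)| < ratr p.2] in
  forall x, U x <-> exists p, box p `<=` U /\ box p x.
Proof.
move=> oU box x; split => [Ux|[p [pU px]]]; last exact: pU.
move: oU; rewrite openE => /(_ _ Ux)/nbhs_ballP[e /= e0 eU].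
have [r] : exists r, ratr r \in `]0, e / 2[ by apply: rat_in_itvoo; rewrite divr_gt0.
rewrite in_itv/= => /andP[r0 re].
have /(choice (P := fun (i : 'I_m) q => `|x 0 i - ratr q| < ratr r))[f fP] :
    forall i : 'I_m, exists q : rat, `|x 0 i - ratr q| < ratr r.
  move=> i; have [q] : exists q, ratr q \in `]x 0 i - ratr r, x 0 i + ratr r[.
    by apply: rat_in_itvoo; rewrite ltrD2l gtrN.
  by rewrite in_itv/= => qi; exists q; rewrite distrC ltr_distl.
exists (\row_i f i, r); split => [y ry|i /=]; last by rewrite mxE; exact: fP.
apply: eU; split => // i j; rewrite (ord1 i) /ball/=.
have := ry j; rewrite /= mxE => yj; rewrite (splitr e).
rewrite -(subrKA (ratr (f j))) (le_lt_trans (ler_normD _ _))// ltrD//.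
  exact: lt_trans (fP j) re.
by rewrite distrC (lt_trans yj re).
Qed.

Lemma measurable_fun_borel_rV d (T : measurableType d) m (f : T -> 'rV[R]_m) :
  (forall i, measurable_fun [set: T] (fun t => f t 0 i)) ->
  measurable_fun [set: T] (f : T -> borel_rV R m).
Proof.
move=> mf; apply: (@measurability _ _ T (borel_rV R m) _ _ open) => // _ [U oU <-].
rewrite setTI.
pose box (p : 'rV[rat]_m * rat) : set 'rV[R]_m :=
  [set x | forall i, `|x 0 i - ratr (p.1 0 i)| < ratr p.2].
pose F (k : nat) : set T :=
  if unpickle k is Some p then
    if `[< box p `<=` U >] then f @^-1` box p else set0 else set0.
have -> : f @^-1` U = \bigcup_k F k.
  apply/seteqP; split => [t /= /(open_rat_boxes oU)[p [pU pt]]|t [k _]].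
    exists (pickle p) => //; rewrite /F pickleK; case: asboolP => //.
  rewrite /F; case: unpickle => // p; case: asboolP => // pU pt.
  by apply/(open_rat_boxes oU); exists p.
apply: bigcupT_measurable => k; rewrite /F; case: unpickle => // p.
case: asboolP => // _.
have -> : f @^-1` box p = \bigcap_(i in [set: 'I_m])
    ((fun t => f t 0 i) @^-1` ball (ratr (p.1 0 i) : R) (ratr p.2 : R)).
  apply/seteqP; split => t /= tp i; first by move=> _; rewrite /ball/= distrC.
  by have := tp i I; rewrite /ball/= distrC.
apply: fin_bigcap_measurable => // i _.
rewrite -[X in measurable X]setTI; apply: mf => //;
  apply: open_measurable; exact: ball_open.
Qed.

Definition cons_rV m (p : borel_rV R m * measurableTypeR R) : borel_rV R m.+1 :=
  row_mx (p.2%:M : 'rV[R]_1) (p.1 : 'rV[R]_m).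

Lemma measurable_cons_rV m : measurable_fun setT (@cons_rV m).
Proof.
apply: measurable_fun_borel_rV => i.
have [j ij|j ij] := @split_ordP 1 m i.
  rewrite [X in measurable_fun _ X](_ : _ = snd); first exact: measurable_snd.
  apply/funext => p; rewrite ij (ord1 j).
  by rewrite [LHS](@row_mxEl R 1 1 m p.2%:M p.1 0 0) mxE mulr1n.
rewrite [X in measurable_fun _ X](_ : _ = (fun x : 'rV[R]_m => x 0 j) \o fst).
  2: by apply/funext => p; rewrite ij [LHS](@row_mxEr R 1 1 m p.2%:M p.1 0 j).
apply: (@measurableT_comp _ _ _ _ _ _
  (fun x : borel_rV R m => (x : 'rV[R]_m) 0 j : measurableTypeR R)) => //.
apply: (measurability _ (RGenOpens.measurableE R)) => _ [_ [a [b ->]] <-].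
rewrite setTI; apply: sub_sigma_algebra.
apply: open_comp => [x _|]; [exact: coord_continuous|exact: interval_open].
Qed.

Section ConsMeasure.
Variables (m : nat) (mu : {measure set (borel_rV R m) -> \bar R}).

Definition cons_measure : set (borel_rV R m.+1) -> \bar R :=
  pushforward (mu \x @lebesgue_measure R)%E (@cons_rV m).

Let map := [the {measure set _ -> \bar R} of
  @measure_function_pushforward__canonical__measure_function_Measure
   _ _ _ _ R  (mu \x @lebesgue_measure R)%E (@cons_rV m) (@measurable_cons_rV m)].

Let cons_measure0 : cons_measure set0 = 0%E.
Proof. exact: (measure0 map). Qed.

Let cons_measure_ge0 A : (0 <= cons_measure A)%E.
Proof. exact: (measure_ge0 map). Qed.

Let cons_measure_sigma_additive : semi_sigma_additive cons_measure.
Proof. exact: (@measure_semi_sigma_additive _ _ _ map). Qed.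

HB.instance Definition _ := isMeasure.Build _ _ _ cons_measure
  cons_measure0 cons_measure_ge0 cons_measure_sigma_additive.

End ConsMeasure.

Fixpoint lebesgue_rV m : {measure set (borel_rV R m) -> \bar R} :=
  if m is k.+1 then cons_measure (lebesgue_rV k)
  else \d_(0 : borel_rV R 0).

End LebesgueMeasure.

Lemma orthonormal_row_basis (F : rcfType) k N (B : 'M[F]_(k, N)) : row_free B ->
  exists A : 'M[F]_(k, N), A *m A^T = 1%:M /\ (A :=: B)%MS.
Proof.
elim: k B => [|k IH] B fB.
  by exists B; split=> //; apply/matrixP => - [].
move: B fB; rewrite -[k.+1]/(1 + k)%N => B; rewrite -(vsubmxK B).
set b := usubmx B; set B' := dsubmx B => fB.
have fB' : row_free B'.
  rewrite /row_free eqn_leq rank_leq_row -(leq_add2l 1) /=.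
  have h := leq_of_leqif (mxrank_adds_leqif b B').
  move: h; rewrite addsmxE (eqP fB) => /leq_trans; apply.
  by rewrite leq_add2r rank_leq_row.
have [A' [oA' eA']] := IH _ fB'.
pose c := b - b *m A'^T *m A'.
have cA : c *m A'^T = 0 by rewrite mulmxBl -(mulmxA _ A') oA' mulmx1 subrr.
have c0 : c != 0.
  apply/eqP => /subr0_eq bA.
  have sbB : (b <= B')%MS by rewrite -eA' bA submxMl.
  have : (\rank (col_mx b B') <= k)%N.
    by rewrite -addsmxE (addsmx_idPr sbB) rank_leq_row.
  by move/eqP: fB => ->; rewrite add1n ltnn.
pose s := (c *m c^T) 0 0.
have s0 : 0 < s.
  rewrite /s mxE lt_neqAle eq_sym psumr_eq0; last first.
    by move=> i _; rewrite [c^T _ _]mxE -expr2 sqr_ge0.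
  rewrite sumr_ge0 ?andbT; last by move=> i _; rewrite [c^T _ _]mxE -expr2 sqr_ge0.
  apply/negP => /allP h; move/negP: c0 => c0; apply: c0; apply/eqP/matrixP => i0 i; rewrite (ord1 i0) [RHS]mxE.
  by have := h i (mem_index_enum _); rewrite [c^T _ _]mxE -expr2 sqrf_eq0 => /eqP.
have cc : c *m c^T = s%:M by apply/matrixP => i j; rewrite !ord1 [RHS]mxE eqxx mulr1n.
pose A := col_mx ((Num.sqrt s)^-1 *: c) A'.
have oA : A *m A^T = 1%:M.
  rewrite /A tr_col_mx mul_col_row oA' linearZ /= -!scalemxAl -!scalemxAr.
  rewrite cA scaler0 -[A' *m c^T]trmxK trmx_mul trmxK cA trmx0 scaler0 cc scalerA.
  rewrite -invfM -expr2 sqr_sqrtr ?ltW// scale_scalar_mx mulVf ?gt_eqF//.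
  by rewrite -scalar_mx_block.
exists A; split => //; apply/eqmxP.
have sAB : (A <= col_mx b B')%MS.
  rewrite -(addsmxE b B') /A col_mx_sub eA' addsmxSr andbT scalemx_sub// addmx_sub_adds//.
  by rewrite eqmx_opp -eA' submxMl.
rewrite sAB/= -(geq_leqif (mxrank_leqif_sup sAB)).
move/eqP: fB => ->.
have /eqP -> : row_free A by apply/row_freeP; exists A^T.
by [].
Qed.

Section ComplexConvexBodies.
Variable R : realType.

Definition euclidean_norm m (x : 'rV[R]_m) : R := Num.sqrt (\sum_i x 0 i ^+ 2).

Definition euclidean_ball m : set 'rV[R]_m := [set x | euclidean_norm x <= 1].

Definition unit_sphere m : set 'rV[R]_m := [set x | euclidean_norm x = 1].

(* The identification of C^n with R^(2n) lists the real and imaginary parts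
   coordinate by coordinate: since mxvec is row-major, row k of
   vec_mx x : 'M[R]_(n, 2) is (Re z_k, Im z_k). *)
Definition ccoord n (x : 'rV[R]_(n * 2)) (k : 'I_n) : R[i] :=
  (vec_mx x k 0 +i* vec_mx x k 1)%C.

Definition rotation n (theta : R) (x : 'rV[R]_(n * 2)) : 'rV[R]_(n * 2) :=
  mxvec (\matrix_(k < n, j < 2)
    if j == 0 then cos theta * vec_mx x k 0 - sin theta * vec_mx x k 1
    else sin theta * vec_mx x k 0 + cos theta * vec_mx x k 1).

Definition convex_body m (L : set 'rV[R]_m) : Prop :=
  [/\ compact L, convex_set L & L° !=set0].

(* For a convex body with 0 in its interior the infimum is a minimum. *)
Definition minkowski_functional m (L : set 'rV[R]_m) (x : 'rV[R]_m) : R :=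
  inf [set a | 0 <= a /\ exists2 y, L y & x = a *: y].

Definition complex_convex_body n (L : set 'rV[R]_(n * 2)) : Prop :=
  [/\ convex_body L,
      forall x, L x -> L (- x) &
      forall x theta, 0 <= theta <= 2 * pi ->
        minkowski_functional L x = minkowski_functional L (rotation theta x)].

Definition complex_hyperplane n (xi : 'rV[R]_(n * 2)) : set 'rV[R]_(n * 2) :=
  [set z | \sum_k ccoord z k * (ccoord xi k)^*%C = 0].

(* The rows of A form an orthonormal basis of the complex hyperplane, so that
   y |-> y *m A is an isometry of R^(2n - 2) onto it. *)
Definition is_hyperplane_frame n (xi : 'rV[R]_(n * 2))
    (A : 'M[R]_(n * 2 - 2, n * 2)) : Prop :=
  A *m A^T = 1%:M /\
  range (fun y : 'rV_(n * 2 - 2) => y *m A) = complex_hyperplane xi.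

Definition hyperplane_frame n (xi : 'rV[R]_(n * 2)) : 'M[R]_(n * 2 - 2, n * 2) :=
  xget 0 (is_hyperplane_frame xi).

Lemma dot_mxvec n (x y : 'rV[R]_(n * 2)) : (x *m y^T) 0 0 =
  \sum_k (vec_mx x k 0 * vec_mx y k 0 + vec_mx x k 1 * vec_mx y k 1).
Proof.
rewrite mxE (reindex _ (curry_mxvec_bij n 2))/=.
transitivity (\sum_(p : 'I_n * 'I_2) vec_mx x p.1 p.2 * vec_mx y p.1 p.2).
  by apply: eq_bigr => -[k j] _; rewrite !mxE.
rewrite -(pair_bigA _ (fun k j => vec_mx x k j * vec_mx y k j))/=.
apply: eq_bigr => k _; rewrite big_ord_recl big_ord1.
by rewrite (_ : lift _ _ = 1)//; apply/val_inj.
Qed.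

Lemma hyperplane_frame_exists n (xi : 'rV[R]_(n * 2)) : unit_sphere xi ->
  exists A, is_hyperplane_frame xi A.
Proof.
move=> xi1.
pose eta : 'rV[R]_(n * 2) :=
  mxvec (\matrix_(k < n, j < 2) if j == 0 then - vec_mx xi k 1 else vec_mx xi k 0).
have eta0 k : vec_mx eta k 0 = - vec_mx xi k 1 by rewrite mxvecK mxE eqxx.
have eta1 k : vec_mx eta k 1 = vec_mx xi k 0 by rewrite mxvecK mxE.
have xx : (xi *m xi^T) 0 0 = 1.
  move: xi1; rewrite /unit_sphere /euclidean_norm /= => /(congr1 (fun a => a ^+ 2)).
  rewrite sqr_sqrtr ?expr1n; last by apply: sumr_ge0 => i _; rewrite sqr_ge0.
  by move=> <-; rewrite mxE; apply: eq_bigr => i _; rewrite mxE expr2.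
have ee : (eta *m eta^T) 0 0 = 1.
  rewrite -xx !dot_mxvec; apply: eq_bigr => k _; rewrite eta0 eta1; ring.
have xe : (xi *m eta^T) 0 0 = 0.
  by rewrite dot_mxvec big1// => k _; rewrite eta0 eta1; ring.
pose W : 'M[R]_(1 + 1, n * 2) := col_mx xi eta.
have WW : W *m W^T = 1%:M.
  rewrite /W tr_col_mx mul_col_row [1%:M]scalar_mx_block; congr block_mx;
    apply/matrixP => i j; rewrite !ord1 [RHS]mxE ?eqxx ?mulr1n //.
  rewrite -[eta *m _]trmxK trmx_mul trmxK mxE //.
have rW : \rank W^T = 2%N.
  by rewrite mxrank_tr; apply/eqP; apply/row_freeP; exists W^T.
have rK : \rank (kermx W^T) = (n * 2 - 2)%N by rewrite mxrank_ker rW.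
have [B [fB eB]] : exists B : 'M[R]_(n * 2 - 2, n * 2),
    row_free B /\ (B :=: kermx W^T)%MS.
  rewrite -rK; exists (row_base (kermx W^T)); split; first exact: row_base_free.
  exact: eq_row_base.
have [A [oA eA]] := orthonormal_row_basis fB.
exists A; split => //.
have hypE z : complex_hyperplane xi z <-> z *m W^T = 0.
  rewrite /complex_hyperplane /= /W tr_col_mx mul_mx_row.
  have -> : \sum_k ccoord z k * (ccoord xi k)^*%C =
      ((z *m xi^T) 0 0 +i* (z *m eta^T) 0 0)%C.
    rewrite !dot_mxvec; elim/big_ind3 : _ => // [a b c a' b' c' -> ->//|k _].
    rewrite eta0 eta1 /ccoord/=; apply/eqP; rewrite eq_complex/=.
    by apply/andP; split; apply/eqP; ring.
  split => [[h1 h2]|/eqP]; last first.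
    by rewrite row_mx_eq0 => /andP[/eqP -> /eqP ->]; rewrite !mxE.
  apply/eqP; rewrite row_mx_eq0; apply/andP; split; apply/eqP/matrixP => i j;
  by rewrite !ord1 [RHS]mxE.
apply/seteqP; split => z.
  move=> [y _ <-]; apply/hypE; apply/eqP; rewrite -sub_kermx -eB -eA submxMl//.
by move=> /hypE/eqP; rewrite -sub_kermx -eB -eA => /submxP[D ->]; exists D.
Qed.

Lemma hyperplane_frameP n (xi : 'rV[R]_(n * 2)) :
  unit_sphere xi -> is_hyperplane_frame xi (hyperplane_frame xi).
Proof. by move=> /hyperplane_frame_exists; exact: xgetPex. Qed.

(* Integral over S of g with respect to (2n - 2)-dimensional Lebesgue measure on
   the complex hyperplane, for S contained in it. The choice of the orthonormal
   basis is immaterial, Lebesgue measure being invariant under isometries. *)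
Definition hyperplane_integral n (g : 'rV[R]_(n * 2) -> R)
    (xi : 'rV[R]_(n * 2)) (S : set 'rV[R]_(n * 2)) : \bar R :=
  (\int[lebesgue_rV R (n * 2 - 2)]_(y in [set y | S (y *m hyperplane_frame xi)])
    (g (y *m hyperplane_frame xi))%:E)%E.

Definition ball_volume m : R := fine (lebesgue_rV R m (@euclidean_ball m)).

Definition d_const n : R :=
  ball_volume (n * 2) `^ ((n%:R - 1) / n%:R) / ball_volume (n * 2 - 2).

End ComplexConvexBodies.

(* Main.v *)
(* Identify C^n with R^(2n), multiplication by i being a skew matrix J with J J = -1.
   A complex-linear T of determinant 1 puts L in position: L T lies in the ball of
   squared radius r and contains the ball of squared radius r / (2n), so that
   r |B_2^(2n)|^(1/n) <= 2n |L|^(1/n).  Such a T arises by nearly maximising |det T|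
   among the complex-linear T with L T in the unit ball: a point of the small ball
   outside L T would be separated from L T by a complex line direction v, and
   stretching along v while contracting its orthogonal complement would increase
   the determinant.
   Parametrise the complex hyperplanes by their normals (1, a) with a in C^(n-1).
   Averaging over a gives, for f >= 0,
     c_(n-2) int f(x) / |x|^2 dx = int (1 + |a|^2)^-(n-1) (int_y f(-<y, a>, y) dy) da
   with c_k = int_(C^k) (1 + |b|^2)^-(k+1) db.  Apply this to f = (g 1_L) o T^-1: the
   left-hand side is at least c_(n-2) gamma(L) / r, and the inner integral is the
   mass of a central section of L divided by q(a) = |(1, a) T^T|^2.  By the
   inequality of arithmetic and geometric means (1 + |a|^2)^-(n-1) / q(a) is at most
   ((n-1) (1 + |a|^2)^-n + q(a)^-n) / n, whose integral is c_(n-1) because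
   det T = 1.  Hence gamma(L) <= r M c_(n-1) / c_(n-2), where M is the largest
   section mass, and polar-type coordinates on the ball give
   c_(n-1) / c_(n-2) = n / (n-1) |B_2^(2n)| / |B_2^(2n-2)|. *)

Require Import Defs.
From HB Require Import structures.
From mathcomp Require Import all_boot all_order all_algebra.
From mathcomp Require Import complex perm.
From mathcomp Require Import all_classical all_reals all_analysis.
From mathcomp Require Import measurable_realfun ring lra zify.

Set Implicit Arguments.
Unset Strict Implicit.
Unset Printing Implicit Defensive.

Import Order.TTheory GRing.Theory Num.Theory.
Import numFieldNormedType.Exports.

Local Open Scope classical_set_scope.
Local Open Scope ring_scope.

(** * Lebesgue measure on row vectors *)

(** The conclusion asks for a hyperplane that attains the maximum. The density cut off by [L] jumps
    at the boundary, so only upper semicontinuity of the section mass is used, and compactness is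
    applied to orthonormal frames rather than to normals, because [hyperplane_frame] is an arbitrary
    choice. The factor 2n comes from a first-order computation. Multiplying squared lengths by 1 +
    (m - 1) e along the complex line of v and by 1 - e on its complement keeps L T in the unit ball
    as soon as the squared width along v is at most 1 / m, and multiplies the determinant by 1 + (m
    - n) e + O(e^2). At m = n this gain vanishes; at m = 2n it is a definite factor, so a matrix
    close enough to the supremum suffices in place of a maximiser. The exponent of the weight (1 +
    |a|^2)^-(n-1) serves two purposes: integrating out the normals leaves exactly |x|^-2, and
    together with 1 / q(a) it is dominated by a mean of two functions with the same integral
    c_(n-1). *)

Section LebesgueRV.
Variable R : realType.

Lemma measurable_coord m (i : 'I_m) :
  measurable_fun [set: borel_rV R m] (fun x : borel_rV R m => (x : 'rV[R]_m) 0 i).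
Proof.
apply: (measurability _ (RGenOpens.measurableE R)) => _ [_ [a [b ->]] <-].
rewrite setTI; apply: sub_sigma_algebra.
apply: open_comp => [x _|]; [exact: coord_continuous|exact: interval_open].
Qed.

Lemma continuous_measurable_rV m (f : 'rV[R]_m -> R) : continuous f ->
  measurable_fun [set: borel_rV R m] (f : borel_rV R m -> R).
Proof.
move=> cf; apply: (measurability _ (RGenOpens.measurableE R)) => _ [_ [a [b ->]] <-].
rewrite setTI; apply: sub_sigma_algebra.
by apply: open_comp => [x _|]; [exact: cf|exact: interval_open].
Qed.

Lemma measurable_coordP d (T : measurableType d) m (f : T -> borel_rV R m) i :
  measurable_fun setT f ->
  measurable_fun setT (fun t => (f t : 'rV[R]_m) 0 i).
Proof.
move=> mf; apply: (@measurableT_comp _ _ _ _ _ _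
  (fun x : borel_rV R m => (x : 'rV[R]_m) 0 i)) => //.
exact: measurable_coord.
Qed.

Lemma lebesgue_rVE m (A : set (borel_rV R m.+1)) :
  lebesgue_rV R m.+1 A =
  (lebesgue_rV R m \x @lebesgue_measure R)%E (@cons_rV R m @^-1` A).
Proof. by []. Qed.

Lemma coord_le_norm m (x : 'rV[R]_m) i : `|x 0 i| <= `|x|.
Proof.
by rewrite [leRHS]/Num.Def.normr /= mx_normrE; apply/bigmax_geP; right => /=; exists (0, i).
Qed.

Definition cube m (k : R) : set 'rV[R]_m := [set x | forall i, `|x 0 i| <= k].

Lemma measurable_cube m k : measurable (@cube m k : set (borel_rV R m)).
Proof.
rewrite (_ : cube k = \bigcap_(i in [set: 'I_m])
   ((fun x : borel_rV R m => (x : 'rV[R]_m) 0 i) @^-1` `[- k, k])); last first.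
  apply/seteqP; split => x /= h i; first by move=> _; rewrite /= in_itv/= -ler_norml.
  by have := h i I; rewrite /= in_itv/= -ler_norml.
apply: fin_bigcap_measurable => // i _.
by rewrite -[X in measurable X]setTI; apply: measurable_coord.
Qed.

Lemma cons_cube m k :
  @cons_rV R m @^-1` (cube k) = cube k `*` `[- k, k]%classic.
Proof.
apply/seteqP; split => -[y t] /=.
  move=> h; split => /= [i|].
    have := h (@rshift 1 m i); rewrite /cons_rV /=.
    by rewrite (@row_mxEr R 1 1 m).
  have := h (@lshift 1 m 0); rewrite /cons_rV /=.
  by rewrite (@row_mxEl R 1 1 m) mxE mulr1n in_itv/= ler_norml.
move=> [h]; rewrite /= in_itv/= => tk i.
have [j ->|j ->] := @split_ordP 1 m i; rewrite /cons_rV /=.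
  by rewrite (@row_mxEl R 1 1 m) (ord1 j) mxE mulr1n ler_norml.
by rewrite (@row_mxEr R 1 1 m); exact: h.
Qed.

Lemma lebesgue_rV_cube m k : 0 <= k ->
  lebesgue_rV R m (@cube m k) = ((2 * k) ^+ m)%:E.
Proof.
move=> k0; elim: m => [|m IH].
  by rewrite expr0 /= /dirac /= indicE mem_set// => -[].
rewrite lebesgue_rVE cons_cube product_measure1E//; last exact: measurable_cube.
rewrite IH [X in (_ * X)%E](lebesgue_measure_itv `[- k, k])/= lte_fin.
case: ifPn => [_|]; first by rewrite -EFinB -EFinM exprS mulrC; congr (_ * _)%:E; ring.
rewrite -leNgt => k0'; have -> : k = 0 by lra.
by rewrite mule0 mulr0 expr0n.
Qed.

Lemma sigma_finite_lebesgue_rV m : sigma_finite setT (lebesgue_rV R m).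
Proof.
exists (fun k => @cube m k%:R); last first.
  move=> k; split; first exact: measurable_cube.
  by rewrite (lebesgue_rV_cube m (ler0n R k)) ltry.
apply/esym/seteqP; split => // x _.
have [k xk] : exists k, `|x| <= k%:R.
  exists (Num.truncn `|x|).+1; exact/ltW/truncnS_gt.
exists k => // i; apply: le_trans xk.
exact: coord_le_norm.
Qed.

(* lebesgue_rV is a fixpoint valued in bundled measures; leb gives the same measure a head
   constant to which the sigma-finite instance is attached. *)
Definition leb m : set (borel_rV R m) -> \bar R := lebesgue_rV R m.
Arguments leb m : clear implicits.

HB.instance Definition _ m := isMeasure.Build _ _ _ (leb m)
  (measure0 (lebesgue_rV R m)) (measure_ge0 (lebesgue_rV R m))
  (@measure_semi_sigma_additive _ _ _ (lebesgue_rV R m)).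

HB.instance Definition _ m := Measure_isSigmaFinite.Build _ _ _ (leb m)
  (sigma_finite_lebesgue_rV m).

Lemma integral_leb m D (f : borel_rV R m -> \bar R) :
  (\int[lebesgue_rV R m]_(x in D) f x = \int[leb m]_(x in D) f x)%E.
Proof. exact: eq_measure_integral. Qed.

Section Tonelli.
Variables (m : nat) (f : 'rV[R]_m.+1 -> \bar R).
Hypothesis mf : measurable_fun setT (f : borel_rV R m.+1 -> \bar R).
Hypothesis f0 : forall x, (0 <= f x)%E.

Local Open Scope ereal_scope.

Let F (p : borel_rV R m * measurableTypeR R) := f (cons_rV p).

Lemma measurable_fun_cons : measurable_fun setT F.
Proof.
by apply: (@measurableT_comp _ _ _ _ _ _ (f : borel_rV R m.+1 -> _)) => //;
  exact: measurable_cons_rV.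
Qed.

Lemma integral_cons_prod :
  \int[leb m.+1]_x f x = \int[leb m \x @lebesgue_measure R]_p F p.
Proof.
have := @ge0_integral_pushforward _ _ _ _ R _ (@measurable_cons_rV R m)
   (leb m \x @lebesgue_measure R) setT f measurableT mf.
by rewrite preimage_setT => <-.
Qed.

Lemma integral_cons1 : \int[leb m.+1]_x f x =
  \int[leb m]_y \int[@lebesgue_measure R]_t f (cons_rV (y, t)).
Proof.
rewrite integral_cons_prod; apply: (fubini_tonelli1 F) => [|p].
  exact: measurable_fun_cons.
exact: f0.
Qed.

Lemma integral_cons2 : \int[leb m.+1]_x f x =
  \int[@lebesgue_measure R]_t \int[leb m]_y f (cons_rV (y, t)).
Proof.
rewrite integral_cons_prod; apply: (fubini_tonelli2 F) => [|p].
  exact: measurable_fun_cons.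
exact: f0.
Qed.

End Tonelli.

Lemma integral_leb0 (f : 'rV[R]_0 -> \bar R) :
  (\int[leb 0]_x f x = f 0%R)%E.
Proof.
rewrite (_ : f = cst (f 0)); last by apply/funext => x; rewrite (thinmx0 x).
transitivity (f 0%R * leb 0 setT)%E; first exact: integral_cst.
have -> : leb 0 setT = 1%E by rewrite /leb /= diracT.
exact: mule1.
Qed.

Lemma measurable_comp_rV d (T : measurableType d) d' (U : measurableType d') m
    (f : 'rV[R]_m -> U) (h : T -> 'rV[R]_m) :
  measurable_fun setT (f : borel_rV R m -> U) ->
  measurable_fun setT (h : T -> borel_rV R m) ->
  measurable_fun setT (fun t => f (h t)).
Proof. exact: (@measurableT_comp _ _ _ _ _ _ (f : borel_rV R m -> U)). Qed.

Lemma measurable_row_mx d (T : measurableType d) q p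
    (u : T -> borel_rV R q) (y : T -> borel_rV R p) :
  measurable_fun setT u -> measurable_fun setT y ->
  measurable_fun setT (fun t => row_mx (u t : 'rV[R]_q) (y t : 'rV[R]_p) : borel_rV R (q + p)).
Proof.
move=> mu my; apply: measurable_fun_borel_rV => i.
have [j ->|j ->] := split_ordP i.
  under eq_fun do rewrite row_mxEl; exact: measurable_coordP.
by under eq_fun do rewrite row_mxEr; exact: measurable_coordP.
Qed.

(** The types [(q + p).+1] and [q.+1 + p] are convertible, so only the nested splittings of the
    index have to be matched. This drives the induction on the first block in [integral_block1]. *)
Lemma cons_row_mx q p (u : 'rV[R]_q) (y : 'rV[R]_p) t :
  cons_rV (row_mx u y : borel_rV R (q + p), t) =
  row_mx (cons_rV (u : borel_rV R q, t) : 'rV_(q.+1)) y :> 'rV_(q.+1 + p).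
Proof.
rewrite /cons_rV /=; apply/rowP => i.
have [j ij|j ij] := @split_ordP 1 (q + p) i.
  rewrite ij [LHS](@row_mxEl R 1 1 (q + p)).
  rewrite [X in row_mx _ _ _ X](_ : _ = lshift p (@lshift 1 q j)).
    by rewrite row_mxEl (@row_mxEl R 1 1 q).
  exact/val_inj.
rewrite ij [LHS](@row_mxEr R 1 1 (q + p)).
have [k jk|k jk] := split_ordP j; rewrite jk.
  rewrite row_mxEl.
  rewrite [X in _ = row_mx _ _ _ X](_ : _ = lshift p (@rshift 1 q k)).
    by rewrite row_mxEl (@row_mxEr R 1 1 q).
  exact/val_inj.
rewrite row_mxEr.
rewrite [X in _ = row_mx _ _ _ X](_ : _ = @rshift q.+1 p k).
  by rewrite row_mxEr.
exact/val_inj.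
Qed.

Section BlockTonelli.
Local Open Scope ereal_scope.

Lemma integral_block1 q p (f : 'rV[R]_(q + p) -> \bar R) :
  measurable_fun setT (f : borel_rV R (q + p) -> \bar R) ->
  (forall x, 0 <= f x) ->
  \int[leb (q + p)]_x f x = \int[leb p]_y \int[leb q]_u f (row_mx u y).
Proof.
elim: q f => [|q IH] f mf f0.
  apply: eq_integral => y _; rewrite integral_leb0.
  congr f; apply/rowP => i; have [[]//|j ->] := @split_ordP 0 p i.
  by rewrite row_mxEr; congr (y _ _); apply: val_inj.
rewrite (@integral_cons1 (q + p))// IH; last 2 first.
- exact: (measurable_fun_fubini_tonelli_F _ (measurable_fun_cons mf)).
- by move=> x; exact: integral_ge0.
apply: eq_integral => y _.
have mfy : measurable_fun setT ((fun u : 'rV[R]_q.+1 => f (row_mx u y)) : borel_rV R q.+1 -> \bar R).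
  apply: (measurable_comp_rV (h := fun u : borel_rV R q.+1 => row_mx (u : 'rV_q.+1) y) mf).
  by apply: measurable_row_mx => //; exact: measurable_cst.
rewrite [RHS](integral_cons1 mfy (fun u => f0 _)).
apply: eq_integral => u _; apply: eq_integral => t _.
exact: (congr1 f (cons_row_mx _ _ _)).
Qed.

Lemma integral_block2 q p (f : 'rV[R]_(q + p) -> \bar R) :
  measurable_fun setT (f : borel_rV R (q + p) -> \bar R) ->
  (forall x, 0 <= f x) ->
  \int[leb (q + p)]_x f x = \int[leb q]_u \int[leb p]_y f (row_mx u y).
Proof.
move=> mf f0; rewrite integral_block1//.
apply: (fubini_tonelli (fun x : borel_rV R p * borel_rV R q => f (row_mx x.2 x.1))) => [|x].
  2: exact: f0.
apply: (measurable_comp_rV (h := fun x : borel_rV R p * borel_rV R q =>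
  row_mx (x.2 : 'rV_q) (x.1 : 'rV_p)) mf).
exact: measurable_row_mx.
Qed.

End BlockTonelli.

End LebesgueRV.

Arguments leb : clear implicits.

(** * Linear change of variables for Lebesgue measure on row vectors *)

Section LinearChange.
Variable R : realType.

(** The scaled pushforward is a measure, so by uniqueness it is enough to compare on half-open
    intervals. For negative [c] the preimage is closed on the left instead of the right. *)
Lemma lebesgue_measure_affine (c b : R) (A : set (measurableTypeR R)) : c != 0 ->
  measurable A ->
  (`|c|%:E * lebesgue_measure ((fun t => c * t + b)%R @^-1` A))%E = lebesgue_measure A.
Proof.
move=> c0 mA.
have mphi : measurable_fun setT ((fun t => c * t + b) : measurableTypeR R -> measurableTypeR R).
  by apply: measurable_funD => //; exact: measurable_funM.
have := @lebesgue_measure_unique R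
  (mscale (NngNum (normr_ge0 c))
    (measure_function_pushforward__canonical__measure_function_Measure (@lebesgue_measure R) mphi)).
move=> /(_ _ A mA) -> // _ [[x y]] _ <-.
change (lebesgue_measure `]x, y]%classic =
  `|c|%:E * lebesgue_measure ((fun t => c * t + b)%R @^-1` `]x, y]%classic))%E.
have [cp|cn] := ltP 0 c.
  rewrite [X in (_ * lebesgue_measure X)%E](_ : _ = `](x - b) / c, (y - b) / c]%classic); last first.
    apply/seteqP; split => t /=; rewrite !in_itv/= ltr_pdivrMr// ler_pdivlMr//;
    by rewrite ltrBlDr lerBrDr mulrC.
  rewrite !lebesgue_measure_itv/= !lte_fin ltr_pM2r ?invr_gt0// ltrD2r.
  case: ifP => _; last by rewrite mule0.
  by rewrite -!EFinB -EFinM gtr0_norm// -mulrBl mulrCA divff// mulr1; congr EFin; ring.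
have {}cn : c < 0 by rewrite lt_neqAle c0.
rewrite [X in (_ * lebesgue_measure X)%E](_ : _ = `[(y - b) / c, (x - b) / c[%classic); last first.
  apply/seteqP; split => t /=; rewrite !in_itv/= ltr_ndivlMr// ler_ndivrMr//;
  by rewrite ltrBlDr lerBrDr mulrC andbC.
rewrite !lebesgue_measure_itv/= !lte_fin ltr_nM2r ?invr_lt0// ltrD2r.
case: ifP => _; last by rewrite mule0.
by rewrite -!EFinB -EFinM ltr0_norm// -mulrBl mulrCA mulNr divff// mulrN1; congr EFin; ring.
Qed.

Lemma integral_affine (c b : R) (f : measurableTypeR R -> \bar R) : c != 0 ->
  measurable_fun setT f -> (forall t, 0 <= f t)%E ->
  (`|c|%:E * \int[lebesgue_measure]_t f (c * t + b)%R = \int[lebesgue_measure]_t f t)%E.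
Proof.
move=> c0 mf f0.
have mphi : measurable_fun setT ((fun t => c * t + b) : measurableTypeR R -> measurableTypeR R).
  by apply: measurable_funD => //; exact: measurable_funM.
have := @ge0_integral_pushforward _ _ _ _ R _ mphi (@lebesgue_measure R) setT f measurableT mf (fun y _ => f0 y).
rewrite preimage_setT => E.
rewrite [X in (_ * X)%E](_ : _ = \int[lebesgue_measure]_x (f \o (fun t => c * t + b)%R) x)%E//.
rewrite -E.
rewrite -(@ge0_integral_mscale _ _ R (measure_function_pushforward__canonical__measure_function_Measure (@lebesgue_measure R) mphi) setT measurableT (NngNum (normr_ge0 c)) f mf (fun y _ => f0 y)).
apply: eq_measure_integral => A mA _.
exact: lebesgue_measure_affine.
Qed.

Lemma measurable_mulmx d (T : measurableType d) m p (h : T -> borel_rV R m) (B : 'M[R]_(m, p)) :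
  measurable_fun setT h ->
  measurable_fun setT (fun x => (h x : 'rV[R]_m) *m B : borel_rV R p).
Proof.
move=> mh; apply: measurable_fun_borel_rV => j.
under eq_fun do rewrite mxE.
apply: measurable_sum => i; apply: measurable_funM => //.
exact: measurable_coordP.
Qed.

Lemma measurable_addmx d (T : measurableType d) m (h k : T -> borel_rV R m) :
  measurable_fun setT h -> measurable_fun setT k ->
  measurable_fun setT (fun x => (h x : 'rV[R]_m) + k x : borel_rV R m).
Proof.
move=> mh mk; apply: measurable_fun_borel_rV => j.
under eq_fun do rewrite mxE.
by apply: measurable_funD; exact: measurable_coordP.
Qed.

Lemma cons_rVE m (y : 'rV[R]_m) t :
  cons_rV (y : borel_rV R m, t) = row_mx (t%:M : 'rV_1) y :> 'rV_(1 + m).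
Proof. by []. Qed.

Lemma cons_rV0 m (p : borel_rV R m * measurableTypeR R) :
  cons_rV p 0 (@lshift 1 m 0) = p.2.
Proof. by rewrite /cons_rV (@row_mxEl R 1 1 m) mxE mulr1n. Qed.

Lemma cons_rVS m (p : borel_rV R m * measurableTypeR R) j :
  cons_rV p 0 (@rshift 1 m j) = (p.1 : 'rV_m) 0 j.
Proof. by rewrite /cons_rV (@row_mxEr R 1 1 m). Qed.

Lemma eq_consP m (x y : 'rV[R]_m.+1) : x 0 (@lshift 1 m 0) = y 0 (@lshift 1 m 0) ->
  (forall j, x 0 (@rshift 1 m j) = y 0 (@rshift 1 m j)) -> x = y.
Proof.
move=> e0 eS; apply/rowP => i.
by have [j ->|j ->] := @split_ordP 1 m i; rewrite ?(ord1 j).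
Qed.

Local Notation mble m f := (measurable_fun [set: borel_rV R m] (f : borel_rV R m -> \bar R)).

Lemma measurable_cons_fst m (f : 'rV[R]_m.+1 -> \bar R) t : mble m.+1 f ->
  mble m (fun y : 'rV_m => f (cons_rV (y : borel_rV R m, t))).
Proof.
move=> mf; apply: (measurable_comp_rV (h := fun y : borel_rV R m => cons_rV (y, t)) mf).
by apply: measurableT_comp; [exact: measurable_cons_rV|exact: measurable_fun_pair].
Qed.

Lemma measurable_cons_snd m (f : 'rV[R]_m.+1 -> \bar R) y : mble m.+1 f ->
  measurable_fun setT (fun t : measurableTypeR R => f (cons_rV (y : borel_rV R m, t))).
Proof.
move=> mf; apply: (measurable_comp_rV (h := fun t : measurableTypeR R => cons_rV (y : borel_rV R m, t)) mf).
by apply: measurableT_comp; [exact: measurable_cons_rV|exact: measurable_fun_pair].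
Qed.

Lemma integral_translate m (f : 'rV[R]_m -> \bar R) v :
  mble m f -> (forall x, 0 <= f x)%E ->
  (\int[leb R m]_x f (x + v)%R = \int[leb R m]_x f x)%E.
Proof.
elim: m f v => [|m IH] f v mf f0.
  by rewrite !integral_leb0 (thinmx0 (_ + _)).
have mfv : mble m.+1 (fun x => f (x + v)).
  apply: (measurable_comp_rV (h := fun x : borel_rV R m.+1 => (x : 'rV_m.+1) + v : borel_rV R m.+1) mf).
  by apply: measurable_addmx => //; exact: measurable_cst.
rewrite (integral_cons2 mfv (fun=> f0 _)) (integral_cons2 mf f0).
pose v0 := v 0 (@lshift 1 m 0).
pose v' : 'rV[R]_m := @rsubmx R 1 1 m v.
have vE t y : cons_rV (y : borel_rV R m, t) + v = cons_rV ((y + v' : 'rV_m) : borel_rV R m, t + v0).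
  apply: eq_consP => [|j].
    by rewrite mxE !cons_rV0.
  by rewrite mxE !cons_rVS /= mxE /v' mxE.
pose F t := (\int[leb R m]_y f (cons_rV (y, t)))%E.
transitivity (\int[@lebesgue_measure R]_t F (1 * t + v0)%R)%E.
  apply: eq_integral => t _; rewrite mul1r /F.
  rewrite -(IH (fun y => f (cons_rV (y : borel_rV R m, t + v0))) v')//; last exact: measurable_cons_fst.
  by apply: eq_integral => y _; rewrite vE.
rewrite -[RHS](@integral_affine 1 v0)// ?normr1 ?mul1e//.
  exact: (measurable_fun_fubini_tonelli_G _ (measurable_fun_cons mf)).
by move=> t; exact: integral_ge0.
Qed.

(** With the Jacobian as a factor on the left, the property passes to products without inverting
    determinants. *)
Definition linear_change m (A : 'M[R]_m) : Prop := forall f : 'rV[R]_m -> \bar R,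
  mble m f -> (forall x, 0 <= f x)%E ->
  (`|\det A|%:E * \int[leb R m]_x f (x *m A)%R = \int[leb R m]_x f x)%E.

Lemma measurable_fun_mulmx m (A : 'M[R]_m) (f : 'rV[R]_m -> \bar R) :
  mble m f -> mble m (fun x => f (x *m A)).
Proof.
move=> mf; apply: (measurable_comp_rV (h := fun x : borel_rV R m => (x : 'rV_m) *m A : borel_rV R m) mf).
exact: measurable_mulmx.
Qed.

Lemma linear_changeM m (A B : 'M[R]_m) :
  linear_change A -> linear_change B -> linear_change (A *m B).
Proof.
move=> hA hB f mf f0.
rewrite -(hB f mf f0) -(hA (fun x => f (x *m B)) (measurable_fun_mulmx B mf) (fun=> f0 _)).
rewrite muleA -EFinM -normrM det_mulmx mulrC.
by under [in RHS]eq_integral do rewrite -mulmxA.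
Qed.

(** For a fixed first coordinate [t], the row [v] only translates the remaining coordinates by
    [t *: v], while [a] rescales [t]. *)
Lemma linear_change_ublock m (a : R) (v : 'rV[R]_m) (S : 'M[R]_m) :
  a != 0 -> linear_change S ->
  linear_change (block_mx (a%:M : 'M[R]_1) v 0 S : 'M[R]_(1 + m)).
Proof.
move=> a0 hS f mf f0.
have mfA := measurable_fun_mulmx (block_mx (a%:M : 'M[R]_1) v 0 S : 'M[R]_(1 + m)) mf.
rewrite (integral_cons2 mfA (fun=> f0 _)) (integral_cons2 mf f0) det_ublock det_scalar1.
rewrite normrM EFinM -muleA -[RHS](@integral_affine a 0)//; last 2 first.
- exact: (measurable_fun_fubini_tonelli_G _ (measurable_fun_cons mf)).
- by move=> t; exact: integral_ge0.
congr (_ * _)%E.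
rewrite -ge0_integralZl//; last 2 first.
- exact: (measurable_fun_fubini_tonelli_G _ (measurable_fun_cons mfA)).
- by move=> t _; exact: integral_ge0.
apply: eq_integral => t _; rewrite addr0.
rewrite -(@integral_translate _ _ (t *: v) (measurable_cons_fst (a * t) mf) (fun=> f0 _)).
rewrite -(hS (fun y => f (cons_rV (y + t *: v : borel_rV R m, a * t)))); last 2 first.
- apply: (measurable_comp_rV (f := fun y : 'rV_m => f (cons_rV (y : borel_rV R m, a * t)))
    (h := fun y : borel_rV R m => (y : 'rV_m) + t *: v : borel_rV R m)).
    exact: measurable_cons_fst.
  by apply: measurable_addmx => //; exact: measurable_cst.
- by move=> x; exact: f0.
congr (_ * _)%E; apply: eq_integral => y _; congr f.
rewrite cons_rVE mul_row_block mulmx0 addr0 mul_scalar_mx scale_scalar_mx mulrC.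
by rewrite mul_scalar_mx addrC.
Qed.

(** Here the remaining coordinates are held fixed and the first one is translated, hence the other
    order of integration. *)
Lemma linear_change_lblock m (w : 'cV[R]_m) :
  linear_change (block_mx (1%:M : 'M[R]_1) 0 w 1%:M : 'M[R]_(1 + m)).
Proof.
move=> f mf f0.
have mfA := measurable_fun_mulmx (block_mx (1%:M : 'M[R]_1) 0 w 1%:M : 'M[R]_(1 + m)) mf.
rewrite (integral_cons1 mfA (fun=> f0 _)) (integral_cons1 mf f0) det_lblock !det1 mulr1 normr1 mul1e.
apply: eq_integral => y _.
rewrite -[RHS](@integral_affine 1 (((y : 'rV_m) *m w) 0 0)
  (fun t => f (cons_rV (y, t))) (oner_neq0 _) (measurable_cons_snd y mf) (fun=> f0 _)).
rewrite normr1 mul1e.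
apply: eq_integral => t _; congr f.
rewrite cons_rVE mul_row_block mulmx0 add0r !mulmx1; congr row_mx.
by apply/rowP => i; rewrite !mxE (ord1 i) !mulr1n mul1r.
Qed.

(* Once the top left entry is nonzero, the matrix is a product of a lower and an upper
   block triangular matrix, with the Schur complement left to the induction; a row
   operation makes that entry nonzero. *)
Lemma linear_change_unit m (A : 'M[R]_m) : A \in unitmx -> linear_change A.
Proof.
elim: m A => [|m IH] A uA.
  by move=> f mf f0; rewrite det_mx00 normr1 mul1e !integral_leb0 mul0mx.
have key (B : 'M[R]_(1 + m)) : B \in unitmx -> ulsubmx B 0 0 != 0 -> linear_change B.
  move=> uB b0; set b := ulsubmx B 0 0 in b0.
  pose v := ursubmx B; pose w := dlsubmx B.
  pose S := drsubmx B - (b^-1 *: w) *m v.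
  have BE : B = block_mx (1%:M : 'M[R]_1) 0 (b^-1 *: w) 1%:M *m block_mx (b%:M : 'M[R]_1) v 0 S.
    rewrite mulmx_block !mul1mx !mul0mx !addr0 mul_mx_scalar scalerA divff// scale1r.
    by rewrite /S addrC subrK /b -(mx11_scalar (ulsubmx B)) submxK.
  rewrite BE; apply: linear_changeM; first exact: linear_change_lblock.
  apply: linear_change_ublock => //; apply: IH.
  move: uB; rewrite BE !unitmxE det_mulmx det_lblock det_ublock !det1 !mul1r det_scalar1.
  by rewrite unitrM => /andP[].
have [u uP] : exists u : 'rV[R]_m, (ulsubmx (A : 'M[R]_(1 + m)) + u *m dlsubmx (A : 'M[R]_(1 + m))) 0 0 != 0.
  have [a0|a0] := eqVneq (ulsubmx (A : 'M[R]_(1 + m)) 0 0) 0; last first.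
    by exists 0; rewrite mul0mx addr0.
  have [i wi] : exists i, dlsubmx (A : 'M[R]_(1 + m)) i 0 != 0.
    (* If the whole first column vanished, the matrix would be singular. *)
    apply/existsP; apply: contraTT uA; rewrite negb_exists => /forallP h.
    rewrite unitmxE unitfE negbK; apply/eqP.
    have w0 : dlsubmx (A : 'M[R]_(1 + m)) = 0.
      by apply/colP => i; have := h i; rewrite negbK => /eqP ->; rewrite mxE.
    have := det_ublock (ulsubmx (A : 'M[R]_(1 + m))) (ursubmx (A : 'M[R]_(1 + m)))
      (drsubmx (A : 'M[R]_(1 + m))).
    by rewrite -w0 submxK (mx11_scalar (ulsubmx _)) a0 det_scalar1 mul0r.
  exists (delta_mx 0 i); rewrite -rowE !mxE.
  by move: a0 wi; rewrite !mxE => ->; rewrite add0r.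
pose U : 'M[R]_(1 + m) := block_mx (1%:M : 'M[R]_1) u 0 1%:M.
have UE : A = block_mx (1%:M : 'M[R]_1) (- u) 0 1%:M *m (U *m A).
  rewrite mulmxA mulmx_block !mul1mx !mul0mx mulmx0 !mulmx1 !addr0 add0r subrr.
  by rewrite -scalar_mx_block mul1mx.
rewrite UE; apply: linear_changeM.
  by apply: linear_change_ublock; [exact: oner_neq0 | move=> f _ _; rewrite det1 normr1 mul1e; under eq_integral do rewrite mulmx1].
apply: key.
  by rewrite unitmx_mul uA andbT unitmxE det_ublock !det1 mulr1 unitr1.
have := mulmx_block (1%:M : 'M[R]_1) u 0 1%:M (ulsubmx (A : 'M[R]_(1 + m)))
  (ursubmx (A : 'M[R]_(1 + m))) (dlsubmx (A : 'M[R]_(1 + m))) (drsubmx (A : 'M[R]_(1 + m))).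
by rewrite submxK /U => ->; rewrite block_mxKul mul1mx.
Qed.

Theorem integral_linear_change m (A : 'M[R]_m) (f : 'rV[R]_m -> \bar R) :
  A \in unitmx -> mble m f -> (forall x, 0 <= f x)%E ->
  (\int[leb R m]_x f (x *m A)%R = `|\det A|^-1%:E * \int[leb R m]_x f x)%E.
Proof.
move=> uA mf f0; rewrite -(linear_change_unit uA mf f0) muleA -EFinM mulVf ?mul1e//.
by rewrite normr_eq0 -unitfE -unitmxE.
Qed.

End LinearChange.

(** * Complex structures and the ball in projective coordinates *)

Section SquaredNorm.
Variable R : realType.

Definition nsq m (x : 'rV[R]_m) : R := (x *m x^T) 0 0.

Lemma nsqE m (x : 'rV[R]_m) : nsq x = \sum_i x 0 i ^+ 2.
Proof. by rewrite /nsq mxE; apply: eq_bigr => i _; rewrite mxE expr2. Qed.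

Lemma nsq_ge0 m (x : 'rV[R]_m) : 0 <= nsq x.
Proof. by rewrite nsqE sumr_ge0// => i _; exact: sqr_ge0. Qed.

Lemma nsq_eq0 m (x : 'rV[R]_m) : (nsq x == 0) = (x == 0).
Proof.
rewrite nsqE psumr_eq0; last by move=> i _; exact: sqr_ge0.
apply/allP/eqP => [h|-> i _]; last by rewrite mxE expr0n/= eqxx.
apply/rowP => i; have := h i (mem_index_enum _).
by rewrite /= sqrf_eq0 mxE => /eqP.
Qed.

Lemma nsq_gt0 m (x : 'rV[R]_m) : (0 < nsq x) = (x != 0).
Proof. by rewrite lt_neqAle nsq_ge0 andbT eq_sym nsq_eq0. Qed.

Lemma nsqZ m c (x : 'rV[R]_m) : nsq (c *: x) = c ^+ 2 * nsq x.
Proof. by rewrite !nsqE mulr_sumr; apply: eq_bigr => i _; rewrite mxE exprMn. Qed.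

Lemma nsqN m (x : 'rV[R]_m) : nsq (- x) = nsq x.
Proof. by rewrite -scaleN1r nsqZ sqrrN expr1n mul1r. Qed.

Lemma nsq_delta m (i : 'I_m) : nsq (delta_mx 0 i) = 1.
Proof.
rewrite nsqE (bigD1 i)//= big1 => [|l li]; rewrite !mxE ?eqxx ?expr1n ?addr0//.
by rewrite (negbTE li) expr0n.
Qed.

Lemma nsq_row_mx q p (u : 'rV[R]_q) (y : 'rV[R]_p) :
  nsq (row_mx u y) = nsq u + nsq y.
Proof. by rewrite /nsq tr_row_mx mul_row_col mxE. Qed.

Lemma nsq_orthogonal m p (x : 'rV[R]_m) (O : 'M[R]_(m, p)) :
  O *m O^T = 1%:M -> nsq (x *m O) = nsq x.
Proof. by move=> oO; rewrite /nsq trmx_mul mulmxA -(mulmxA x) oO mulmx1. Qed.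

Lemma dot_sym m (x y : 'rV[R]_m) : (x *m y^T) 0 0 = (y *m x^T) 0 0.
Proof. by rewrite -[x *m _]trmxK trmx_mul trmxK mxE. Qed.

Lemma nsqD m (x y : 'rV[R]_m) : nsq (x + y) = nsq x + 2 * (x *m y^T) 0 0 + nsq y.
Proof.
rewrite /nsq linearD mulmxDl !mulmxDr !mxE -!/(nsq _).
have := dot_sym y x; rewrite !mxE => ->; ring.
Qed.

Lemma euclidean_ballE m (x : 'rV[R]_m) : euclidean_ball x <-> nsq x <= 1.
Proof.
rewrite /euclidean_ball /euclidean_norm /= -nsqE; split => h.
  by rewrite -(sqr_sqrtr (nsq_ge0 x)) expr_le1// sqrtr_ge0.
by rewrite -sqrtr1 ler_wsqrtr.
Qed.

Lemma unit_sphereE m (x : 'rV[R]_m) : unit_sphere x <-> nsq x = 1.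
Proof.
rewrite /unit_sphere /euclidean_norm /= -nsqE; split => h; last by rewrite h sqrtr1.
by rewrite -(sqr_sqrtr (nsq_ge0 x)) h expr1n.
Qed.

Lemma measurable_nsq d (T : measurableType d) m (h : T -> borel_rV R m) :
  measurable_fun setT h -> measurable_fun setT (fun x => nsq (h x)).
Proof.
move=> mh; under eq_fun do rewrite nsqE.
by apply: measurable_sum => i; apply: measurable_funX; exact: measurable_coordP.
Qed.

(** Since [0^-1 = 0], inversion is total but discontinuous at 0: continuity covers the open set of
    nonzero reals, and the missing point is a measurable singleton. *)
Lemma measurable_invr d (T : measurableType d) (f : T -> R) :
  measurable_fun setT f -> measurable_fun setT (fun x => (f x)^-1).
Proof.
move=> mf; apply: (@measurableT_comp _ _ _ _ _ _ (@GRing.inv R)) => //.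
rewrite (_ : setT = [set x | x != 0] `|` [set (0 : R)]); last first.
  by apply/seteqP; split => x //= _; have [->|] := eqVneq x 0; [right|left].
have on0 : open [set x : R | x != 0] by exact: open_neq.
rewrite measurable_funU//; last exact: open_measurable.
split; last exact: measurable_fun_set1.
by apply: open_continuous_measurable_fun => // x; rewrite inE; exact: inv_continuous.
Qed.

Lemma measurable_natr_ler d (T : measurableType d) (f g : T -> R) :
  measurable_fun setT f -> measurable_fun setT g ->
  measurable_fun setT (fun x => ((f x <= g x)%R%:R)%:E : \bar R).
Proof.
move=> mf mg; apply/measurable_EFinP.
apply: (@measurableT_comp _ _ _ _ _ _ (fun b : bool => b%:R : R) setT); last exact: measurable_fun_ler.
by [].
Qed.

Lemma measurable_rV0 m : measurable ([set 0] : set (borel_rV R m)).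
Proof.
rewrite (_ : [set 0] = (fun x : borel_rV R m => nsq x) @^-1` [set 0]); last first.
  apply/seteqP; split => [x -> /=|x /= /eqP]; last by rewrite nsq_eq0 => /eqP.
  by apply/eqP; rewrite nsq_eq0.
rewrite -[X in measurable X]setTI; apply: measurable_nsq => //.
Qed.

Lemma leb_set0 m : leb R m.+1 [set 0] = 0%E.
Proof.
transitivity ((leb R m \x @lebesgue_measure R) ([set (0%R : 'rV_m)] `*` [set 0%R]))%E.
  rewrite -[LHS]/((leb R m \x @lebesgue_measure R)%E (@cons_rV R m @^-1` [set 0])).
  congr (_ _); apply/seteqP; split => -[y t] /=.
    move=> /rowP h; split; last by have := h (@lshift 1 m 0); rewrite cons_rV0 mxE.
    by apply/rowP => j; have := h (@rshift 1 m j); rewrite cons_rVS !mxE.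
  move=> [-> ->]; apply: eq_consP => [|j]; first by rewrite cons_rV0 mxE.
  by rewrite cons_rVS !mxE.
rewrite product_measure1E//; last exact: measurable_rV0.
by rewrite [X in (_ * X)%E]lebesgue_measure_set1 mule0.
Qed.

(** In positive dimension the origin is a null set, so the single point where a chart or an inverse
    norm degenerates can be ignored. *)
Lemma eq_integral_neq0 m (f g : 'rV[R]_m.+1 -> \bar R) :
  measurable_fun setT (f : borel_rV R m.+1 -> \bar R) ->
  measurable_fun setT (g : borel_rV R m.+1 -> \bar R) ->
  (forall x, x != 0 -> f x = g x) ->
  (\int[leb R m.+1]_x f x = \int[leb R m.+1]_x g x)%E.
Proof.
move=> mf mg fg; apply: ae_eq_integral => //.
exists [set 0]; split; [exact: measurable_rV0|exact: leb_set0|].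
move=> x /= h; apply: contrapT => /eqP x0; apply: h => _; exact: fg.
Qed.

End SquaredNorm.

Section ComplexStructure.
Variable R : realType.

Definition complex_structure m (J : 'M[R]_m) : Prop := J^T = - J /\ J *m J = - 1%:M.

Lemma dot_complex_structure m (J : 'M[R]_m) (x : 'rV_m) : complex_structure J ->
  (x *m (x *m J)^T) 0 0 = 0.
Proof.
move=> [JT _]; have : (x *m (x *m J)^T) 0 0 = - (x *m (x *m J)^T) 0 0.
  by rewrite {1}trmx_mul JT mulNmx mulmxN mulmxA mxE dot_sym.
lra.
Qed.

Lemma complex_structureM m (J : 'M[R]_m) : complex_structure J -> J *m J^T = 1%:M.
Proof. by move=> [-> JJ]; rewrite mulmxN JJ opprK. Qed.

Lemma nsq_complex m (J : 'M[R]_m) (x : 'rV_m) c s : complex_structure J ->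
  nsq (c *: x + s *: (x *m J)) = (c ^+ 2 + s ^+ 2) * nsq x.
Proof.
move=> cJ; rewrite nsqD !nsqZ (nsq_orthogonal _ (complex_structureM cJ)).
rewrite linearZ /= -scalemxAl -scalemxAr !mxE -/(_ 0 0).
have := dot_complex_structure x cJ; rewrite mxE => ->; ring.
Qed.

(** The product of the matrix with its transpose is scalar, which gives the square of the
    determinant; its absolute value is all a Jacobian requires. *)
Lemma det_complex k (J : 'M[R]_(k * 2)) c s : complex_structure J ->
  `|\det (c%:M + s *: J)| = (c ^+ 2 + s ^+ 2) ^+ k.
Proof.
move=> cJ; apply/eqP; rewrite -(@eqrXn2 _ 2)// ?normr_ge0// ?exprn_ge0 ?addr_ge0 ?sqr_ge0//.
rewrite real_normK ?num_real// expr2 -{2}det_tr -det_mulmx -exprM.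
suff -> : (c%:M + s *: J) *m (c%:M + s *: J)^T = (c ^+ 2 + s ^+ 2)%:M.
  by rewrite det_scalar.
rewrite linearD /= tr_scalar_mx linearZ /= (proj1 cJ) scalerN mulmxBr !mulmxDl.
rewrite -scalar_mxM mul_scalar_mx mul_mx_scalar -scalemxAl -scalemxAr (proj2 cJ).
rewrite !scalerN opprD opprK addrACA addrC -!expr2 scalerA scale_scalar_mx mulr1.
by rewrite addrC addrA subrK scale_scalar_mx -expr2 -raddfD.
Qed.

Definition J2 : 'M[R]_2 := delta_mx 0 1 - delta_mx 1 0.
Definition e0 : 'rV[R]_2 := delta_mx 0 0.

Lemma e0J2 : e0 *m J2 = delta_mx 0 1.
Proof. by rewrite /e0 /J2 mulmxBr !mul_delta_mx_cond /= mulr1n mulr0n subr0. Qed.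

Lemma complex_structure_J2 : complex_structure J2.
Proof.
split; first by rewrite /J2 linearB /= !trmx_delta opprB.
rewrite /J2 mulmxBl !mulmxBr !mul_delta_mx_cond /= !mulr0n !mulr1n.
rewrite sub0r subr0 -opprD; congr (- _).
by apply/matrixP => -[[|[|//]] i2] [[|[|//]] j2]; rewrite !mxE /= ?addr0 ?add0r.
Qed.

Lemma ord2P (i : 'I_2) : i = 0 \/ i = 1.
Proof. by case: i => [[|[|//]] i2]; [left|right]; exact: val_inj. Qed.

Lemma rV2E (u : 'rV[R]_2) : u = u 0 0 *: e0 + u 0 1 *: (e0 *m J2).
Proof.
rewrite e0J2; apply/rowP => i; rewrite !mxE /=.
by have [->|->] := ord2P i; rewrite /= ?mulr1 ?mulr0 ?addr0 ?add0r.
Qed.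

Lemma nsq_rV2 (u : 'rV[R]_2) : nsq u = u 0 0 ^+ 2 + u 0 1 ^+ 2.
Proof. by rewrite nsqE big_ord_recl big_ord1; congr (_ + u 0 _ ^+ 2); apply: val_inj. Qed.

Lemma nsq_e0 : nsq e0 = 1.
Proof. by rewrite nsq_rV2 !mxE /= expr1n expr0n addr0. Qed.

Local Notation mble m f := (measurable_fun [set: borel_rV R m] (f : borel_rV R m -> \bar R)).

Definition disc_moment k : \bar R :=
  (\int[leb R 2]_u ((nsq u ^+ k)%:E * ((nsq u <= 1)%R%:R)%:E))%E.

Lemma measurable_powr d (T : measurableType d) (h : T -> R) k :
  measurable_fun setT h -> measurable_fun setT (fun x => (h x ^+ k)%:E).
Proof. by move=> mh; apply/measurable_EFinP; exact: measurable_funX. Qed.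

Lemma integral_scale m (c : R) (f : 'rV[R]_m -> \bar R) : 0 < c ->
  mble m f -> (forall x, 0 <= f x)%E ->
  (\int[leb R m]_x f x = (c ^+ m)%:E * \int[leb R m]_x f (c *: x)%R)%E.
Proof.
move=> c0 mf f0.
have u : (c%:M : 'M[R]_m) \in unitmx by rewrite unitmxE det_scalar unitrX// unitfE gt_eqF.
rewrite -[LHS](linear_change_unit u mf f0) det_scalar ger0_norm ?exprn_ge0 ?ltW//.
by under eq_integral do rewrite mul_mx_scalar.
Qed.

(* In complex notation the chart is x = u (1, a) with u in C and a in C^k; L below is the
   matrix of multiplication by u, whose Jacobian in a is |u|^(2k). *)
Section Chart.
Variables (k N : nat) (J : 'M[R]_(k * 2)) (JN : 'M[R]_N) (W : 'M[R]_(2 + k * 2, N)).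
Hypotheses (cJ : complex_structure J) (cJN : complex_structure JN).
Hypothesis (JW : block_mx J2 0 0 J *m W = W *m JN).
Let q a := nsq (row_mx e0 a *m W).
Hypothesis q_gt0 : forall a, 0 < q a.

(** In complex notation the argument is u times (1, a); [JW] carries multiplication by u through
    [W], where it scales the squared norm by |u|^2. *)
Let chart_mulmx (u : 'rV_2) (a : 'rV_(k * 2)) :
  nsq (row_mx u (a *m ((u 0 0)%:M + u 0 1 *: J)) *m W) = nsq u * q a.
Proof.
rewrite /q nsq_rV2 -(nsq_complex _ _ _ cJN); congr nsq.
rewrite -mulmxA -JW mulmxA mul_row_block !mulmx0 add0r addr0.
rewrite !scalemxAl -mulmxDl; congr (_ *m _).
rewrite !scale_row_mx add_row_mx -rV2E; congr row_mx.
by rewrite mulmxDr mul_mx_scalar -scalemxAr.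
Qed.

(** [W] is kept general because the chart is used twice: with the identity it computes ball volumes,
    with [T^T] it evaluates the integral of a power of [q]. *)
Lemma ball_chart : (\int[leb R (2 + k * 2)]_x ((nsq (x *m W) <= 1)%R%:R)%:E =
  disc_moment k * \int[leb R (k * 2)]_a ((q a)^-1 ^+ k.+1)%:E)%E.
Proof.
have mI d (T : measurableType d) (h : T -> borel_rV R (2 + k * 2)) : measurable_fun setT h ->
    measurable_fun setT (fun x => ((nsq ((h x : 'rV_(2 + k * 2)) *m W) <= 1)%R%:R)%:E : \bar R).
  move=> mh; apply: measurable_natr_ler => //; apply: (@measurable_nsq _ _ _ _ (fun x => (h x : 'rV_(2 + k * 2)) *m W)).
  exact: measurable_mulmx.
have I0 b : (0 <= (b%:R : R)%:E)%E by rewrite lee_fin ler0n.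
rewrite integral_block2//; last exact: (mI _ _ id).
have mq d (T : measurableType d) (h : T -> borel_rV R (k * 2)) : measurable_fun setT h ->
    measurable_fun setT (fun x => q (h x)).
  move=> mh; apply: (@measurable_nsq _ _ _ _ (fun x => row_mx e0 (h x : 'rV_(k * 2)) *m W)).
  by apply: measurable_mulmx; apply: measurable_row_mx.
pose F (p : borel_rV R 2 * borel_rV R (k * 2)) : \bar R :=
  ((nsq p.1 ^+ k)%:E * ((nsq p.1 * q p.2 <= 1)%R%:R)%:E)%E.
have mF : measurable_fun setT F.
  apply: emeasurable_funM; first by apply: measurable_powr; exact: measurable_nsq.
  apply: measurable_natr_ler => //; apply: measurable_funM; first exact: measurable_nsq.
  exact: mq.
have F0 p : (0 <= F p)%E by rewrite mule_ge0// lee_fin exprn_ge0// nsq_ge0.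
transitivity (\int[leb R 2]_u \int[leb R (k * 2)]_a F (u, a))%E.
  (* The chart degenerates at [u = 0], a null set. *)
  apply: eq_integral_neq0.
  - have := measurable_fun_fubini_tonelli_F (m2 := leb R (k * 2))
      (fun p : borel_rV R 2 * borel_rV R (k * 2) => ((nsq (row_mx (p.1 : 'rV_2) (p.2 : 'rV_(k * 2)) *m W) <= 1)%R%:R)%:E).
    apply => //; apply: (mI _ _ (fun p : borel_rV R 2 * borel_rV R (k * 2) => row_mx (p.1 : 'rV_2) (p.2 : 'rV_(k * 2)))).
    exact: measurable_row_mx.
  - exact: measurable_fun_fubini_tonelli_F.
  move=> u u0.
  pose L := (u 0 0)%:M + u 0 1 *: J.
  have dL : `|\det L| = nsq u ^+ k by rewrite /L det_complex// -nsq_rV2.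
  have uL : L \in unitmx.
    by rewrite unitmxE unitfE -normr_eq0 dL expf_neq0// nsq_eq0.
  rewrite -(linear_change_unit uL); last 2 first.
  - apply: (mI _ _ (fun a : borel_rV R (k * 2) => row_mx u (a : 'rV_(k * 2)))).
    exact: measurable_row_mx.
  - by [].
  rewrite dL -ge0_integralZl//; last 2 first.
  - apply: (mI _ _ (fun a : borel_rV R (k * 2) => row_mx u ((a : 'rV_(k * 2)) *m L))).
    by apply: measurable_row_mx => //; exact: measurable_mulmx.
  - by rewrite lee_fin exprn_ge0// nsq_ge0.
  by apply: eq_integral => a _; rewrite chart_mulmx.
rewrite (fubini_tonelli F mF F0).
rewrite -ge0_integralZl//; last 3 first.
- by apply: measurable_powr; apply: measurable_invr; exact: mq.
- by move=> a _; rewrite lee_fin exprn_ge0// invr_ge0 ltW.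
- by apply: integral_ge0 => u _; rewrite mule_ge0// lee_fin exprn_ge0// nsq_ge0.
apply: eq_integral => a _.
(* Scaling [u] by [c] turns the condition |u|^2 q(a) <= 1 into the unit disc. The area contributes
   [c ^+ 2] and the Jacobian |u|^(2k) contributes [c ^+ (2 * k)], in total [(q a)^-1 ^+ k.+1]. *)
pose c := Num.sqrt (q a)^-1.
have c0 : 0 < c by rewrite sqrtr_gt0 invr_gt0.
have c2 : c ^+ 2 = (q a)^-1 by rewrite sqr_sqrtr// invr_ge0 ltW.
have mFa : mble 2 (fun u => F (u, a)) by apply: measurableT_comp => //; exact: measurable_fun_pair.
rewrite (integral_scale c0 mFa (fun=> F0 _)) /disc_moment.
rewrite -ge0_integralZl//; last 2 first.
- apply: (measurable_comp_rV (f := fun u => F (u, a)) (h := fun u : borel_rV R 2 => c *: (u : 'rV_2) : borel_rV R 2)) => //.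
  under eq_fun do rewrite -mul_mx_scalar; exact: measurable_mulmx.
- by rewrite lee_fin exprn_ge0// ltW.
rewrite [RHS]muleC -[RHS]ge0_integralZl//; last 3 first.
- apply: emeasurable_funM; first by apply: measurable_powr; exact: measurable_nsq.
  by apply: measurable_natr_ler => //; exact: measurable_nsq.
- by move=> u _; rewrite mule_ge0// lee_fin exprn_ge0// nsq_ge0.
- by rewrite lee_fin exprn_ge0// invr_ge0 ltW.
apply: eq_integral => u _; rewrite /F /= nsqZ c2 exprMn mulrAC mulVf ?gt_eqF// mul1r.
by rewrite exprS !EFinM !muleA.
Qed.

End Chart.

End ComplexStructure.

(* The radial moments over the disc are computed by Tonelli on {(u, s) : |u|^2 <= s <= 1}. *)
Section LayerCake.
Variable R : realType.
Local Notation mble m f := (measurable_fun [set: borel_rV R m] (f : borel_rV R m -> \bar R)).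

Lemma integral_exprn n (c : R) : 0 <= c <= 1 ->
  (\int[lebesgue_measure]_(s in `[c, 1%R]) (n.+1%:R * s ^+ n)%:E = (1 - c ^+ n.+1)%:E)%E.
Proof.
move=> /andP[c0]; rewrite le_eqVlt => /orP[/eqP ->|c1].
  by rewrite set_itv1 integral_set1 expr1n subrr.
rewrite (@continuous_FTC2 _ _ (fun y => y ^+ n.+1))//.
- by rewrite expr1n EFinB.
- apply: continuous_subspaceT => x; apply: cvgMr; exact: exprn_continuous.
- split; first by move=> x _; exact: exprn_derivable.
    by apply: cvg_at_right_filter; exact: exprn_continuous.
  by apply: cvg_at_left_filter; exact: exprn_continuous.
- by move=> x _; rewrite exp_derive1.
Qed.

Definition ball_ind m (x : 'rV[R]_m) : \bar R := ((nsq x <= 1)%R%:R)%:E.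

Lemma measurable_ball_ind m : mble m (@ball_ind m).
Proof. by apply: measurable_natr_ler => //; exact: (measurable_nsq (h := id)). Qed.

Lemma measurable_ball m : measurable (@euclidean_ball R m : set (borel_rV R m)).
Proof.
rewrite (_ : @euclidean_ball R m = (fun x : borel_rV R m => nsq x) @^-1` `]-oo, 1]).
  by rewrite -[X in measurable X]setTI; apply: (measurable_nsq (h := id)).
by apply/seteqP; split => x /=; rewrite in_itv/=; move/euclidean_ballE.
Qed.

Lemma leb_ballE m : leb R m (@euclidean_ball R m) = (\int[leb R m]_x ball_ind x)%E.
Proof.
rewrite -[LHS]mul1e -integral_cst; last exact: measurable_ball.
rewrite integral_mkcond; apply: eq_integral => x _; rewrite patchE /ball_ind.
case: ifPn => [|/negP]; rewrite inE => /euclidean_ballE; first by move=> ->.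
by move=> /negP/negbTE ->.
Qed.

Lemma sqr_coord_le m (x : 'rV[R]_m) i : x 0 i ^+ 2 <= nsq x.
Proof.
by rewrite nsqE (bigD1 i)//= lerDl sumr_ge0// => j _; exact: sqr_ge0.
Qed.

Lemma leb_ball_fin m : leb R m (@euclidean_ball R m) \is a fin_num.
Proof.
rewrite ge0_fin_numE//; apply: (@le_lt_trans _ _ (leb R m (@cube R m 1))).
  apply: le_measure; rewrite ?inE; [exact: measurable_ball|exact: measurable_cube|].
  move=> x /euclidean_ballE x1 i; rewrite -(@expr_le1 _ 2)//.
  by rewrite real_normK ?num_real// (le_trans _ x1)// sqr_coord_le.
by have /= -> := lebesgue_rV_cube m (@ler01 R); exact: ltry.
Qed.

Lemma leb_ball_gt0 m : (0 < leb R m (@euclidean_ball R m))%E.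
Proof.
(* The cube of half-side [k] fits in the ball because m k^2 <= 1; taking [m.+1] keeps [k] well
   behaved at [m = 0]. *)
pose k : R := (m.+1%:R)^-1.
have k0 : 0 < k by rewrite invr_gt0.
apply: (@lt_le_trans _ _ (leb R m (@cube R m k))).
  have /= -> := lebesgue_rV_cube m (ltW k0).
  by rewrite lte_fin exprn_gt0// mulr_gt0.
apply: le_measure; rewrite ?inE; [exact: measurable_cube|exact: measurable_ball|].
move=> x h; apply/euclidean_ballE.
rewrite nsqE; apply: (@le_trans _ _ (\sum_(i < m) k ^+ 2)).
  by apply: ler_sum => i _; rewrite -real_normK ?num_real// lerXn2r// ?nnegrE ?ltW//; exact: h.
rewrite sumr_const card_ord -mulr_natr /k exprVn mulrC ler_pdivrMr ?exprn_gt0// mul1r.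
by rewrite -natrX ler_nat; nia.
Qed.

Lemma disc_moment0 : disc_moment R 0 = leb R 2 (@euclidean_ball R 2).
Proof. by rewrite leb_ballE; apply: eq_integral => u _; rewrite expr0 mul1e. Qed.

(** The area of the unit disc is left unevaluated: it cancels in the ratio of consecutive Cauchy
    masses. *)
Lemma disc_momentE k :
  (disc_moment R k = leb R 2 (@euclidean_ball R 2) * (k.+1%:R^-1)%:E)%E.
Proof.
case: k => [|k]; first by rewrite disc_moment0 invr1 mule1.
set kap := leb R 2 _.
have [r rE] : exists r, kap = r%:E by exists (fine kap); rewrite fineK ?leb_ball_fin.
(* Integrating out [s] leaves 1 - |u|^(2(k+1)) on the disc; integrating out [u] leaves kap (k+1)
   s^(k+1) on [0, 1]. *)
pose phi (p : borel_rV R 2 * measurableTypeR R) : \bar R :=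
  ((k.+1%:R * p.2 ^+ k)%:E * (((0 <= p.2)%R%:R)%:E * (((p.2 <= 1)%R%:R)%:E * ((nsq p.1 <= p.2)%R%:R)%:E)))%E.
have mphi : measurable_fun setT phi.
  apply: emeasurable_funM.
    by apply/measurable_EFinP; apply: measurable_funM => //; exact: measurable_funX.
  apply: emeasurable_funM; first exact: measurable_natr_ler.
  apply: emeasurable_funM; first exact: measurable_natr_ler.
  by apply: measurable_natr_ler => //; exact: measurable_nsq.
have phi0 p : (0 <= phi p)%E.
  rewrite /phi; case: (lerP 0 p.2) => p0; last by rewrite mul0e mule0.
  by rewrite !mule_ge0// lee_fin mulr_ge0// exprn_ge0.
have I1 u : (\int[lebesgue_measure]_s phi (u, s) = (1 - nsq u ^+ k.+1)%:E * ball_ind u)%E.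
  rewrite /ball_ind; have [u1|u1] := lerP (nsq u) 1; last first.
    rewrite mule0 integral0_eq// => s _; rewrite /phi /=.
    have [s1|s1] := lerP s 1; last by rewrite mul0e !mule0.
    by rewrite (lt_geF (le_lt_trans s1 u1)) /= !mule0.
  rewrite mule1 -integral_exprn ?nsq_ge0// [RHS]integral_mkcond.
  apply: eq_integral => s _; rewrite /phi patchE /= mem_setE in_itv/=.
  have [s0|s0] := lerP 0 s; last first.
    by rewrite mul0e mule0 (lt_geF (lt_le_trans s0 (nsq_ge0 u))).
  rewrite mul1e; case: (nsq u <= s) => /=; last by rewrite !mule0.
  by case: (s <= 1) => /=; rewrite ?mul0e ?mule0 ?mule1 ?mul1e.
have I2 s : (\int[leb R 2]_u phi (u, s) = kap * (((0 <= s)%R%:R)%:E * (((s <= 1)%R%:R)%:E * (k.+1%:R * s ^+ k.+1)%:E)))%E.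
  have [s0|s0] := lerP 0 s; last first.
    rewrite mul0e mule0 integral0_eq// => u _; rewrite /phi /= (lt_geF s0) /=.
    by rewrite mul0e mule0.
  have ms : mble 2 (fun u => ((nsq u <= s)%R%:R)%:E).
    by apply: measurable_natr_ler => //; exact: (measurable_nsq (h := id)).
  transitivity ((k.+1%:R * s ^+ k)%:E * (((s <= 1)%R%:R)%:E * (kap * s%:E)))%E; last first.
    by rewrite mul1e rE -!EFinM exprS; move: ((s <= 1)%R%:R) => b; congr EFin; ring.
  under eq_integral do rewrite /phi /= s0 mul1e.
  rewrite ge0_integralZl//; last 2 first.
  - exact: emeasurable_funM.
  - by rewrite lee_fin mulr_ge0// exprn_ge0.
  congr (_ * _)%E; rewrite ge0_integralZl//; congr (_ * _)%E.
  move: s0; rewrite le_eqVlt => /orP[/eqP s0|s0].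
    rewrite -s0 in ms *; rewrite mule0; transitivity (\int[leb R 2]_u (cst 0 u : \bar R))%E; last by rewrite integral0.
    apply: eq_integral_neq0 => [|//|u u0]; first exact: ms.
    by rewrite -nsq_gt0 in u0; rewrite (lt_geF u0).
  rewrite (@integral_scale _ _ (Num.sqrt s)) ?sqrtr_gt0// sqr_sqrtr ?(ltW s0)// muleC.
  congr (_ * _)%E; rewrite /kap leb_ballE; apply: eq_integral => u _.
  by rewrite /ball_ind nsqZ sqr_sqrtr ?(ltW s0)// ger_pMr.
have : (\int[leb R 2]_u \int[@lebesgue_measure R]_s phi (u, s) =
    \int[@lebesgue_measure R]_s \int[leb R 2]_u phi (u, s))%E.
  exact: (fubini_tonelli phi mphi phi0).
under eq_integral do rewrite I1.
under [X in _ = X]eq_integral do rewrite I2.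
have -> : (\int[lebesgue_measure]_s (kap * (((0 <= s)%R%:R)%:E *
    (((s <= 1)%R%:R)%:E * (k.+1%:R * s ^+ k.+1)%:E))) =
    (r * k.+1%:R / k.+2%:R)%:E)%E.
  transitivity (\int[lebesgue_measure]_(s in `[0%R, 1%R])
      ((r * k.+1%:R / k.+2%:R)%:E * (k.+2%:R * s ^+ k.+1)%:E))%E.
    rewrite [RHS]integral_mkcond; apply: eq_integral => s _.
    rewrite patchE mem_setE in_itv/= rE.
    case: (0 <= s) => /=; last by rewrite mul0e mule0.
    case: (s <= 1) => /=; last by rewrite mul0e !mule0.
    by rewrite -!EFinM; congr EFin; rewrite !mul1r -!mulrA mulKf// pnatr_eq0.
  rewrite ge0_integralZl//; last 3 first.
  - by apply/measurable_EFinP; apply: measurable_funM => //; exact: measurable_funX.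
  - by move=> s /=; rewrite in_itv/= => /andP[s0 _]; rewrite lee_fin mulr_ge0// exprn_ge0.
  - rewrite lee_fin divr_ge0// mulr_ge0// -lee_fin -rE; exact: measure_ge0.
  by rewrite integral_exprn ?lexx ?ler01// expr0n/= subr0 mule1.
(* Adding the sought moment to the first iterated integral restores the area of the disc, so the
   moment is a difference of known quantities. *)
have : (\int[leb R 2]_u ((1 - nsq u ^+ k.+1)%:E * ball_ind u) + disc_moment R k.+1 = kap)%E.
  rewrite /disc_moment -ge0_integralD//.
  - rewrite /kap leb_ballE; apply: eq_integral => u _.
    by rewrite /ball_ind -!EFinM -EFinD -mulrDl subrK mul1r.
  - move=> u _; rewrite /ball_ind; have [u1|_] := lerP (nsq u) 1; last by rewrite mule0.
    by rewrite mule1 lee_fin subr_ge0 exprn_ile1// nsq_ge0.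
  - apply: emeasurable_funM; last exact: measurable_ball_ind.
    apply/measurable_EFinP; apply: measurable_funB => //; apply: measurable_funX.
    exact: (measurable_nsq (h := id)).
  - by move=> u _; rewrite mule_ge0// lee_fin exprn_ge0// nsq_ge0.
  - apply: emeasurable_funM; last exact: measurable_ball_ind.
    by apply: measurable_powr; exact: (measurable_nsq (h := id)).
move=> + E; rewrite E rE; case: (disc_moment R k.+1) => [x| |]//.
rewrite -EFinD => -[xE]; rewrite -EFinM; congr EFin.
have k2 : k.+2%:R = k.+1%:R + 1 :> R by rewrite natr1.
have b0 : k.+1%:R + 1 != 0 :> R by rewrite -k2 pnatr_eq0.
move: xE; rewrite k2; move: (k.+1%:R : R) b0 => a b0 xE.
have -> : x = r - r * a / (a + 1) by rewrite -[X in X - _]xE addrAC subrr add0r.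
by field.
Qed.

End LayerCake.

Lemma orthonormal_completion (F : rcfType) q m (B : 'M[F]_(q, q + m)) :
  B *m B^T = 1%:M ->
  exists A : 'M[F]_(m, q + m),
    A *m B^T = 0 /\ col_mx B A *m (col_mx B A)^T = 1%:M.
Proof.
move=> BB.
have rB : \rank B^T = q.
  by rewrite mxrank_tr; apply/eqP; apply/row_freeP; exists B^T.
have rK : \rank (kermx B^T) = m by rewrite mxrank_ker rB addKn.
have [C [fC eC]] : exists C : 'M[F]_(m, q + m), row_free C /\ (C :=: kermx B^T)%MS.
  (* The number [m] also occurs in the width [q + m], which is abstracted before [m] is replaced by
     the rank of the kernel. *)
  move: (kermx B^T) rK => K rK; move: (q + m)%N K rK => N K <-.
  exists (row_base K); split; [exact: row_base_free|exact: eq_row_base].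
have [A [oA eA]] := orthonormal_row_basis fC.
have AB : A *m B^T = 0 by apply/eqP; rewrite -sub_kermx -eC -eA.
exists A; split => //; rewrite tr_col_mx mul_col_row BB oA AB.
by rewrite -[B *m A^T]trmxK trmx_mul trmxK AB trmx0 -scalar_mx_block.
Qed.

(** * Averaging over complex hyperplanes *)

Section KeyIdentity.
Variable R : realType.
Local Notation mble m f := (measurable_fun [set: borel_rV R m] (f : borel_rV R m -> \bar R)).

(** [x *m (complex_rows J a)^T] is the Hermitian product of [x] and [a], written as a pair of
    reals. *)
Definition complex_rows m (J : 'M[R]_m) (a : 'rV[R]_m) : 'M[R]_(1 + 1, m) :=
  col_mx a (a *m J).

Lemma complex_rowsM m (J : 'M[R]_m) a : complex_structure J ->
  complex_rows J a *m (complex_rows J a)^T = (nsq a)%:M.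
Proof.
move=> cJ; have aaJ := dot_complex_structure a cJ.
rewrite /complex_rows tr_col_mx mul_col_row [RHS](@scalar_mx_block _ 1 1).
congr block_mx; apply/matrixP => i j; rewrite !ord1 [RHS]mxE ?eqxx ?mulr1n//.
  by rewrite dot_sym.
by rewrite -[LHS]/(nsq (a *m J)) (nsq_orthogonal _ (complex_structureM cJ)).
Qed.

(** The constant c_k of the overview. *)
Definition cauchy_mass k : \bar R :=
  (\int[leb R (k * 2)]_b ((1 + nsq b)^-1 ^+ k.+1)%:E)%E.

Lemma dotC m (x y : 'rV[R]_m) : x *m y^T = y *m x^T.
Proof. by apply/matrixP => i j; rewrite !ord1; exact: dot_sym. Qed.

Lemma measurable_scalerv d (T : measurableType d) m (h : T -> borel_rV R m) c :
  measurable_fun setT h -> measurable_fun setT (fun x => c *: (h x : 'rV[R]_m) : borel_rV R m).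
Proof. by move=> mh; under eq_fun do rewrite -mul_mx_scalar; exact: measurable_mulmx. Qed.

Lemma orthogonal_det m (O : 'M[R]_m) : O *m O^T = 1%:M -> `|\det O| = 1.
Proof.
move=> oO; have : \det O * \det O = 1 by rewrite -{2}det_tr -det_mulmx oO det1.
by rewrite -expr2 -real_normK ?num_real// => /eqP; rewrite sqrp_eq1// => /eqP.
Qed.

Lemma orthogonal_unit m (O : 'M[R]_m) : O *m O^T = 1%:M -> O \in unitmx.
Proof. by move=> /mulmx1_unit[]. Qed.

Lemma integral_orthogonal m (O : 'M[R]_m) (f : 'rV[R]_m -> \bar R) :
  O *m O^T = 1%:M -> mble m f -> (forall x, 0 <= f x)%E ->
  (\int[leb R m]_x f (x *m O)%R = \int[leb R m]_x f x)%E.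
Proof.
move=> oO mf f0; rewrite integral_linear_change ?orthogonal_unit//.
by rewrite orthogonal_det// invr1 mul1e.
Qed.

Lemma measurable_cauchy d (T : measurableType d) m (h : T -> borel_rV R m) (c : R) k :
  measurable_fun setT h ->
  measurable_fun setT (fun x => ((c + nsq (h x))^-1 ^+ k)%:E : \bar R).
Proof.
move=> mh; apply: measurable_powr; apply: measurable_invr.
by apply: measurable_funD => //; exact: measurable_nsq.
Qed.

Lemma integralZ_leb m (c : \bar R) (f : 'rV[R]_m -> \bar R) :
  mble m f -> (forall x, 0 <= f x)%E -> (0 <= c)%E ->
  (\int[leb R m]_x (c * f x) = c * \int[leb R m]_x f x)%E.
Proof.
move=> mf f0 c0; apply: ge0_integralZl; [exact: measurableT|exact: mf| |exact: c0].
by move=> x _; exact: f0.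
Qed.

Lemma cauchy_ge0 m (c : R) k (x : 'rV[R]_m) : 0 <= c ->
  (0 <= ((c + nsq x)^-1 ^+ k)%:E)%E.
Proof. by move=> c0; rewrite lee_fin exprn_ge0// invr_ge0 addr_ge0 ?nsq_ge0. Qed.

(** Scaling [b] by the root of [s] produces s^k against s^-(k+1). The single inverse power left over
    becomes the |x|^-2 of the averaging identity. *)
Lemma integral_cauchy k (s : R) : 0 < s ->
  (\int[leb R (k * 2)]_b ((s + nsq b)^-1 ^+ k.+1)%:E = s^-1%:E * cauchy_mass k)%E.
Proof.
move=> s0.
have q0 : 0 < Num.sqrt s by rewrite sqrtr_gt0.
have m1 := measurable_cauchy (1 : R) k.+1 (@measurable_id _ (borel_rV R (k * 2)) setT).
have ms := measurable_cauchy s k.+1 (@measurable_id _ (borel_rV R (k * 2)) setT).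
have mq := measurable_cauchy s k.+1 (measurable_scalerv (Num.sqrt s)
  (@measurable_id _ (borel_rV R (k * 2)) setT)).
rewrite (integral_scale q0 ms (fun x => cauchy_ge0 k.+1 x (ltW s0))).
have -> : Num.sqrt s ^+ (k * 2) = s ^+ k by rewrite mulnC exprM sqr_sqrtr// ltW.
have sk0 : (0 <= (s ^+ k)%:E)%E by rewrite lee_fin exprn_ge0// ltW.
have si0 : (0 <= s^-1%:E)%E by rewrite lee_fin invr_ge0 ltW.
rewrite /cauchy_mass -(integralZ_leb m1 (fun x => cauchy_ge0 k.+1 x ler01) si0).
rewrite -(integralZ_leb mq (fun x => cauchy_ge0 k.+1 _ (ltW s0)) sk0).
apply: eq_integral => b _; rewrite nsqZ sqr_sqrtr ?(ltW s0)// -!EFinM; congr EFin.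
rewrite -[X in X + _]mulr1 -mulrDr invfM exprMn mulrA; congr (_ * _).
by rewrite exprS mulrCA -exprMn divff ?gt_eqF// expr1n mulr1.
Qed.

Section Fiber.
Variables (k : nat) (J : 'M[R]_(2 + k * 2)) (cJ : complex_structure J).
Variables (h : 'rV[R]_2 -> \bar R).
Hypotheses (mh : mble 2 h) (h0 : forall u, (0 <= h u)%E).

(** After a rotation of [a], the argument of [h] depends only on the two real coordinates along the
    complex line attached to [y]; the other [k] complex coordinates are integrated out by
    [integral_cauchy]. *)
Lemma fiber_integral (y : 'rV[R]_(2 + k * 2)) : y != 0 ->
  (\int[leb R (2 + k * 2)]_a (((1 + nsq a)^-1 ^+ k.+1)%:E * h (- (y *m (complex_rows J a)^T))%R)
   = cauchy_mass k * \int[leb R 2]_u (((nsq y + nsq u)^-1)%:E * h u))%E.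
Proof.
move=> y0.
(* The Hermitian product is conjugate-linear in [a], so as a linear map of [a] it is described by
   the conjugate structure [J^T]. *)
pose E : 'M[R]_(1 + 1, 2 + k * 2) := - complex_rows J^T y.
have EE : E *m E^T = (nsq y)%:M.
  rewrite /E linearN /= mulmxN mulNmx opprK complex_rowsM//.
  case: cJ => JT JJ; split; first by rewrite trmxK JT opprK.
  by rewrite JT mulmxN mulNmx opprK.
have yE a : - (y *m (complex_rows J a)^T) = a *m E^T.
  rewrite /E linearN /= mulmxN; congr (- _).
  rewrite /complex_rows !tr_col_mx !mul_mx_row (dotC y a) (dotC y (a *m J)).
  by rewrite trmx_mul trmxK mulmxA.
pose r := Num.sqrt (nsq y).
have r0 : 0 < r by rewrite sqrtr_gt0 nsq_gt0.
have r2 : r ^+ 2 = nsq y by rewrite sqr_sqrtr// nsq_ge0.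
have BB : (r^-1 *: E) *m (r^-1 *: E)^T = 1%:M.
  rewrite linearZ /= -scalemxAl -scalemxAr EE scalerA scale_scalar_mx -r2.
  by rewrite -invfM -expr2 mulVf// gt_eqF// exprn_gt0.
have [A [AB oO]] := orthonormal_completion BB.
set O := col_mx _ A in oO.
have OE (u : 'rV[R]_2) (b : 'rV[R]_(k * 2)) : row_mx u b *m O *m E^T = r *: u.
  rewrite /O mul_row_col mulmxDl -!mulmxA -scalemxAl EE.
  move: AB; rewrite linearZ /= -scalemxAr => /eqP; rewrite scaler_eq0 invr_eq0 gt_eqF//= => /eqP ->.
  rewrite mulmx0 addr0 scale_scalar_mx mul_mx_scalar -r2 expr2 mulrA mulVf ?mul1r//.
  by rewrite gt_eqF.
pose F (x : 'rV[R]_(2 + k * 2)) := (((1 + nsq x)^-1 ^+ k.+1)%:E * h (x *m E^T)%R)%E.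
have mF : mble (2 + k * 2) F.
  apply: emeasurable_funM; first exact: (measurable_cauchy 1 k.+1 (h := id)).
  apply: (measurable_comp_rV (h := fun x : borel_rV R (2 + k * 2) => (x : 'rV_(2 + k * 2)) *m E^T) mh).
  exact: measurable_mulmx.
have F0 x : (0 <= F x)%E.
  by rewrite mule_ge0// lee_fin exprn_ge0// invr_ge0 addr_ge0 ?nsq_ge0.
transitivity (\int[leb R (2 + k * 2)]_x F x)%E.
  by apply: eq_integral => a _; rewrite yE.
rewrite -(integral_orthogonal oO mF F0) (integral_block2 (measurable_fun_mulmx O mF) (fun=> F0 _)).
pose G (u : 'rV[R]_2) := ((nsq y + nsq u)^-1%:E * h u)%E.
have mG : mble 2 G.
  apply: emeasurable_funM; last exact: mh.
  apply/measurable_EFinP; apply: measurable_invr; apply: measurable_funD => //.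
  exact: (measurable_nsq (h := id)).
have G0 u : (0 <= G u)%E.
  by rewrite mule_ge0// lee_fin invr_ge0 addr_ge0// nsq_ge0.
have mGr : mble 2 (fun u => G (r *: u)).
  apply: (measurable_comp_rV (h := fun u : borel_rV R 2 => r *: (u : 'rV_2) : borel_rV R 2) mG).
  exact: (measurable_scalerv _ (h := id)).
have C0 : (0 <= cauchy_mass k)%E by apply: integral_ge0 => b _; exact: cauchy_ge0.
have r20 : (0 <= (r ^+ 2)%:E)%E by rewrite lee_fin exprn_ge0// ltW.
(* As |y|^2 = r^2, scaling [u] by [r] turns (|y|^2 + |u|^2)^-1 into r^-2 (1 + |u|^2)^-1, and the
   area factor r^2 compensates. *)
rewrite -[X in (_ * X)%E]/(\int[leb R 2]_u G u)%E (integral_scale r0 mG G0).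
have mrG : mble 2 (fun u => (r ^+ 2)%:E * G (r *: u))%E.
  exact: (emeasurable_funM (measurable_cst _) mGr).
rewrite -(integralZ_leb mGr (fun=> G0 _) r20).
rewrite -(integralZ_leb mrG (fun=> mule_ge0 r20 (G0 _)) C0).
apply: eq_integral => u _.
have s0 : 0 < 1 + nsq u by rewrite ltr_pwDl// nsq_ge0.
transitivity (h (r *: u)%R * \int[leb R (k * 2)]_b ((1 + nsq u + nsq b)^-1 ^+ k.+1)%:E)%E.
  rewrite -(integralZ_leb (measurable_cauchy (1 + nsq u) k.+1 (@measurable_id _ (borel_rV R (k * 2)) setT))
    (fun b => cauchy_ge0 k.+1 b (ltW s0)) (h0 _)).
  apply: eq_integral => b _.
  by rewrite /F OE (nsq_orthogonal _ oO) nsq_row_mx addrA muleC.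
have -> : ((r ^+ 2)%:E * G (r *: u) = (1 + nsq u)^-1%:E * h (r *: u)%R)%E.
  rewrite /G nsqZ -r2 muleA -EFinM; congr (_%:E * _)%E.
  rewrite -{2}[r ^+ 2]mulr1 -mulrDr invfM mulrA divff ?mul1r//.
  by rewrite expf_neq0// gt_eqF.
rewrite (integral_cauchy k s0).
by rewrite muleC -muleA muleCA.
Qed.

End Fiber.

Lemma measurable_complex_rows d (T : measurableType d) m (J : 'M[R]_m)
    (h a : T -> borel_rV R m) : measurable_fun setT h -> measurable_fun setT a ->
  measurable_fun setT (fun x => (h x : 'rV[R]_m) *m (complex_rows J (a x))^T : borel_rV R (1 + 1)).
Proof.
move=> mh ma; have mdot (b : T -> borel_rV R m) : measurable_fun setT b ->
    measurable_fun setT (fun x => (h x : 'rV[R]_m) *m (b x : 'rV[R]_m)^T : borel_rV R 1).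
  move=> mb; apply: measurable_fun_borel_rV => i; rewrite (ord1 i); under eq_fun do rewrite mxE.
  apply: measurable_sum => j; apply: measurable_funM; first exact: measurable_coordP.
  by under eq_fun do rewrite mxE; exact: measurable_coordP.
under eq_fun do rewrite /complex_rows tr_col_mx mul_mx_row.
apply: measurable_row_mx; first exact: mdot.
by apply: (mdot (fun x => (a x : 'rV_m) *m J)); exact: measurable_mulmx.
Qed.

Lemma measurable_section p (J : 'M[R]_p) (f : 'rV[R]_(2 + p) -> \bar R) :
  mble (2 + p) f -> measurable_fun setT (fun x : borel_rV R p * borel_rV R p =>
    f (row_mx (- ((x.2 : 'rV_p) *m (complex_rows J x.1)^T)) (x.2 : 'rV_p))).
Proof.
move=> mf.
apply: (measurable_comp_rV (h := fun x : borel_rV R p * borel_rV R p =>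
    row_mx (- ((x.2 : 'rV_p) *m (complex_rows J x.1)^T)) (x.2 : 'rV_p)) mf).
apply: measurable_row_mx; last exact: measurable_snd.
under eq_fun do rewrite -scaleN1r.
exact: (measurable_scalerv _ (measurable_complex_rows J measurable_snd measurable_fst)).
Qed.

(* y |-> (-<y, a>, y) parametrises the complex hyperplane orthogonal to (1, a). *)
Lemma hyperplane_average k (J : 'M[R]_(2 + k * 2)) (cJ : complex_structure J)
    (f : 'rV[R]_(2 + (2 + k * 2)) -> \bar R) :
  mble (2 + (2 + k * 2)) f -> (forall x, 0 <= f x)%E ->
  (\int[leb R (2 + k * 2)]_a (((1 + nsq a)^-1 ^+ k.+1)%:E *
      \int[leb R (2 + k * 2)]_y f (row_mx (- (y *m (complex_rows J a)^T)) y)) =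
   cauchy_mass k * \int[leb R (2 + (2 + k * 2))]_x ((nsq x)^-1%:E * f x))%E.
Proof.
move=> mf f0.
have C0 : (0 <= cauchy_mass k)%E by apply: integral_ge0 => b _; exact: cauchy_ge0.
have mg : mble (2 + (2 + k * 2)) (fun x => (nsq x)^-1%:E * f x)%E.
  apply: emeasurable_funM; last exact: mf.
  by apply/measurable_EFinP; apply: measurable_invr; exact: (measurable_nsq (h := id)).
have g0 x : (0 <= (nsq x)^-1%:E * f x)%E by rewrite mule_ge0// lee_fin invr_ge0 nsq_ge0.
rewrite (integral_block1 mg g0).
pose P (p : borel_rV R (2 + k * 2) * borel_rV R (2 + k * 2)) : \bar R :=
  (((1 + nsq p.1)^-1 ^+ k.+1)%:E * f (row_mx (- ((p.2 : 'rV_(2 + k * 2)) *m (complex_rows J p.1)^T)) (p.2 : 'rV_(2 + k * 2))))%E.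
have mP : measurable_fun setT P.
  apply: emeasurable_funM; first exact: (measurable_cauchy 1 k.+1 (h := fst)).
  exact: (measurable_section J mf).
have P0 p : (0 <= P p)%E by rewrite mule_ge0// cauchy_ge0.
transitivity (\int[leb R (2 + k * 2)]_a \int[leb R (2 + k * 2)]_y P (a, y))%E.
  apply: eq_integral => a _; rewrite -integralZ_leb//.
  - apply: (measurable_comp_rV (h := fun y : borel_rV R (2 + k * 2) =>
      row_mx (- ((y : 'rV_(2 + k * 2)) *m (complex_rows J a)^T)) (y : 'rV_(2 + k * 2))) mf).
    apply: measurable_row_mx => //; under eq_fun do rewrite -mulmxN; exact: measurable_mulmx.
  - exact: cauchy_ge0.
rewrite (fubini_tonelli P mP P0) -(integralZ_leb _ _ C0); last 2 first.
- exact: (measurable_fun_fubini_tonelli_F (m2 := leb R 2)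
    (fun p : borel_rV R (2 + k * 2) * borel_rV R 2 => (nsq (row_mx (p.2 : 'rV_2) (p.1 : 'rV_(2 + k * 2))))^-1%:E *
      f (row_mx (p.2 : 'rV_2) (p.1 : 'rV_(2 + k * 2))))%E (measurable_comp_rV mg (measurable_row_mx measurable_snd measurable_fst))).
- by move=> y; apply: integral_ge0 => u _.
(* The fibre formula excludes [y = 0], where the complex line of [y] is undefined. *)
apply: eq_integral_neq0.
- exact: (measurable_fun_fubini_tonelli_G _ mP).
- apply: emeasurable_funM => //.
  exact: (measurable_fun_fubini_tonelli_F (m2 := leb R 2)
    (fun p : borel_rV R (2 + k * 2) * borel_rV R 2 => (nsq (row_mx (p.2 : 'rV_2) (p.1 : 'rV_(2 + k * 2))))^-1%:E *
      f (row_mx (p.2 : 'rV_2) (p.1 : 'rV_(2 + k * 2))))%E (measurable_comp_rV mg (measurable_row_mx measurable_snd measurable_fst))).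
move=> y y0; rewrite /P /=.
rewrite (@fiber_integral k J cJ (fun u => f (row_mx u y)))//.
  by congr (_ * _)%E; apply: eq_integral => u _; rewrite nsq_row_mx addrC.
apply: (measurable_comp_rV (h := fun u : borel_rV R 2 => row_mx (u : 'rV_2) y) mf).
by apply: measurable_row_mx => //; exact: measurable_cst.
Qed.

End KeyIdentity.

(** * Section masses under a complex-linear map, and the slicing inequality *)

Section Sections.
Variable R : realType.
Local Notation mble m f := (measurable_fun [set: borel_rV R m] (f : borel_rV R m -> \bar R)).

Definition block_structure p (J : 'M[R]_p) : 'M[R]_(2 + p) := block_mx (J2 R) 0 0 J.

Lemma complex_structure_block p (J : 'M[R]_p) :
  complex_structure J -> complex_structure (block_structure J).
Proof.
move=> [JT JJ]; have [J2T J2J] := complex_structure_J2 R; split.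
  by rewrite /block_structure tr_block_mx !trmx0 J2T JT opp_block_mx !oppr0.
rewrite /block_structure mulmx_block J2J JJ !mulmx0 !mul0mx !addr0 !add0r.
by rewrite [in RHS]scalar_mx_block opp_block_mx !oppr0.
Qed.

Section Jacobian.
Variables (p : nat) (J : 'M[R]_p) (JN T : 'M[R]_(2 + p)).
Hypotheses (cJ : complex_structure J) (cJN : complex_structure JN).
Hypotheses (JT : JN *m T = T *m block_structure J) (dT : `|\det T| = 1).

Let uT : T \in unitmx.
Proof. by rewrite unitmxE unitfE -normr_eq0 dT oner_eq0. Qed.

Lemma intertwine_tr : block_structure J *m T^T = T^T *m JN.
Proof.
have := congr1 trmx JT; rewrite !trmx_mul (proj1 cJN) (proj1 (complex_structure_block cJ)).
by rewrite mulmxN mulNmx => /oppr_inj.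
Qed.

(* invmx T maps the hyperplane orthogonal to (1, a) onto the one orthogonal to conormal a. *)
Definition conormal (a : 'rV[R]_p) : 'rV[R]_(2 + p) := row_mx (e0 R) a *m T^T.

Lemma conormal_gt0 a : 0 < nsq (conormal a).
Proof.
rewrite nsq_gt0; apply/eqP => h.
have : row_mx (e0 R) a = 0.
  by rewrite -[LHS](mulmxK (_ : T^T \in unitmx)) ?unitmx_tr// -/(conormal a) h mul0mx.
move=> /eqP; rewrite row_mx_eq0 => /andP[/eqP e _].
by have := nsq_e0 R; rewrite e nsqE big1 => [/eqP|i _]; rewrite ?mxE ?expr0n// eq_sym oner_eq0.
Qed.

Lemma complex_rows_block a : complex_rows (block_structure J) (row_mx (e0 R) a) =
  row_mx 1%:M (complex_rows J a).
Proof.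
rewrite /complex_rows /block_structure mul_row_block !mulmx0 addr0 add0r.
rewrite -block_mxEv block_mxEh; congr row_mx.
apply/matrixP => i j; rewrite e0J2.
have [k ->|k ->] := @split_ordP 1 1 i; rewrite (ord1 k) ?col_mxEu ?col_mxEd !mxE -!val_eqE;
  by have [-> | ->] := ord2P j.
Qed.

Let q a := nsq (conormal a).

(** The rows [G] of the chart are [S] times an orthonormal frame [A] of the hyperplane normal to
    [xi], so the integral is a section mass divided by [|\det S|]. Since [|\det T| = 1], this
    Jacobian is exactly [q a]. *)
Lemma section_integral (f : 'rV[R]_(2 + p) -> \bar R) (M : \bar R) (a : 'rV[R]_p) :
  mble (2 + p) f -> (forall x, 0 <= f x)%E ->
  (forall (xi : 'rV[R]_(2 + p)) (A : 'M[R]_(p, 2 + p)), nsq xi = 1 ->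
    A *m A^T = 1%:M -> A *m (complex_rows JN xi)^T = 0 ->
    (\int[leb R p]_y f (y *m A)%R <= M)%E) ->
  (\int[leb R p]_y f (row_mx (- (y *m (complex_rows J a)^T)) y *m invmx T)%R
    <= (q a)^-1%:E * M)%E.
Proof.
move=> mf f0 fM.
have q0 : 0 < q a := conormal_gt0 a.
pose r := Num.sqrt (q a).
have r0 : 0 < r by rewrite sqrtr_gt0.
have r2 : r ^+ 2 = q a by rewrite sqr_sqrtr// ltW.
pose xi := r^-1 *: conormal a.
have xi1 : nsq xi = 1 by rewrite nsqZ -/(q a) -r2 -exprMn mulVf ?expr1n// gt_eqF.
pose B := complex_rows JN xi.
have BB : B *m B^T = 1%:M by rewrite /B complex_rowsM// xi1.
have [A [AB oO]] := orthonormal_completion BB.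
set O := col_mx B A in oO.
pose C := complex_rows J a.
pose V0 : 'M[R]_(1 + 1, 2 + p) := row_mx 1%:M C.
pose G0 : 'M[R]_(p, 2 + p) := row_mx (- C^T) 1%:M.
pose V := V0 *m T^T; pose G := G0 *m invmx T.
have VE : V = r *: B.
  rewrite /V /V0 -complex_rows_block /B /xi /complex_rows /conormal.
  rewrite mul_col_mx -!mulmxA intertwine_tr -scalemxAl scale_col_mx !scalerA divff ?gt_eqF//.
  by rewrite !scale1r mulmxA.
have GV : G *m V^T = 0.
  rewrite /G /V trmx_mul trmxK mulmxA mulmxKV// /G0 /V0 tr_row_mx mul_row_col.
  by rewrite trmx1 mulmx1 mul1mx addNr.
have GB : G *m B^T = 0.
  by apply/eqP; have := GV; rewrite VE linearZ /= -scalemxAr => /eqP; rewrite scaler_eq0 gt_eqF.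
have AA : A *m A^T = 1%:M.
  by have := oO; rewrite /O tr_col_mx mul_col_row [RHS]scalar_mx_block => /eq_block_mx[].
pose S := G *m A^T.
have SA : S *m A = G.
  have : G *m (O^T *m O) = G by rewrite (mulmx1C oO) mulmx1.
  by rewrite /O tr_col_mx mul_row_col mulmxDr !mulmxA GB mul0mx add0r.
(* Evaluate the determinant of D = [V; G] twice: against T K, with K unitriangular, and
   against the orthogonal O. *)
have dS : `|\det S| = q a.
  pose D : 'M[R]_(1 + 1 + p) := col_mx V G.
  have dDT : \det D * \det T = q a ^+ 2.
    pose K2 : 'M[R]_(1 + 1 + p, p) := col_mx 0 1%:M.
    pose K : 'M[R]_(1 + 1 + p) := row_mx V0^T K2.
    have dK : \det K = 1.
      by rewrite /K /V0 tr_row_mx trmx1 -block_mxEh det_lblock !det1 mulr1.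
    have GT : G *m T = G0 by rewrite /G mulmxKV.
    have G0V0 : G0 *m V0^T = 0.
      by rewrite /G0 /V0 tr_row_mx mul_row_col trmx1 mulmx1 mul1mx addNr.
    have G0K : G0 *m K2 = 1%:M by rewrite /G0 /K2 mul_row_col mulmx0 add0r mulmx1.
    rewrite -[LHS]mulr1 -dK -!det_mulmx /D mul_col_mx GT /K mul_col_row G0V0 G0K.
    rewrite det_ublock det1 mulr1 -mulmxA -[T *m _]trmxK trmx_mul trmxK -/V.
    by rewrite VE linearZ /= -scalemxAl -scalemxAr BB scalerA scale_scalar_mx mulr1 det_scalar -expr2 r2.
  have dDO : \det D * \det O^T = q a * \det S.
    rewrite -det_mulmx /D /O tr_col_mx mul_col_row GB -/S det_ublock VE -scalemxAl BB.
    by rewrite scale_scalar_mx mulr1 det_scalar r2.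
  have dO : `|\det O^T| = 1 by rewrite det_tr orthogonal_det.
  have := congr1 Num.norm dDT; have := congr1 Num.norm dDO.
  rewrite !normrM dT dO !mulr1 => -> /eqP.
  by rewrite (gtr0_norm q0) => /eqP/(mulfI (lt0r_neq0 q0)).
have uS : S \in unitmx by rewrite unitmxE unitfE -normr_eq0 dS gt_eqF.
have yG y : row_mx (- (y *m C^T)) y *m invmx T = y *m S *m A.
  by rewrite -mulmxA SA /G /G0 mulmxA mul_mx_row mulmxN mulmx1.
under eq_integral do rewrite yG.
have mfA : mble p (fun y => f (y *m A)).
  apply: (measurable_comp_rV (h := fun y : borel_rV R p => (y : 'rV_p) *m A) mf).
  exact: measurable_mulmx.
rewrite (integral_linear_change uS mfA (fun=> f0 _)) dS.
by apply: lee_wpmul2l; [rewrite lee_fin invr_ge0 ltW|exact: (fM xi)].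
Qed.

End Jacobian.

(** Induction with integer powers: multiply the previous case by [x] and add the rearrangement
    inequality [h], which holds because [x ^+ j] and [y ^+ j] are ordered as [x] and [y]. *)
Lemma amgm k (x y : R) : 0 <= x -> 0 <= y ->
  k.+2%:R * (x ^+ k.+1 * y) <= k.+1%:R * x ^+ k.+2 + y ^+ k.+2.
Proof.
move=> x0 y0.
have h j : (x ^+ j - y ^+ j) * (x - y) >= 0.
  have [xy|yx] := lerP x y.
    by rewrite mulr_le0// subr_le0// lerXn2r.
  by have yx' := ltW yx; rewrite mulr_ge0// subr_ge0// lerXn2r.
elim: k => [|k IH].
  have := h 1%N; rewrite !expr1 !exprS expr0; nra.
have := h k.+2; have := ler_wpM2l x0 IH.
rewrite -!natr1 !exprS; move: (x ^+ k) (y ^+ k) => X Y.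
nra.
Qed.

Lemma disc_moment_gt0 k : exists2 c : R, 0 < c & disc_moment R k = c%:E.
Proof.
have := leb_ball_gt0 R 2; have := leb_ball_fin R 2; rewrite disc_momentE.
case: (leb R 2 _) => [r _|//|//]; rewrite lte_fin => r0.
by exists (r / k.+1%:R); rewrite ?divr_gt0// EFinM.
Qed.

Section Assembly.
Variables (k : nat) (J : 'M[R]_(2 + k * 2)) (JN T : 'M[R]_(2 + (2 + k * 2))).
Hypotheses (cJ : complex_structure J) (cJN : complex_structure JN).
Hypotheses (JT : JN *m T = T *m block_structure J) (dT : `|\det T| = 1).
Let q a := nsq (conormal T a).
Let N := (2 + (2 + k * 2))%N.

(** The ellipsoid |x T^T| <= 1 has the volume of the unit ball because [|\det T| = 1]. Both volumes
    are computed in the chart with the same disc moment, which is positive and finite and therefore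
    cancels. *)
Lemma integral_conormal :
  (\int[leb R (2 + k * 2)]_a ((q a)^-1 ^+ k.+2)%:E = cauchy_mass R k.+1)%E.
Proof.
have b1 := @ball_chart R k.+1 _ J JN T^T cJ cJN (intertwine_tr cJ cJN JT) (conormal_gt0 dT).
have JW : block_mx (J2 R) 0 0 J *m 1%:M = 1%:M *m block_structure J by rewrite mulmx1 mul1mx.
have q1 a : nsq (row_mx (e0 R) a *m 1%:M) = 1 + nsq (a : 'rV[R]_(k.+1 * 2)).
  by rewrite mulmx1 nsq_row_mx nsq_e0.
have q1_gt0 a : 0 < nsq (row_mx (e0 R) (a : 'rV[R]_(k.+1 * 2)) *m 1%:M).
  by rewrite q1 ltr_pwDl// nsq_ge0.
have := @ball_chart R k.+1 _ J (block_structure J) 1%:M cJ (complex_structure_block cJ) JW q1_gt0.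
under [X in _ = (_ * X)%E -> _]eq_integral do rewrite q1.
have uT : T^T \in unitmx.
  by rewrite unitmx_tr unitmxE unitfE -normr_eq0 dT oner_eq0.
have : (\int[leb R (2 + k.+1 * 2)]_x ((nsq (x *m T^T) <= 1)%R%:R)%:E =
    \int[leb R (2 + k.+1 * 2)]_x ((nsq (x *m 1%:M) <= 1)%R%:R)%:E)%E.
  under [RHS]eq_integral do rewrite mulmx1.
  rewrite (integral_linear_change uT (@measurable_ball_ind R N)); last first.
    by move=> x; rewrite lee_fin.
  by rewrite det_tr dT invr1 mul1e.
move=> E b2; move: b1; rewrite E b2.
have [c c0 ->] := disc_moment_gt0 k.+1.
move=> /(congr1 (mule c^-1%:E)); rewrite !muleA -EFinM mulVf ?gt_eqF// !mul1e => H.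
exact/esym/H.
Qed.

Lemma slicing_inequality (L : set 'rV[R]_N) (f : 'rV[R]_N -> \bar R) (M s : R) :
  mble N f -> (forall x, 0 <= f x)%E -> (forall x, ~ L x -> f x = 0%E) ->
  (forall x, L x -> nsq (x *m T) <= s) -> 0 <= s -> 0 <= M ->
  (forall (xi : 'rV[R]_N) (A : 'M[R]_(2 + k * 2, N)), nsq xi = 1 ->
    A *m A^T = 1%:M -> A *m (complex_rows JN xi)^T = 0 ->
    (\int[leb R (2 + k * 2)]_y f (y *m A)%R <= M%:E)%E) ->
  (cauchy_mass R k * \int[leb R N]_x f x <= s%:E * M%:E * cauchy_mass R k.+1)%E.
Proof.
move=> mf f0 fL Ls s0 M0 fM.
have uT : T \in unitmx by rewrite unitmxE unitfE -normr_eq0 dT oner_eq0.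
have uTi : invmx T \in unitmx by rewrite unitmx_inv.
have dTi : `|\det (invmx T)| = 1 by rewrite det_inv normfV dT invr1.
pose F x := f (x *m invmx T).
have mF : mble N F := measurable_fun_mulmx (invmx T) mf.
have F0 x : (0 <= F x)%E by exact: f0.
have FE : (\int[leb R N]_x f x = \int[leb R N]_x F x)%E.
  by rewrite /F (integral_linear_change uTi mf f0) dTi invr1 mul1e.
pose G x := ((nsq x)^-1%:E * F x)%E.
have mi : mble N (fun x => (nsq x)^-1%:E).
  by apply/measurable_EFinP; apply: measurable_invr; exact: (measurable_nsq (h := id)).
have mG : mble N G by exact: (emeasurable_funM mi mF).
have G0 x : (0 <= G x)%E by rewrite mule_ge0// lee_fin invr_ge0 nsq_ge0.
(* On the support of [F] the squared norm is at most [s], so [F] is bounded by [s] times [F] over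
   the squared norm; the origin is again negligible. *)
have FG : (\int[leb R N]_x F x <= s%:E * \int[leb R N]_x G x)%E.
  have mnG : mble N (fun x => (nsq x)%:E * G x)%E.
    apply: emeasurable_funM; last exact: mG.
    by apply/measurable_EFinP; exact: (measurable_nsq (h := id)).
  rewrite -(integralZ_leb mG G0) ?lee_fin//.
  rewrite (@eq_integral_neq0 _ _ F (fun x => (nsq x)%:E * G x)%E mF mnG); last first.
    by move=> x x0; rewrite /G muleA -EFinM divff ?mul1e// nsq_eq0.
  apply: ge0_le_integral => //.
  - by move=> x _; rewrite mule_ge0// lee_fin nsq_ge0.
  - exact: (emeasurable_funM (measurable_cst _) mG).
  move=> x _; have [Lx|Lx] := pselect (L (x *m invmx T)).
    by apply: lee_wpmul2r => //; rewrite lee_fin; have := Ls _ Lx; rewrite mulmxKV.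
  by rewrite /G /F fL// !mule0.
have C0 : (0 <= cauchy_mass R k)%E by apply: integral_ge0 => b _; exact: cauchy_ge0.
rewrite FE; apply: (@le_trans _ _ (cauchy_mass R k * (s%:E * \int[leb R N]_x G x))%E).
  exact: lee_wpmul2l.
rewrite muleCA -(hyperplane_average cJ mF F0) -muleA; apply: lee_wpmul2l; first by rewrite lee_fin.
pose u (a : 'rV[R]_(2 + k * 2)) := (1 + nsq a)^-1; pose v a := (q a)^-1.
have u0 a : 0 <= u a by rewrite invr_ge0 addr_ge0// nsq_ge0.
have v0 a : 0 <= v a by rewrite invr_ge0 nsq_ge0.
have mv : measurable_fun setT (v : borel_rV R (2 + k * 2) -> R).
  apply: measurable_invr; apply: (@measurable_nsq _ _ _ _ (fun a : borel_rV R (2 + k * 2) => row_mx (e0 R) (a : 'rV_(2 + k * 2)) *m T^T : borel_rV R N)).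
  by apply: measurable_mulmx; apply: measurable_row_mx.
have mu j : mble (2 + k * 2) (fun a => (u a ^+ j)%:E) := measurable_cauchy 1 j (@measurable_id _ _ setT).
have mw : mble (2 + k * 2) (fun a => (v a ^+ k.+2)%:E) by exact: measurable_powr.
have k2 : 0 < k.+2%:R :> R by rewrite ltr0n.
(* Pointwise [amgm] with x = u(a) and y = v(a). The two terms have the same integral, and their
   coefficients add up to [M]. *)
apply: (@le_trans _ _ (\int[leb R (2 + k * 2)]_a ((M / k.+2%:R * k.+1%:R)%:E * (u a ^+ k.+2)%:E
    + (M / k.+2%:R)%:E * (v a ^+ k.+2)%:E))%E).
  apply: ge0_le_integral => //.
  - by move=> a _; rewrite mule_ge0 ?integral_ge0// cauchy_ge0.
  - apply: (emeasurable_funM (mu k.+1)).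
    exact: (measurable_fun_fubini_tonelli_F (m2 := leb R (2 + k * 2)) _ (measurable_section J mF)).
  - by apply: emeasurable_funD; apply: emeasurable_funM => //; exact: mu.
  move=> a _; apply: (@le_trans _ _ ((u a ^+ k.+1)%:E * ((v a)%:E * M%:E))%E).
    apply: (lee_wpmul2l (cauchy_ge0 k.+1 a ler01)).
    exact: (section_integral cJ cJN JT dT a mf f0 fM).
  rewrite -!EFinM -EFinD lee_fin.
  have := amgm k (u0 a) (v0 a).
  move: (u a ^+ k.+1) (u a ^+ k.+2) (v a) (v a ^+ k.+2) (k.+1%:R : R) => X X' Y Y' k1 h.
  have -> : X * (Y * M) = M / k.+2%:R * (k.+2%:R * (X * Y)).
    by rewrite [RHS]mulrA divfK ?gt_eqF// mulrA mulrC.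
  by rewrite -[X in _ <= X + _]mulrA -mulrDr ler_wpM2l// divr_ge0// ltW.
have d0 : 0 <= M / k.+2%:R by rewrite divr_ge0.
have d1 : 0 <= M / k.+2%:R * k.+1%:R by rewrite mulr_ge0.
rewrite ge0_integralD//; last 4 first.
- by move=> a _; rewrite -EFinM lee_fin mulr_ge0// exprn_ge0.
- by apply: emeasurable_funM => //; exact: mu.
- by move=> a _; rewrite -EFinM lee_fin mulr_ge0// exprn_ge0.
- by apply: emeasurable_funM => //; exact: mw.
rewrite (integralZ_leb (mu k.+2)) ?lee_fin// => [|a]; last by rewrite lee_fin exprn_ge0.
rewrite (integralZ_leb mw) ?lee_fin// => [|a]; last by rewrite lee_fin exprn_ge0.
rewrite integral_conormal -[X in (_ * X + _)%E]/(cauchy_mass R k.+1).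
rewrite -ge0_muleDl ?lee_fin// -EFinD.
rewrite (_ : M / k.+2%:R * k.+1%:R + M / k.+2%:R = M)//.
by rewrite -[X in _ + X]mulr1 -mulrDr natr1 divfK// gt_eqF.
Qed.

End Assembly.
End Sections.

(** * A complex ellipsoid of nearly maximal determinant *)

Section Separation.
Variable R : realType.

Lemma continuous_sumr (T : topologicalType) (I : Type) (r : seq I) (F : I -> T -> R) :
  (forall i, continuous (F i)) -> continuous (fun x => \sum_(i <- r) F i x).
Proof.
by move=> cF; apply: continuous_big => // x;
  apply: (@cvgD _ R^o); [exact: cvg_fst|exact: cvg_snd].
Qed.

Lemma continuous_nsqB m p (T : 'M[R]_(m, p)) (y : 'rV[R]_p) :
  continuous (fun z : 'rV[R]_m => nsq (y - z *m T)).
Proof.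
rewrite (_ : (fun _ => _) = (fun z : 'rV[R]_m =>
    \sum_j (y 0 j - \sum_i z 0 i * T i j) * (y 0 j - \sum_i z 0 i * T i j))).
  apply: continuous_sumr => j.
  have c : continuous (fun z : 'rV[R]_m => y 0 j - \sum_i z 0 i * T i j).
    have cs : continuous (fun z : 'rV[R]_m => \sum_i z 0 i * T i j).
      apply: continuous_sumr => i z.
      apply: (@continuousM R 'rV[R]_m (fun z => z 0 i) (fun=> T i j) z).
        exact: coord_continuous.
      exact: cst_continuous.
    by move=> z; apply: (@continuousB R R^o 'rV[R]_m (fun=> y 0 j)); [exact: cst_continuous|exact: cs].
  by move=> z; exact: (@continuousM R 'rV[R]_m _ _ z (c z) (c z)).
by apply/funext => z; rewrite nsqE; apply: eq_bigr => j _; rewrite !mxE -expr2.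
Qed.

Lemma convexP m (L : set 'rV[R]_m) x y (t : R) : convex_set L -> L x -> L y ->
  0 <= t <= 1 -> L (t *: x + (1 - t) *: y).
Proof.
move=> cL Lx Ly /andP[t0 t1].
have := cL x y (Itv01 t0 t1); rewrite !inE => /(_ Lx Ly).
by [].
Qed.

(** [v] joins the point of the image of [L] nearest to [y] to [y] itself; strictness comes from [v]
    being nonzero. *)
Lemma separation m p (L : set 'rV[R]_m) (T : 'M[R]_(m, p)) (y : 'rV[R]_p) :
  compact L -> convex_set L -> L !=set0 -> (forall z, L z -> z *m T != y) ->
  exists2 v : 'rV[R]_p, v != 0 &
    forall z, L z -> (z *m T *m v^T) 0 0 < (y *m v^T) 0 0.
Proof.
move=> kL cL L0 Ly.
have cf := @continuous_nsqB _ _ T y.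
have [q Lq qmin] := compact_EVT_min L0 kL (continuous_subspaceT cf).
rewrite inE in Lq; pose v := y - q *m T.
have v0 : v != 0 by rewrite subr_eq0 eq_sym; exact: Ly.
exists v => // z Lz.
have key : ((z - q) *m T *m v^T) 0 0 <= 0.
  rewrite leNgt; apply/negP => d0; set d := (_ 0 0) in d0.
  pose w := (z - q) *m T; have w0 : 0 <= nsq w := nsq_ge0 w.
  (* If [d] were positive, a step [t] towards [z] would shorten the distance, as t^2 |w|^2 < 2 t d.
     The added 1 protects the division when [w] vanishes. *)
  pose t := Num.min 1 (d / (nsq w + 1)).
  have t0 : 0 < t by rewrite lt_min ltr01 divr_gt0// ltr_wpDl.
  have t1 : t <= 1 by rewrite ge_min lexx.
  have := qmin (t *: z + (1 - t) *: q); rewrite inE.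
  have -> : y - (t *: z + (1 - t) *: q) *m T = v + (- t) *: w.
    by rewrite /v /w mulmxDl mulmxBl -!scalemxAl scalerBl scale1r scalerBr !scaleNr; apply/rowP => i; rewrite !mxE; ring.
  rewrite -/v => /(_ (convexP cL Lz Lq _)); rewrite ltW// t1 => /(_ isT).
  rewrite nsqD nsqZ sqrrN.
  have -> : (v *m (- t *: w)^T) 0 0 = - t * d.
    by rewrite linearZ /= -scalemxAr mxE dot_sym.
  have td : t * (nsq w + 1) <= d.
    by rewrite -ler_pdivlMr ?ltr_wpDl// ge_min lexx orbT.
  have := ler_wpM2l (ltW t0) td; have := mulr_gt0 t0 d0; have := sqr_ge0 t.
  move: (nsq w) (nsq v) => W V; nra.
move: key; rewrite !mulmxBl mxE [X in _ + X]mxE subr_le0 => key.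
have : 0 < nsq v by rewrite nsq_gt0.
rewrite {1}/nsq {1}/v mulmxBl mxE [X in _ + X]mxE subr_gt0.
exact: le_lt_trans key.
Qed.

End Separation.

Section John.
Variable R : realType.

Lemma bernoulli (e : R) k : 0 <= e <= 1 -> 1 - k%:R * e <= (1 - e) ^+ k.
Proof.
move=> /andP[e0 e1]; elim: k => [|k IH]; first by rewrite mul0r subr0 expr0.
rewrite exprS -natr1.
have := ler_wpM2l (_ : 0 <= 1 - e) IH; rewrite subr_ge0 => /(_ e1).
have : 0 <= k%:R * e ^+ 2 by rewrite mulr_ge0// sqr_ge0.
move: (k%:R : R) ((1 - e) ^+ k) => K X; nra.
Qed.

Lemma J2E : (J2 R : 'M[R]_(1 + 1)) = block_mx 0 1%:M (- 1%:M) 0.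
Proof.
apply/matrixP => i j.
have [i' ->|i' ->] := @split_ordP 1 1 i; have [j' ->|j' ->] := @split_ordP 1 1 j;
  by rewrite (ord1 i') (ord1 j') ?(block_mxEul, block_mxEur, block_mxEdl, block_mxEdr)
    !mxE -!val_eqE /= ?subr0 ?sub0r.
Qed.

Lemma J2_rows m (J : 'M[R]_m) (v : 'rV[R]_m) : complex_structure J ->
  complex_rows J v *m J = (J2 R : 'M[R]_(1 + 1)) *m complex_rows J v.
Proof.
move=> [_ JJ]; rewrite /complex_rows mul_col_mx -mulmxA JJ mulmxN mulmx1.
by rewrite J2E mul_block_col !mul0mx mul1mx mulNmx mul1mx addr0 add0r.
Qed.

(* stretch scales the complex line of v by sqrt al and its orthogonal complement by sqrt be. *)
Section Gain.
Variables (p : nat) (J : 'M[R]_(2 + p)) (cJ : complex_structure J).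
Variables (v : 'rV[R]_(2 + p)) (v1 : nsq v = 1).
Variables (al be : R) (al0 : 0 <= al) (be0 : 0 <= be).
Let B := complex_rows J v.
Definition stretch := (Num.sqrt be)%:M + (Num.sqrt al - Num.sqrt be) *: (B^T *m B).
Let BB : B *m B^T = 1%:M.
Proof. by rewrite complex_rowsM// v1. Qed.

Lemma stretch_commutes : J *m stretch = stretch *m J.
Proof.
have BJ : B *m J = (J2 R : 'M[R]_(1 + 1)) *m B := J2_rows v cJ.
have JB : J *m B^T = B^T *m (J2 R : 'M[R]_(1 + 1)).
  have := congr1 trmx BJ; rewrite !trmx_mul (proj1 cJ) (proj1 (complex_structure_J2 R)).
  by rewrite mulmxN mulNmx => /oppr_inj.
rewrite /stretch mulmxDr mulmxDl scalar_mxC -scalemxAl -scalemxAr mulmxA JB.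
by rewrite -[in RHS]mulmxA BJ !mulmxA.
Qed.

Lemma nsq_stretch x : nsq (x *m stretch) = be * nsq x + (al - be) * nsq (x *m B^T).
Proof.
have sE : stretch *m stretch^T = be%:M + (al - be) *: (B^T *m B).
  rewrite /stretch linearD /= tr_scalar_mx linearZ /= trmx_mul trmxK.
  set P := B^T *m B; have PP : P *m P = P.
    by rewrite /P mulmxA -(mulmxA B^T) BB mulmx1.
  rewrite mulmxDl !mulmxDr -scalar_mxM mul_scalar_mx mul_mx_scalar -scalemxAl -scalemxAr PP.
  rewrite !scalerA -addrA -!scalerDl -expr2 sqr_sqrtr//; congr (_ + _ *: _).
  rewrite /GRing.scale /=; have := sqr_sqrtr al0; have := sqr_sqrtr be0.
  by move: (Num.sqrt al) (Num.sqrt be) => a b; nra.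
rewrite /nsq trmx_mul mulmxA -(mulmxA x) sE mulmxDr mul_mx_scalar -scalemxAr mulmxDl.
by rewrite -!scalemxAl trmx_mul trmxK !mulmxA !mxE.
Qed.

Lemma det_stretch : `|\det stretch| = al * Num.sqrt be ^+ p.
Proof.
have [A [AB oO]] := orthonormal_completion BB.
have : stretch *m (col_mx B A)^T = (col_mx B A)^T *m
    block_mx (Num.sqrt al)%:M 0 0 (Num.sqrt be)%:M.
  rewrite tr_col_mx mul_mx_row mul_row_block !mulmx0 addr0 add0r.
  have BA : B *m A^T = 0 by rewrite -[LHS]trmxK trmx_mul trmxK AB trmx0.
  rewrite /stretch !mulmxDl -!scalemxAl -!mulmxA BB BA !mulmx0 scaler0 addr0 mulmx1.
  by rewrite !mul_scalar_mx !mul_mx_scalar -scalerDl addrC subrK.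
move/(congr1 determinant); rewrite !det_mulmx det_tr mulrC.
have O0 : \det (col_mx B A) != 0 by rewrite -unitfE -unitmxE orthogonal_unit.
move/(mulfI O0) ->; rewrite det_ublock !det_scalar sqr_sqrtr// ger0_norm//.
by rewrite mulr_ge0// exprn_ge0// sqrtr_ge0.
Qed.

End Gain.

(** A crude bound from the Leibniz expansion, enough to make the supremum of the determinants
    finite. *)
Lemma det_bound m (A : 'M[R]_m) c : (forall i j, `|A i j| <= c) ->
  `|\det A| <= \sum_(s : 'S_m) c ^+ m.
Proof.
move=> Ac; rewrite /determinant (le_trans (ler_norm_sum _ _ _))//.
apply: ler_sum => s _; rewrite normrM normrX normrN1 expr1n mul1r normr_prod.
rewrite -[X in _ ^+ X]card_ord -prodr_const; apply: ler_prod => i _.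
by rewrite normr_ge0 Ac.
Qed.

Section Ellipsoid.
Variables (k : nat).
Let N := (2 + k.+1 * 2)%N.
Variables (J JN T0 : 'M[R]_N).
Hypotheses (cJ : complex_structure J) (cJN : complex_structure JN).
Hypotheses (oT0 : T0 *m T0^T = 1%:M) (JT0 : JN *m T0 = T0 *m J).
Variable L : set 'rV[R]_N.
Hypotheses (kL : compact L) (cL : convex_set L).
Hypothesis rotL : forall x c s, c ^+ 2 + s ^+ 2 = 1 -> L x -> L (c *: x + s *: (x *m JN)).
Variable d : R.
Hypotheses (d0 : 0 < d) (dL : forall x, nsq x <= d -> L x).

Let L0 : L 0. Proof. by apply: dL; rewrite nsqE big1 ?ltW// => i _; rewrite mxE expr0n. Qed.

Let admissible (T : 'M[R]_N) := JN *m T = T *m J /\ forall x, L x -> nsq (x *m T) <= 1.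

Lemma admissible_exists : exists2 T, admissible T & 0 < `|\det T|.
Proof.
have L00 : L !=set0 by exists 0.
have [q _ qmax] := compact_EVT_max L00 kL
  (continuous_subspaceT (@continuous_nsqB R _ _ 1%:M 0)).
have b x : L x -> nsq x <= nsq q.
  by move=> Lx; have := qmax x; rewrite inE !mulmx1 !sub0r !nsqN; exact.
pose c := Num.sqrt (nsq q + 1)^-1.
have q1 : 0 < nsq q + 1 by rewrite ltr_wpDl// nsq_ge0.
have c0 : 0 < c by rewrite sqrtr_gt0 invr_gt0.
exists (c *: T0); first split.
- by rewrite -scalemxAr JT0 scalemxAl.
- move=> x Lx; rewrite -scalemxAr nsqZ (nsq_orthogonal _ oT0) sqr_sqrtr ?invr_ge0 ?(ltW q1)//.
  by rewrite mulrC ler_pdivrMr// mul1r (le_trans (b _ Lx))// lerDl.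
- by rewrite detZ normrM orthogonal_det// mulr1 normr_gt0 expf_neq0// gt_eqF.
Qed.

(** [L] contains a ball of radius [Num.sqrt d], so every row of an admissible matrix has norm at
    most the inverse of that radius. *)
Lemma admissible_bound : exists C, forall T, admissible T -> `|\det T| <= C.
Proof.
exists (\sum_(s : 'S_N) (Num.sqrt d)^-1 ^+ N) => T [_ hT].
apply: det_bound => i j.
pose s := Num.sqrt d; have s0 : 0 < s by rewrite sqrtr_gt0.
have := hT (s *: delta_mx 0 i).
have nd : nsq (delta_mx 0 i : 'rV[R]_N) = 1 := nsq_delta _ _.
rewrite -scalemxAl nsqZ -rowE; move=> /(_ _)/(le_trans _); move=> h.
have : s ^+ 2 * T i j ^+ 2 <= 1.
  apply: h; last by apply: dL; rewrite nsqZ nd mulr1 sqr_sqrtr// ltW.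
  by rewrite ler_pM2l ?exprn_gt0//; have := sqr_coord_le (row i T) j; rewrite mxE.
rewrite -exprMn -real_normK ?num_real// expr_le1// normrM gtr0_norm//.
by rewrite mulrC -ler_pdivlMr// mul1r.
Qed.

(** Rotating [x] inside [L] by the opposite phase makes its Hermitian product with [v] real and
    nonnegative, so a bound on real parts over [L] bounds the modulus. *)
Lemma rotation_bound (T : 'M[R]_N) (v : 'rV[R]_N) (t : R) : JN *m T = T *m J ->
  0 <= t -> (forall x, L x -> (x *m T *m v^T) 0 0 <= t) ->
  forall x, L x -> nsq (x *m T *m (complex_rows J v)^T) <= t ^+ 2.
Proof.
move=> JT t0 h x Lx.
pose a := (x *m T *m v^T) 0 0; pose b := (x *m T *m (v *m J)^T) 0 0.
have -> : nsq (x *m T *m (complex_rows J v)^T) = a ^+ 2 + b ^+ 2.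
  rewrite /complex_rows tr_col_mx mul_mx_row nsq_row_mx.
  by rewrite !nsqE !big_ord1.
pose w := Num.sqrt (a ^+ 2 + b ^+ 2).
have ab0 : 0 <= a ^+ 2 + b ^+ 2 by rewrite addr_ge0// sqr_ge0.
have w2 : w ^+ 2 = a ^+ 2 + b ^+ 2 by rewrite sqr_sqrtr.
have [w0|w0] := eqVneq w 0; first by rewrite -w2 w0 expr0n/= exprn_ge0.
have wp : 0 < w by rewrite lt_neqAle eq_sym w0 sqrtr_ge0.
have := h _ (@rotL x (a / w) (- (b / w)) _ Lx).
have -> : (a / w) ^+ 2 + (- (b / w)) ^+ 2 = 1.
  by rewrite sqrrN !exprMn -mulrDl -w2 exprVn divff// expf_neq0.
move=> /(_ erefl).
have -> : ((a / w *: x + - (b / w) *: (x *m JN)) *m T *m v^T) 0 0 = w.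
  have xJ : x *m JN *m T *m v^T = - (x *m T *m (v *m J)^T).
    rewrite -[x *m JN *m T]mulmxA JT mulmxA -[_ *m J *m v^T]mulmxA.
    by rewrite trmx_mul (proj1 cJ) mulNmx mulmxN opprK.
  rewrite !mulmxDl -!scalemxAl xJ mxE [X in X + _]mxE [X in _ + X]mxE.
  rewrite [(- _ : 'M[R]_(_, _)) 0 0]mxE -/a -/b mulrNN ![_ / w * _]mulrAC -mulrDl -!expr2 -w2.
  by rewrite expr2 mulfK.
by rewrite -w2 => wt; rewrite lerXn2r// nnegrE ltW.
Qed.

Lemma dot_sqr_le m (y v : 'rV[R]_m) : nsq v = 1 -> (y *m v^T) 0 0 ^+ 2 <= nsq y.
Proof.
move=> v1; have := nsq_ge0 (y + (- (y *m v^T) 0 0) *: v).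
rewrite nsqD nsqZ v1 linearZ /= -scalemxAr [(_ *: _ : 'M[R]_(_, _)) 0 0]mxE.
by move: ((y *m v^T) 0 0) (nsq y) => X Y; nra.
Qed.

Theorem john_ellipsoid : exists T (r : R), [/\ JN *m T = T *m J, `|\det T| = 1, 0 < r,
  (forall x, L x -> nsq (x *m T) <= r) &
  (forall x, (k.+2 * 2)%:R * nsq (x *m T) <= r -> L x)].
Proof.
pose S : set R := [set t | exists2 T, admissible T & t = `|\det T|].
have [C CP] := admissible_bound; have [T1 aT1 T1p] := admissible_exists.
have hS : has_sup S.
  by split; [exists `|\det T1|, T1|exists C => _ [T aT ->]; exact: CP].
pose M := sup S.
have M0 : 0 < M by apply: lt_le_trans T1p _; apply: ub_le_sup; [case: hS|exists T1].
pose nn : R := k.+2%:R.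
have nn2 : 2 <= nn by rewrite ler_nat.
(* With n for [nn]: al - be = 2n e, so a squared width at most 1 / (2n) along [v] gives the new
   bound be + e = 1. By Bernoulli, eta >= 1 + n e - (2n - 1)(n - 1) e^2, which exceeds 1 for this
   [e]. *)
pose e : R := (4 * nn)^-1.
have e0 : 0 < e by rewrite invr_gt0; lra.
have ee : 4 * nn * e = 1 by rewrite divff//; apply/eqP; lra.
pose be := 1 - e; pose al := 1 + (2 * nn - 1) * e.
have e1 : e <= 1 by nra.
have be0 : 0 <= be by rewrite subr_ge0.
have al0 : 0 <= al by rewrite /al; nra.
pose eta := al * be ^+ k.+1.
have eta1 : 1 < eta.
  have := bernoulli k.+1 (_ : 0 <= e <= 1); rewrite (ltW e0) e1 => /(_ isT).
  have -> : k.+1%:R = nn - 1 by rewrite /nn -[k.+2%:R]natr1 addrK.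
  move=> /(ler_wpM2l al0); apply: lt_le_trans; rewrite /al; nra.
(* A matrix within the factor [eta] of the supremum suffices: a stretch would push its determinant
   above the supremum. *)
have [_ [T [JT T1le] ->] MT] : exists2 t, S t & M / eta < t.
  have [|t St tM] := @sup_adherent _ S (M - M / eta) _ hS.
    by rewrite subr_gt0 ltr_pdivrMr ?(lt_trans ltr01)// ltr_pMr.
  by exists t => //; rewrite -/M subKr in tM.
have dT0 : 0 < `|\det T| by apply: lt_trans MT; rewrite divr_gt0// (lt_trans ltr01).
have key x : (k.+2 * 2)%:R * nsq (x *m T) <= 1 -> L x.
  move=> xT; apply: contrapT => Lx.
  have uT : T \in unitmx by rewrite unitmxE unitfE -normr_gt0.
  have Ly z : L z -> z *m T != x *m T.
    by move=> Lz; apply/eqP => /(can_inj (mulmxK uT)) zx; apply: Lx; rewrite -zx.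
  have L00 : L !=set0 by exists 0.
  have [v0 v0n v0P] := separation kL cL L00 Ly.
  pose c := Num.sqrt (nsq v0); have c0 : 0 < c by rewrite sqrtr_gt0 nsq_gt0.
  pose v := c^-1 *: v0.
  have v1 : nsq v = 1.
    by rewrite nsqZ exprVn sqr_sqrtr ?nsq_ge0// mulVf// gt_eqF// nsq_gt0.
  pose t := Num.sqrt ((k.+2 * 2)%:R^-1) : R.
  have t2 : t ^+ 2 = (k.+2 * 2)%:R^-1 by rewrite sqr_sqrtr// invr_ge0.
  have vP z : L z -> (z *m T *m v^T) 0 0 <= t.
    move=> /v0P/ltW zx; have vE y : (y *m v^T) 0 0 = c^-1 * (y *m v0^T) 0 0.
      by rewrite /v linearZ /= -scalemxAr mxE.
    apply: (@le_trans _ _ ((x *m T *m v^T) 0 0)).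
      by rewrite !vE ler_wpM2l// invr_ge0 ltW.
    have := le_trans (dot_sqr_le (x *m T) v1) (_ : _ <= t ^+ 2).
    have -> : nsq (x *m T) <= t ^+ 2 by rewrite t2 -[_^-1]mulr1 ler_pdivlMl.
    move=> /(_ isT); have : 0 <= t := sqrtr_ge0 _.
    move: ((x *m T *m v^T) 0 0) => X; rewrite leNgt => tp h; apply/negP => tX; nra.
  have rb := rotation_bound JT (sqrtr_ge0 _) vP.
  pose D := stretch J v al be.
  have aTD : admissible (T *m D).
    split; first by rewrite mulmxA JT -!mulmxA stretch_commutes.
    move=> z Lz; rewrite mulmxA nsq_stretch//.
    have := rb z Lz; rewrite t2 natrM -/nn -[_^-1]mulr1 ler_pdivlMl ?mulr_gt0 ?ltr0n//.
    have := T1le z Lz; have := nsq_ge0 (z *m T).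
    move: (nsq (z *m T)) (nsq _) => X Y X0 X1 Y1; rewrite /al /be.
    nra.
  have : `|\det (T *m D)| <= M by apply: ub_le_sup; [case: hS|exists (T *m D)].
  rewrite det_mulmx normrM det_stretch//.
  have -> : Num.sqrt be ^+ (k.+1 * 2) = be ^+ k.+1 by rewrite mulnC exprM sqr_sqrtr.
  rewrite -/eta leNgt => /negP; apply.
  by rewrite -ltr_pdivrMr// (lt_trans ltr01).
(* Normalising the determinant multiplies both squared radii by [c ^+ 2] and so keeps their
   ratio. *)
pose c := `|\det T| `^ (- (N%:R)^-1).
have c0 : 0 < c by rewrite powR_gt0.
have cN : c ^+ N * `|\det T| = 1.
  rewrite /c -powR_mulrn ?powR_ge0// -powRrM mulNr mulVf ?pnatr_eq0//.
  by rewrite powR_inv1 ?ltW// mulVf// gt_eqF.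
exists (c *: T), (c ^+ 2); split.
- by rewrite -scalemxAr JT scalemxAl.
- by rewrite detZ normrM ger0_norm ?exprn_ge0 ?(ltW c0).
- by rewrite exprn_gt0.
- by move=> x Lx; rewrite -scalemxAr nsqZ ler_piMr ?exprn_ge0 ?(ltW c0)//; exact: T1le.
- move=> x; rewrite -scalemxAr nsqZ mulrCA => h; apply: key.
  by rewrite -(ler_pM2l (exprn_gt0 2 c0)) mulr1.
Qed.

End Ellipsoid.
End John.

(** * Existence of a maximal section *)

Section EntrywiseContinuity.
Variables (R : realType) (T : topologicalType).

(** Continuity entry by entry passes directly to products and transposes of rectangular matrices. *)
Definition entry_continuous a b (F : T -> 'M[R]_(a, b)) := forall i j, continuous (fun w => F w i j).

Lemma entry_continuous_mulmx a b c (F : T -> 'M[R]_(a, b)) (G : T -> 'M[R]_(b, c)) :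
  entry_continuous F -> entry_continuous G -> entry_continuous (fun w => F w *m G w).
Proof.
move=> cF cG i j.
rewrite (_ : (fun _ => _) = (fun w => \sum_l F w i l * G w l j)); last first.
  by apply/funext => w; rewrite mxE.
by apply: continuous_sumr => l w; exact: (@continuousM R T _ _ w (cF i l w) (cG l j w)).
Qed.

Lemma entry_continuous_tr a b (F : T -> 'M[R]_(a, b)) :
  entry_continuous F -> entry_continuous (fun w => (F w)^T).
Proof.
by move=> cF i j; rewrite (_ : (fun _ => _) = (fun w => F w j i))//; apply/funext => w; rewrite mxE.
Qed.

Lemma entry_continuous_cst a b (A : 'M[R]_(a, b)) : entry_continuous (fun=> A).
Proof. by move=> i j; exact: cst_continuous. Qed.

Lemma closed_eq_mx a b (F G : T -> 'M[R]_(a, b)) :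
  entry_continuous F -> entry_continuous G -> closed [set w | F w = G w].
Proof.
move=> cF cG; rewrite (_ : [set _ | _] =
    \bigcap_(p in [set: 'I_a * 'I_b]) ((fun w => F w p.1 p.2 - G w p.1 p.2) @^-1` [set 0])); last first.
  apply/seteqP; split => w; first by move=> wE p _; rewrite /= wE subrr.
  move=> h.
  by apply/matrixP => i j; have /subr0_eq := h (i, j) I.
apply: closed_bigI => p _; apply: preimage_closed; last exact: closed_eq.
move=> w _; exact: (@continuousB R R^o T _ _ w (cF p.1 p.2 w) (cG p.1 p.2 w)).
Qed.

Lemma entry_continuous_rV a (F : T -> 'rV[R]_a) : entry_continuous F -> continuous F.
Proof.
move=> cF w; apply/cvg_ballP => e e0.
have : \forall w' \near w, forall j, ball (F w 0 j) e (F w' 0 j).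
  by apply: filter_forall => j; move: (cF 0 j w) => /cvg_ballP; exact.
by apply: filterS => w' h; split => // i j; rewrite (ord1 i).
Qed.

End EntrywiseContinuity.

Lemma entry_continuous_vec_mx (R : realType) a b :
  entry_continuous (fun w : 'rV[R]_(a * b) => vec_mx w : 'M[R]_(a, b)).
Proof.
move=> i j; rewrite (_ : (fun _ => _) = (fun w : 'rV[R]_(a * b) => w 0 (mxvec_index i j))).
  by move=> w; exact: coord_continuous.
by apply/funext => w; rewrite mxE.
Qed.

(** Upper semicontinuity is only required along convergent sequences that nearly attain a level; a
    cluster point of a maximising sequence supplies one. *)
Lemma compact_sup_attained (R : realType) q (K : set 'rV[R]_q) (phi : 'rV[R]_q -> R) :
  compact K -> K !=set0 -> (exists C, forall w, K w -> phi w <= C) ->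
  (forall (u : nat -> 'rV[R]_q) w c, K w -> (forall i, K (u i)) -> u @ \oo --> w ->
     (forall i, c - i.+1%:R^-1 <= phi (u i)) -> c <= phi w) ->
  exists2 w, K w & forall w', K w' -> phi w' <= phi w.
Proof.
move=> cK [w0 Kw0] [C phiC] usc.
have hS : has_sup (phi @` K).
  by split; [exists (phi w0); exists w0|exists C => _ [w Kw <-]; exact: phiC].
pose M := sup (phi @` K).
have /choice[x xP] i : exists x, K x /\ M - i.+1%:R^-1 <= phi x.
  have [|_ [x Kx <-] /ltW xM] := @sup_adherent _ (phi @` K) (i.+1%:R^-1) _ hS.
    by rewrite invr_gt0.
  by exists x.
have [w [Kw clw]] : K `&` cluster (x @ \oo) !=set0.
  by apply: cK; exists 0%N => // i _; exact: (xP i).1.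
(* Taking an index at least [i] keeps the defect below [i.+1%:R^-1], while the shrinking balls force
   convergence to the cluster point. *)
have /choice[s sP] i : exists j, (i <= j)%N /\ ball w i.+1%:R^-1 (x j).
  have i0 : 0 < i.+1%:R^-1 :> R by rewrite invr_gt0.
  have [_ [[j /= ij <-] xj]] := clw (x @` [set j | (i <= j)%N]) (ball w i.+1%:R^-1)
    (ex_intro2 _ _ i I (fun j ij => ex_intro2 _ _ j ij erefl)) (nbhsx_ballx w _ i0).
  by exists j.
exists w => // w' Kw'; apply: (@le_trans _ _ M); first by apply: ub_le_sup; [case: hS|exists w'].
apply: (usc (fun i => x (s i))) => // [i||].
- exact: (xP _).1.
- apply/cvg_ballP => e e0; near=> i; apply: le_ball (sP i).2.
  by apply: ltW; near: i; exact: (near_infty_natSinv_lt (PosNum e0)).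
- move=> i; apply: le_trans (xP _).2; rewrite lerB// lef_pV2 ?posrE ?ltr0n// ler_nat ltnS.
  exact: (sP i).1.
Unshelve. all: by end_near. Qed.

Section MaximalSection.
Variables (R : realType) (p N : nat) (L : set 'rV[R]_N) (g : 'rV[R]_N -> R).
Hypotheses (kL : compact L) (cg : continuous g) (g0 : forall x, 0 <= g x).
Local Notation mble m f := (measurable_fun [set: borel_rV R m] (f : borel_rV R m -> \bar R)).

Definition cut_density (x : 'rV[R]_N) : R := if `[< L x >] then g x else 0.

Lemma cut_density_ge0 x : 0 <= cut_density x.
Proof. by rewrite /cut_density; case: asboolP. Qed.

Lemma body_closed : closed L.
Proof. by apply: compact_closed kL; exact: norm_hausdorff. Qed.

Lemma body_measurable : measurable (L : set (borel_rV R N)).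
Proof.
rewrite -[L]setCK; apply: measurableC; apply: sub_sigma_algebra.
by rewrite /= openC; exact: body_closed.
Qed.

Lemma cut_densityE : (fun x => (cut_density x)%:E) = (EFin \o g) \_ L.
Proof.
apply/funext => x; rewrite patchE /cut_density.
by case: asboolP => Lx; [rewrite mem_set|rewrite memNset].
Qed.

Lemma measurable_cut_density : mble N (fun x => (cut_density x)%:E).
Proof.
rewrite cut_densityE; apply/(measurable_restrictT _ body_measurable).
apply: measurable_funTS; apply/measurable_EFinP; exact: continuous_measurable_rV.
Qed.

Lemma body_bounded : exists2 b, 0 < b & forall x, L x -> nsq x <= b.
Proof.
have [->|/set0P L0] := eqVneq L set0; first by exists 1.
have [q _ qmax] := compact_EVT_max L0 kL (continuous_subspaceT (@continuous_nsqB R _ _ 1%:M 0)).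
exists (nsq q + 1); first by rewrite ltr_wpDl// nsq_ge0.
move=> x Lx; have := qmax x; rewrite inE !mulmx1 !sub0r !nsqN => /(_ Lx) h.
by rewrite (le_trans h)// lerDl.
Qed.

Lemma density_bounded : exists2 C, 0 <= C & forall x, cut_density x <= C.
Proof.
have [L0|/set0P L0] := eqVneq L set0.
  by exists 0 => // x; rewrite /cut_density L0; case: asboolP.
have [q _ qmax] := compact_EVT_max L0 kL (continuous_subspaceT cg).
exists (g q) => // x; rewrite /cut_density; case: asboolP => // Lx.
by apply: qmax; rewrite inE.
Qed.

Definition section_mass (A : 'M[R]_(p, N)) : \bar R :=
  (\int[leb R p]_y (cut_density (y *m A))%:E)%E.

(** An integrable majorant common to all orthonormal frames: these are isometries, so the part of
    any section inside [L] stays in a fixed ball. *)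
Definition dominating (C b : R) (y : 'rV[R]_p) : \bar R :=
  (C%:E * ((nsq y <= b)%R%:R)%:E)%E.

Lemma integrable_dominating C b : 0 <= C -> 0 < b ->
  (leb R p).-integrable setT (dominating C b).
Proof.
move=> C0 b0.
have mb : mble p (fun y => ((nsq y <= b)%R%:R)%:E).
  by apply: measurable_natr_ler => //; exact: (measurable_nsq (h := id)).
apply: integrableZl => //.
apply/integrableP; split; first exact: mb.
under eq_integral do rewrite gee0_abs//.
have s0 : 0 < Num.sqrt b by rewrite sqrtr_gt0.
rewrite (integral_scale s0 mb) => [|y]; last by rewrite lee_fin.
have -> : (\int[leb R p]_y (((nsq (Num.sqrt b *: y) <= b)%R%:R)%:E : \bar R) =
    leb R p (@euclidean_ball R p))%E.
  rewrite leb_ballE; apply: eq_integral => y _.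
  by rewrite /ball_ind nsqZ sqr_sqrtr ?(ltW b0)// ger_pMr.
have := leb_ball_fin R p; case: (leb R p _) => // r _.
by rewrite -EFinM ltry.
Qed.

Lemma nsq_mul_bound (A : 'M[R]_(p, N)) (y : 'rV[R]_p) b C :
  A *m A^T = 1%:M -> (forall x, L x -> nsq x <= b) -> 0 <= C ->
  (forall x, cut_density x <= C) -> ((cut_density (y *m A))%:E <= dominating C b y)%E.
Proof.
move=> oA Lb C0 fC; rewrite /dominating -EFinM lee_fin.
have [yb|yb] := lerP (nsq y) b; first by rewrite mulr1; exact: fC.
rewrite mulr0 /cut_density; case: asboolP => // /Lb.
by rewrite (nsq_orthogonal _ oA) leNgt yb.
Qed.

Lemma measurable_section_mass (A : 'M[R]_(p, N)) :
  mble p (fun y => (cut_density (y *m A))%:E).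
Proof.
apply: (measurable_comp_rV (h := fun y : borel_rV R p => (y : 'rV_p) *m A) measurable_cut_density).
exact: measurable_mulmx.
Qed.

Lemma section_mass_bounded : exists C : R, forall A, A *m A^T = 1%:M ->
  (section_mass A <= C%:E)%E.
Proof.
have [b b0 Lb] := body_bounded; have [C C0 fC] := density_bounded.
have iD := integrable_dominating C0 b0.
have D0 y : (0 <= dominating C b y)%E by rewrite mule_ge0// lee_fin.
have /integrableP[mD] := iD; under eq_integral do rewrite gee0_abs//.
move=> lD; exists (fine (\int[leb R p]_y dominating C b y)) => A oA.
rewrite fineK ?ge0_fin_numE ?integral_ge0//.
apply: ge0_le_integral => //.
- by move=> y _; rewrite lee_fin cut_density_ge0.
- exact: measurable_section_mass.
- by move=> y _; exact: nsq_mul_bound.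
Qed.

(* The densities cut along A i are dominated by F i, their maximum with the limiting one,
   which converges everywhere since L is closed. *)
Lemma section_mass_usc (A : nat -> 'M[R]_(p, N)) (B : 'M[R]_(p, N)) (c : R) :
  (forall i, A i *m (A i)^T = 1%:M) -> B *m B^T = 1%:M ->
  (forall y : 'rV[R]_p, (fun i => y *m A i) @ \oo --> y *m B) ->
  (forall i, (c - i.+1%:R^-1)%:E <= section_mass (A i))%E ->
  (c%:E <= section_mass B)%E.
Proof.
move=> oA oB AB hc.
have [b b0 Lb] := body_bounded; have [C C0 fC] := density_bounded.
have iD := integrable_dominating C0 b0.
pose F i (y : borel_rV R p) : \bar R := (Num.max (cut_density (y *m A i)) (cut_density (y *m B)))%:E.
have mF i : measurable_fun setT (F i).
  apply/measurable_EFinP; apply: measurable_maxr; apply/measurable_EFinP;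
  exact: measurable_section_mass.
have FB y : (F ^~ y) @ \oo --> (cut_density (y *m B))%:E.
  apply: cvg_EFin; first exact: nearW.
  apply/cvgrPdist_lt => e e0; rewrite /F /=.
  (* If the limit lies in [L], each term is either the limit value or a value of [g] at a nearby
     point; otherwise the points eventually leave the closed set [L] and both densities vanish. *)
  have [yB|yB] := pselect (L (y *m B)).
    have -> : cut_density (y *m B) = g (y *m B).
      by rewrite /cut_density; case: asboolP.
    have gB : (fun i => g (y *m A i)) @ \oo --> g (y *m B).
      by apply: continuous_cvg; [exact: cg|exact: AB].
    move/cvgrPdist_lt : gB => /(_ e e0); apply: filterS => i ge.
    rewrite /cut_density; case: asboolP => _; rewrite maxEle; last first.
      by rewrite g0 subrr normr0.
    by case: ifP => //; rewrite subrr normr0.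
  have -> : cut_density (y *m B) = 0 by rewrite /cut_density; case: asboolP.
  have : \forall i \near \oo, (~` L) (y *m A i).
    by apply: (AB y); apply: open_nbhs_nbhs; split => //; rewrite openC; exact: body_closed.
  apply: filterS => i Li; rewrite /cut_density; case: asboolP => // _.
  by rewrite maxxx subrr normr0.
have [] := @dominated_convergence _ _ R (leb R p) setT measurableT F
  (fun y => (cut_density (y *m B))%:E) (dominating C b) mF (measurable_section_mass B) _ iD _.
- by apply: aeW => y _; exact: FB.
- apply: aeW => y i _; rewrite gee0_abs ?lee_fin ?le_max ?cut_density_ge0//.
  have := nsq_mul_bound y (oA i) Lb C0 fC; have := nsq_mul_bound y oB Lb C0 fC.
  by rewrite /dominating -EFinM !lee_fin ge_max => -> ->.
move=> _ _ cvgI.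
have cc : (fun i => (c - i.+1%:R^-1)%:E : \bar R) @ \oo --> c%:E.
  apply: cvg_EFin; first exact: nearW.
  rewrite -[X in _ --> X]subr0; apply: (@cvgB R R^o); first exact: cvg_cst.
  exact: cvg_harmonic.
apply: (lee_cvg_to cc cvgI); apply: nearW => i.
apply: le_trans (hc i) _; apply: ge0_le_integral => //.
- by move=> y _; rewrite lee_fin cut_density_ge0.
- exact: measurable_section_mass.
- by move=> y _; rewrite lee_fin le_max lexx.
Qed.

End MaximalSection.

Section MaximalFrame.
Variables (R : realType) (p : nat) (J : 'M[R]_(2 + p)) (cJ : complex_structure J).
Variables (L : set 'rV[R]_(2 + p)) (g : 'rV[R]_(2 + p) -> R).
Hypotheses (kL : compact L) (cg : continuous g) (g0 : forall x, 0 <= g x).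

Definition frame (xi : 'rV[R]_(2 + p)) (A : 'M[R]_(p, 2 + p)) : Prop :=
  [/\ nsq xi = 1, A *m A^T = 1%:M & A *m (complex_rows J xi)^T = 0].

(* The row space of A is J-invariant: a closed condition on A not mentioning the normal. *)
Definition invariant_frame (A : 'M[R]_(p, 2 + p)) : Prop :=
  A *m A^T = 1%:M /\ A *m J *m A^T *m A = A *m J.

Lemma frame_exists (xi : 'rV[R]_(2 + p)) : nsq xi = 1 -> exists A, frame xi A.
Proof.
move=> xi1.
have BB : complex_rows J xi *m (complex_rows J xi)^T = 1%:M by rewrite complex_rowsM// xi1.
have [A [AB oO]] := orthonormal_completion BB.
exists A; split => //.
by have := oO; rewrite tr_col_mx mul_col_row [RHS]scalar_mx_block => /eq_block_mx[].
Qed.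

(** The complex line of [xi] and the frame resolve the identity, and [A *m J] has no component on
    that line because the line is itself invariant. *)
Lemma frame_invariant xi A : frame xi A -> invariant_frame A.
Proof.
move=> [xi1 oA AC]; split => //; set C := complex_rows J xi in AC.
have CC : C *m C^T = 1%:M by rewrite complex_rowsM// xi1.
have oO : col_mx C A *m (col_mx C A)^T = 1%:M.
  rewrite tr_col_mx mul_col_row CC oA AC -[C *m A^T]trmxK trmx_mul trmxK AC trmx0.
  by rewrite -scalar_mx_block.
have CA : C^T *m C + A^T *m A = 1%:M.
  by have := mulmx1C oO; rewrite tr_col_mx mul_row_col.
have JC : A *m J *m C^T = 0.
  have := congr1 trmx (J2_rows xi cJ); rewrite !trmx_mul (proj1 cJ) mulNmx => JC.
  by rewrite -mulmxA -[J *m C^T]opprK JC mulmxN mulmxA AC mul0mx oppr0.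
have := congr1 (mulmx (A *m J)) CA.
by rewrite mulmxDr !mulmxA JC mul0mx add0r mulmx1.
Qed.

(** A dimension count provides a nonzero vector orthogonal to the rows of [A]; their span being
    invariant, the image of this vector under [J] is orthogonal to them as well. *)
Lemma invariant_frame_normal A : invariant_frame A -> exists xi, frame xi A.
Proof.
move=> [oA AJ].
have rA : (\rank A^T <= p)%N by rewrite mxrank_tr rank_leq_row.
have [v v0 vA] : exists2 v : 'rV[R]_(2 + p), v != 0 & v *m A^T = 0.
  exists (nz_row (kermx A^T)).
    rewrite nz_row_eq0 -mxrank_eq0 mxrank_ker -lt0n subn_gt0 (leq_ltn_trans rA)//.
  by apply/eqP; rewrite -sub_kermx nz_row_sub.
pose c := Num.sqrt (nsq v); have c0 : 0 < c by rewrite sqrtr_gt0 nsq_gt0.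
exists (c^-1 *: v); split => //.
  by rewrite nsqZ exprVn sqr_sqrtr ?nsq_ge0// mulVf// gt_eqF// nsq_gt0.
have Av : A *m v^T = 0 by rewrite -[LHS]trmxK trmx_mul trmxK vA trmx0.
rewrite /complex_rows tr_col_mx mul_mx_row !linearZ /= -scalemxAl linearZ /= -!scalemxAr Av scaler0.
have -> : A *m (v *m J)^T = 0; last by rewrite scaler0 row_mx0.
by rewrite trmx_mul (proj1 cJ) mulNmx mulmxN mulmxA -AJ -[_ *m A *m v^T]mulmxA Av mulmx0 oppr0.
Qed.

(** Invariant frames form a closed set of matrices with unit rows, hence a compact one, on which no
    normal has to be tracked; the normal is recovered at the maximiser. *)
Theorem maximal_frame : exists xi A, frame xi A /\
  forall xi' A', frame xi' A' -> (section_mass L g A' <= section_mass L g A)%E.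
Proof.
pose K := [set w : 'rV[R]_(p * (2 + p)) | invariant_frame (vec_mx w)].
have cv := @entry_continuous_vec_mx R p (2 + p).
have clK : closed K.
  rewrite (_ : K = [set w | vec_mx w *m (vec_mx w)^T = 1%:M] `&`
    [set w | vec_mx w *m J *m (vec_mx w)^T *m vec_mx w = vec_mx w *m J])//.
  have ct := entry_continuous_tr cv; have cJ' := @entry_continuous_cst R _ _ _ J.
  have cvJ := entry_continuous_mulmx cv (cJ' _).
  apply: closedI; apply: closed_eq_mx => //.
  - exact: (entry_continuous_mulmx cv ct).
  - exact: entry_continuous_cst.
  - exact: (entry_continuous_mulmx (entry_continuous_mulmx cvJ ct) cv).
have bK : bounded_set K.
  exists 1; split => // M M1 w [oA _].
  have M0 : 0 <= M by rewrite (le_trans ler01)// ltW.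
  rewrite /= [leLHS]/Num.Def.normr /= mx_normrE; apply/bigmax_leP; split => //= -[i l] _ /=.
  rewrite (ord1 i); case/mxvec_indexP: l => a b.
  rewrite -[w]vec_mxK mxvecE.
  have : nsq (row a (vec_mx w)) = 1.
    transitivity ((vec_mx w *m (vec_mx w)^T) a a); last by rewrite oA mxE eqxx.
    by rewrite nsqE mxE; apply: eq_bigr => l _; rewrite !mxE expr2.
  move=> r1; rewrite (le_trans _ (ltW M1))// -(@expr_le1 _ 2)// real_normK ?num_real//.
  by rewrite -r1; have := sqr_coord_le (row a (vec_mx w)) b; rewrite [row _ _ _ _]mxE.
have cK : compact K by exact: bounded_closed_compact.
have e1 : nsq (delta_mx 0 0 : 'rV[R]_(2 + p)) = 1 := nsq_delta _ _.
have K0 : K !=set0.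
  have [A fA] := frame_exists e1; exists (mxvec A); rewrite /K /= mxvecK.
  exact: frame_invariant fA.
have [C hC] := section_mass_bounded p kL cg g0.
have fin (A : 'M[R]_(p, 2 + p)) : A *m A^T = 1%:M -> section_mass L g A \is a fin_num.
  move=> oA; rewrite ge0_fin_numE; first exact: le_lt_trans (hC _ oA) (ltry _).
  by apply: integral_ge0 => y _; rewrite lee_fin cut_density_ge0.
pose phi w := fine (section_mass L g (vec_mx w : 'M[R]_(p, 2 + p))).
have [w Kw wmax] : exists2 w, K w & forall w', K w' -> phi w' <= phi w.
  apply: compact_sup_attained => //.
    by exists C => w [oA _]; rewrite -lee_fin fineK ?fin//; exact: hC.
  move=> u w c Kw Ku uw hu; rewrite -lee_fin fineK ?fin//; last by case: Kw.
  apply: (@section_mass_usc _ _ _ L g kL cg g0 (fun i => vec_mx (u i))).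
  - by move=> i; case: (Ku i).
  - by case: Kw.
  - move=> y; have cy : continuous (fun w : 'rV[R]_(p * (2 + p)) => y *m (vec_mx w : 'M[R]_(p, 2 + p))).
      apply: entry_continuous_rV; apply: entry_continuous_mulmx => //; exact: entry_continuous_cst.
    exact: (cvg_comp _ _ uw (cy w)).
  - by move=> i; have := hu i; rewrite -lee_fin fineK ?fin//; case: (Ku i).
have [xi fxi] := invariant_frame_normal Kw.
exists xi, (vec_mx w); split => // xi' A' fA'.
have iA' := frame_invariant fA'.
have := wmax (mxvec A'); rewrite /K /= /phi mxvecK => /(_ iA').
by rewrite -lee_fin (fineK (fin _ iA'.1)) (fineK (fin _ Kw.1)).
Qed.

End MaximalFrame.

(** * Complex convex bodies *)

Section StandardStructure.
Variables (R : realType) (n : nat).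

Definition standard_structure : 'M[R]_(n * 2) := lin_mulmxr (J2 R).
Local Notation J := standard_structure.

Lemma mul_standard_structure (x : 'rV[R]_(n * 2)) : x *m J = mxvec (vec_mx x *m J2 R).
Proof. by rewrite -{1}[x]vec_mxK /J mul_vec_lin. Qed.

Lemma standard_structure0 (x : 'rV[R]_(n * 2)) k : vec_mx (x *m J) k 0 = - vec_mx x k 1.
Proof.
rewrite mul_standard_structure mxvecK mxE big_ord_recl big_ord1.
rewrite (_ : lift _ _ = 1); last exact: val_inj.
by rewrite !mxE /=; ring.
Qed.

Lemma standard_structure1 (x : 'rV[R]_(n * 2)) k : vec_mx (x *m J) k 1 = vec_mx x k 0.
Proof.
rewrite mul_standard_structure mxvecK mxE big_ord_recl big_ord1.
rewrite (_ : lift _ _ = 1); last exact: val_inj.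
by rewrite !mxE /=; ring.
Qed.

Lemma complex_structure_standard : complex_structure J.
Proof.
split; last first.
  apply/row_matrixP => i; rewrite rowE [RHS]rowE mulmxA !mul_standard_structure mxvecK.
  by rewrite -mulmxA (proj2 (complex_structure_J2 R)) !mulmxN !mulmx1 linearN /= vec_mxK.
apply/matrixP => i j.
have E (a b : 'I_(n * 2)) : J a b = ((delta_mx 0 a : 'rV[R]_(n * 2)) *m J *m (delta_mx 0 b : 'rV[R]_(n * 2))^T) 0 0.
  by rewrite -rowE trmx_delta -colE [RHS]mxE [RHS]mxE.
rewrite [LHS]mxE [RHS]mxE !E dot_sym !dot_mxvec -sumrN; apply: eq_bigr => k _.
by rewrite !standard_structure0 !standard_structure1; ring.
Qed.

Lemma complex_hyperplaneE (xi z : 'rV[R]_(n * 2)) :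
  complex_hyperplane xi z <-> z *m (complex_rows J xi)^T = 0.
Proof.
rewrite /complex_hyperplane /= /complex_rows tr_col_mx mul_mx_row.
have -> : \sum_k ccoord z k * (ccoord xi k)^*%C =
    ((z *m xi^T) 0 0 +i* (z *m (xi *m J)^T) 0 0)%C.
  rewrite !dot_mxvec; elim/big_ind3 : _ => // [a b c a' b' c' -> ->//|k _].
  rewrite standard_structure0 standard_structure1 /ccoord/=; apply/eqP; rewrite eq_complex/=.
  by apply/andP; split; apply/eqP; ring.
split => [[h1 h2]|/eqP]; last first.
  by rewrite row_mx_eq0 => /andP[/eqP -> /eqP ->]; rewrite !mxE.
apply/eqP; rewrite row_mx_eq0; apply/andP; split; apply/eqP/matrixP => i j;
by rewrite !ord1 [RHS]mxE.
Qed.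

Lemma rotationE theta (x : 'rV[R]_(n * 2)) :
  rotation theta x = cos theta *: x + sin theta *: (x *m J).
Proof.
rewrite -[RHS]vec_mxK /rotation; congr mxvec; apply/matrixP => k j.
rewrite linearD !linearZ /= mxE [RHS]mxE [in RHS]mxE [X in _ = _ + X]mxE.
by have [->|->] := ord2P j; rewrite /= ?standard_structure0 ?standard_structure1; ring.
Qed.

End StandardStructure.

(** The angle is sought in [0, 2 pi], the range where invariance is assumed: [acos c] when [s] is
    nonnegative, its reflection [2 * pi - acos c] otherwise. *)
Lemma cos_sin_exists (R : realType) (c s : R) : c ^+ 2 + s ^+ 2 = 1 ->
  exists2 theta, 0 <= theta <= 2 * pi & cos theta = c /\ sin theta = s.
Proof.
move=> cs1.
have c1 : -1 <= c <= 1 by rewrite -ler_norml -(@expr_le1 _ 2)// real_normK ?num_real//; have := sqr_ge0 s; lra.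
have cc : cos (acos c) = c by rewrite acosK// in_itv.
have s2 : sin (acos c) ^+ 2 = s ^+ 2 by rewrite sin2cos2 cc; lra.
have a0 := acos_ge0 c1; have api := acos_lepi c1.
have pi0 := pi_ge0 R.
have sa : 0 <= sin (acos c) by apply: sin_ge0_pi; rewrite a0.
have [s0|s0] := lerP 0 s.
  exists (acos c); first by rewrite a0 (le_trans api)//; lra.
  by split => //; apply/eqP; rewrite -(@eqrXn2 _ 2) ?s2.
exists (2 * pi - acos c); first by apply/andP; split; lra.
have -> : 2 * pi - acos c = - acos c + pi *+ 2 by rewrite mulr_natl addrC.
rewrite cosD2pi sinD2pi cosN sinN cc; split => //.
have : `|sin (acos c)| = `|s| by apply/eqP; rewrite -(@eqrXn2 _ 2) // !real_normK ?num_real// s2.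
by rewrite ger0_norm// ltr0_norm// => ->; rewrite opprK.
Qed.

(** For [x0] interior and [x] small, [x] is the midpoint of [x0 + x] and of the opposite of
    [x0 - x], both in [L]. *)
Lemma symmetric_body_ball (R : realType) m (L : set 'rV[R]_m) :
  convex_body L -> (forall x, L x -> L (- x)) ->
  exists2 d, 0 < d & forall x, nsq x <= d -> L x.
Proof.
move=> [_ cL [x0 /nbhs_ballP[e /= e0 be]]] sL.
exists ((e / 2) ^+ 2); first by rewrite exprn_gt0// divr_gt0.
move=> x xe.
have shift y : nsq y <= (e / 2) ^+ 2 -> L (x0 + y).
  move=> ye; apply: be; split => // i j; rewrite (ord1 i) /ball /= mxE opprD addNKr normrN.
  apply: (@le_lt_trans _ _ (e / 2)); last by lra.
  rewrite -(@ler_pXn2r _ 2) ?nnegrE//; last by lra.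
  by rewrite real_normK ?num_real// (le_trans (sqr_coord_le _ _)).
have h1 := shift x xe; have := shift (- x); rewrite nsqN => /(_ xe)/sL h2.
have half : 1 - 2^-1 = 2^-1 :> R by lra.
have -> : x = 2^-1 *: (x0 + x) + (1 - 2^-1) *: - (x0 - x).
  by apply/matrixP => i j; rewrite half !mxE; lra.
by apply: convexP => //; lra.
Qed.

Section MinkowskiFunctional.
Variables (R : realType) (m : nat) (L : set 'rV[R]_m).
Hypotheses (kL : compact L) (cL : convex_set L).

Let lbS x : has_lbound [set a | 0 <= a /\ exists2 y, L y & x = a *: y].
Proof. by exists 0 => a []. Qed.

Lemma minkowski_functional_le1 x : L x -> minkowski_functional L x <= 1.
Proof. by move=> Lx; apply: ge_inf => //; split => //; exists x; rewrite ?scale1r. Qed.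

(** Rotation invariance is given for the gauge; this brings it back to the body. Attainment of the
    infimum is bypassed by approximating [y] from inside the closed set [L]. *)
Lemma minkowski_functional_le1_body d y : 0 < d -> (forall x, nsq x <= d -> L x) ->
  minkowski_functional L y <= 1 -> L y.
Proof.
move=> d0 dL y1.
have L0 : L 0 by apply: dL; rewrite /nsq mul0mx mxE ltW.
have hS : has_inf [set a | 0 <= a /\ exists2 z, L z & y = a *: z].
  split; last exact: lbS.
  pose c := Num.sqrt ((nsq y + 1) / d).
  have c0 : 0 < c by rewrite sqrtr_gt0 divr_gt0// ltr_wpDl// nsq_ge0.
  exists c; split; first exact: ltW.
  exists (c^-1 *: y); last by rewrite scalerA divff ?scale1r// gt_eqF.
  apply: dL; rewrite nsqZ exprVn sqr_sqrtr; last by rewrite divr_ge0 ?addr_ge0 ?nsq_ge0// ltW.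
  have y0 := nsq_ge0 y.
  rewrite invf_div mulrAC ler_pdivrMr; last by lra.
  by rewrite ler_pM2l//; lra.
(* With e for [i.+1%:R^-1], some dilation factor below 1 + e already captures [y], and (1 - e)(1 +
   e) <= 1; convexity with [L0] does the rest. *)
have Lu i : L ((1 - i.+1%:R^-1) *: y).
  have i0 : 0 < i.+1%:R^-1 :> R by rewrite invr_gt0.
  have i1 : i.+1%:R^-1 <= 1 :> R by rewrite invf_le1 ?ler1n.
  have [a [a0 [z Lz yE]] aS] := inf_adherent i0 hS.
  have a1 : a < 1 + i.+1%:R^-1 by apply: lt_le_trans aS _; rewrite lerD2r.
  rewrite yE scalerA -[_ *: z]addr0 -[X in _ + X](scaler0 _ (1 - (1 - i.+1%:R^-1) * a)).
  apply: convexP => //; apply/andP; split.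
    by rewrite mulr_ge0// subr_ge0.
  apply: (@le_trans _ _ ((1 - i.+1%:R^-1) * (1 + i.+1%:R^-1))); first by rewrite ler_wpM2l ?subr_ge0// ltW.
  by rewrite -subr_sqr expr1n lerBlDr lerDl sqr_ge0.
apply: (@closed_cvg _ _ \oo _ _ L (body_closed kL) (nearW _ Lu)).
rewrite -[X in _ --> X]scale1r; apply: cvgZr_tmp.
rewrite -[X in _ --> X]subr0; apply: (@cvgB R R^o); first exact: cvg_cst.
exact: cvg_harmonic.
Qed.

End MinkowskiFunctional.

Lemma rotation_invariant (R : realType) n (L : set 'rV[R]_(n * 2)) x c s :
  complex_convex_body L -> c ^+ 2 + s ^+ 2 = 1 -> L x ->
  L (c *: x + s *: (x *m standard_structure R n)).
Proof.
move=> [bL sL rL] cs Lx; have [kL cL _] := bL.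
have [d d0 dL] := symmetric_body_ball bL sL.
have [theta t01 [<- <-]] := cos_sin_exists cs; rewrite -rotationE.
apply: (minkowski_functional_le1_body kL cL d0 dL).
by rewrite -rL//; exact: minkowski_functional_le1.
Qed.

Section BlockForm.
Variables (R : realType) (p : nat) (JN : 'M[R]_(2 + p)) (cJN : complex_structure JN).

Lemma frame_completion xi (A : 'M[R]_(p, 2 + p)) : frame JN xi A ->
  col_mx (complex_rows JN xi) A *m (col_mx (complex_rows JN xi) A)^T = 1%:M.
Proof.
move=> [xi1 oA AC].
rewrite tr_col_mx mul_col_row complex_rowsM// xi1 oA AC.
by rewrite -[complex_rows JN xi *m A^T]trmxK trmx_mul trmxK AC trmx0 -scalar_mx_block.
Qed.

(** An orthonormal basis adapted to one complex line and its complement splits off a copy of [J2].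
    The chart uses block coordinates, and this avoids relating them to the indices of [mxvec]. *)
Lemma complex_structure_block_form : exists (J : 'M[R]_p) (T0 : 'M[R]_(2 + p)), [/\ complex_structure J,
  T0 *m T0^T = 1%:M & JN *m T0 = T0 *m block_structure J].
Proof.
pose e : 'rV[R]_(2 + p) := delta_mx 0 0.
have e1 : nsq e = 1 := nsq_delta _ _.
have [A fA] := frame_exists cJN e1; have [_ oA AC] := fA.
have oO := frame_completion fA.
set C := complex_rows JN e in oO AC; set O := col_mx C A in oO.
have CA : C *m A^T = 0 by rewrite -[LHS]trmxK trmx_mul trmxK AC trmx0.
have CJ : C *m JN = J2 R *m C by exact: J2_rows.
have CC : C *m C^T = 1%:M by rewrite complex_rowsM// e1.
have JC : JN *m C^T = C^T *m J2 R.
  have := congr1 trmx CJ; rewrite !trmx_mul (proj1 cJN) (proj1 (complex_structure_J2 R)).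
  by rewrite mulNmx mulmxN => /oppr_inj.
pose J := A *m JN *m A^T.
have OJ : O *m JN *m O^T = block_structure J.
  rewrite /O tr_col_mx mul_col_mx mul_col_row -/J CJ -!mulmxA CA CC mulmx0 mulmx1.
  by rewrite JC (mulmxA A) AC mul0mx.
have oO' := mulmx1C oO.
exists J, O^T; split.
- split; first by rewrite !trmx_mul trmxK (proj1 cJN) mulNmx mulmxN mulmxA.
  have : block_structure J *m block_structure J = - 1%:M.
    rewrite -OJ !mulmxA -(mulmxA _ O^T O) oO' mulmx1 -(mulmxA O) (proj2 cJN).
    by rewrite mulmxN mulmx1 mulNmx oO.
  rewrite mulmx_block scalar_mx_block opp_block_mx !mulmx0 !mul0mx add0r.
  by move=> /eq_block_mx[_ _ _]; rewrite add0r.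
- by rewrite trmxK.
- by rewrite -OJ !mulmxA oO' mul1mx.
Qed.

(** Two orthonormal frames of one hyperplane differ by an orthogonal matrix. This passes from the
    maximising frame to the one selected by [hyperplane_frame]. *)
Lemma section_mass_frame (L : set 'rV[R]_(2 + p)) (g : 'rV[R]_(2 + p) -> R) xi
    (A A' : 'M[R]_(p, 2 + p)) : compact L -> continuous g -> (forall x, 0 <= g x) ->
  frame JN xi A -> frame JN xi A' -> section_mass L g A = section_mass L g A'.
Proof.
move=> kL cg g0 fA [_ oA' A'C]; have [_ oA _] := fA; have := mulmx1C (frame_completion fA).
rewrite tr_col_mx mul_row_col => CA.
pose S := A' *m A^T.
have SA : A' = S *m A.
  rewrite -mulmxA -[LHS]mulmx1 -CA mulmxDr.
  by rewrite (mulmxA A' (complex_rows JN xi)^T) A'C mul0mx add0r.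
have oS : S *m S^T = 1%:M.
  by have := oA'; rewrite SA trmx_mul -mulmxA (mulmxA A) oA mul1mx.
rewrite /section_mass -(integral_orthogonal oS).
- by apply: eq_integral => y _; rewrite -mulmxA -SA.
- exact: measurable_section_mass.
- by move=> y; rewrite lee_fin cut_density_ge0.
Qed.

End BlockForm.

(** * Ball volumes, Cauchy masses and the volume of an ellipsoid *)

Section Volumes.
Variable R : realType.

Lemma ball_volumeE m : leb R m (@euclidean_ball R m) = (ball_volume R m)%:E.
Proof. by rewrite /ball_volume fineK //; exact: leb_ball_fin. Qed.

Lemma ball_volume_gt0 m : 0 < ball_volume R m.
Proof. by rewrite -lte_fin -ball_volumeE leb_ball_gt0. Qed.

Lemma leb_ball_mass k :
  leb R (2 + k * 2) (@euclidean_ball R (2 + k * 2)) = (disc_moment R k * cauchy_mass R k)%E.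
Proof.
have cS := complex_structure_standard R k.
have q1 (a : 'rV[R]_(k * 2)) : nsq (row_mx (e0 R) a *m (1%:M : 'M[R]_(2 + k * 2))) = 1 + nsq a.
  by rewrite mulmx1 nsq_row_mx nsq_e0.
have := ball_chart (W := 1%:M) cS (complex_structure_block cS).
under eq_integral do rewrite mulmx1.
under [X in _ -> _ -> _ = (_ * X)%E]eq_integral do rewrite q1.
rewrite leb_ballE; apply; first by rewrite mulmx1 mul1mx.
by move=> a; rewrite q1 ltr_wpDr// nsq_ge0.
Qed.

(** Finiteness of this integral over the whole space is read off the finite volume of the ball. *)
Lemma cauchy_mass_gt0 k : exists2 c : R, 0 < c & cauchy_mass R k = c%:E.
Proof.
have [d d0 dE] := disc_moment_gt0 R k; have b0 := ball_volume_gt0 (2 + k * 2).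
have := leb_ball_mass k; rewrite ball_volumeE dE => /(congr1 (fun x => d^-1%:E * x)%E).
rewrite muleA -!EFinM mulVf ?gt_eqF// mul1e => <-.
by exists (d^-1 * ball_volume R (2 + k * 2)) => //; rewrite mulr_gt0 ?invr_gt0.
Qed.

(** The quotient of consecutive disc moments gives [k.+2%:R / k.+1%:R], which is the n / (n - 1) of
    the theorem for n = k + 2. *)
Lemma cauchy_mass_ratio k : exists2 c : R, 0 < c & cauchy_mass R k = c%:E /\
  cauchy_mass R k.+1 = (c * (ball_volume R (2 + k.+1 * 2) / ball_volume R (2 + k * 2) *
    (k.+2%:R / k.+1%:R)))%:E.
Proof.
have [c c0 cE] := cauchy_mass_gt0 k; have [c' c'0 cE'] := cauchy_mass_gt0 k.+1.
exists c => //; split => //; rewrite cE'; congr EFin.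
have := leb_ball_mass k; have := leb_ball_mass k.+1.
rewrite !disc_momentE !ball_volumeE cE cE' -!EFinM => -[->] -[->].
have := ball_volume_gt0 2; move: (ball_volume R 2) => kap kap0.
field; rewrite !gt_eqF//= -?natr1 -?natrD ?ltr0n//.
Qed.

Lemma ellipsoid_volume m (T : 'M[R]_m) t (L : set 'rV[R]_m) :
  `|\det T| = 1 -> 0 < t -> measurable (L : set (borel_rV R m)) ->
  (forall x, nsq (x *m T) <= t ^+ 2 -> L x) ->
  ((t ^+ m * ball_volume R m)%:E <= leb R m L)%E.
Proof.
move=> dT t0 mL TL.
have uT : T \in unitmx by rewrite unitmxE unitfE -normr_eq0 dT oner_eq0.
have mb := @measurable_ball_ind R m.
have b0 (x : 'rV[R]_m) : (0 <= ball_ind x)%E by rewrite lee_fin.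
have mT := measurable_fun_mulmx T mb.
have mtT := measurable_fun_mulmx (t^-1%:M) mT.
have -> : ((t ^+ m * ball_volume R m)%:E = \int[leb R m]_x ball_ind ((x *m t^-1%:M) *m T)%R)%E.
  rewrite (integral_scale t0 mtT) => [|x]; last exact: b0.
  rewrite EFinM -ball_volumeE leb_ballE -(linear_change_unit uT mb b0) dT mul1e.
  by congr (_ * _)%E; apply: eq_integral => x _; rewrite mul_mx_scalar scalerA mulVf ?gt_eqF// scale1r.
have -> : (leb R m L = \int[leb R m]_x (\1_L x)%:E)%E by rewrite integral_indic// setIT.
apply: ge0_le_integral => //.
  by apply/measurable_EFinP; exact: measurable_indic.
move=> x _; rewrite /ball_ind lee_fin indicE; have [h|_] := lerP (nsq _) 1; last exact: ler0n.
rewrite mem_set//; apply: TL.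
by move: h; rewrite mul_mx_scalar -scalemxAl nsqZ exprVn ler_pdivrMl ?exprn_gt0// mulr1.
Qed.

Lemma body_volume_fin m (L : set 'rV[R]_m) : compact L -> leb R m L \is a fin_num.
Proof.
move=> kL; have [b b0 Lb] := body_bounded kL.
rewrite ge0_fin_numE// (@le_lt_trans _ _ (leb R m (@cube R m (Num.sqrt b))))//.
  apply: le_measure; rewrite ?inE; [exact: body_measurable|exact: measurable_cube|].
  move=> x /Lb xb i; rewrite -sqrtr_sqr ler_wsqrtr//.
  by rewrite (le_trans (sqr_coord_le _ _)).
by rewrite /leb lebesgue_rV_cube ?sqrtr_ge0// ltry.
Qed.

End Volumes.

Section HyperplaneIntegral.
Variables (R : realType) (n : nat) (L : set 'rV[R]_(n * 2)) (g : 'rV[R]_(n * 2) -> R).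

Lemma hyperplane_integralE xi : unit_sphere xi ->
  hyperplane_integral g xi (L `&` complex_hyperplane xi) = section_mass L g (hyperplane_frame xi).
Proof.
move=> /hyperplane_frameP[_ rA]; rewrite /hyperplane_integral integral_leb integral_mkcond.
apply: eq_integral => y _; rewrite patchE /cut_density.
have Hy : complex_hyperplane xi (y *m hyperplane_frame xi) by rewrite -rA; exists y.
by case: asboolP => Ly; [rewrite mem_set|rewrite memNset// => -[]].
Qed.

Lemma frame_hyperplane xi : unit_sphere xi ->
  hyperplane_frame xi *m (hyperplane_frame xi)^T = 1%:M /\
  hyperplane_frame xi *m (complex_rows (standard_structure R n) xi)^T = 0.
Proof.
move=> /hyperplane_frameP[oA rA]; split => //.
apply/row_matrixP => i; rewrite row0 row_mul; apply/complex_hyperplaneE.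
by rewrite -rA rowE; exists (delta_mx 0 i).
Qed.

End HyperplaneIntegral.

(** Take n-th roots of the volume bound, then multiply by b^((n-1)/n) to complete b^(1/n) to [b];
    this power is the numerator of [d_const]. *)
Lemma radius_volume_bound (R : realType) (n : nat) (r b V : R) : (0 < n)%N ->
  0 < r -> 0 < b -> (r / (n * 2)%:R) ^+ n * b <= V ->
  r * b <= 2 * n%:R * b `^ ((n%:R - 1) / n%:R) * V `^ n%:R^-1.
Proof.
move=> n0 r0 b0 h; have nR0 : 0 < n%:R :> R by rewrite ltr0n.
have t0 : 0 < r / (n * 2)%:R by rewrite divr_gt0// ltr0n muln_gt0 n0.
have V0 : 0 <= V by apply: le_trans h; rewrite mulr_ge0 ?exprn_ge0 ?ltW.
have bE : b = b `^ ((n%:R - 1) / n%:R) * b `^ n%:R^-1.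
  rewrite -powRD; last by rewrite (gt_eqF b0) implybT.
  by rewrite mulrBl divff ?gt_eqF// mul1r subrK powRr1// ltW.
have : ((r / (n * 2)%:R) ^+ n * b) `^ n%:R^-1 <= V `^ n%:R^-1.
  apply: ge0_ler_powR => //; rewrite ?invr_ge0 ?nnegrE// mulr_ge0 ?exprn_ge0 ?ltW//.
rewrite powRM ?exprn_ge0 ?(ltW t0) ?(ltW b0)// -powR_mulrn ?(ltW t0)// -powRrM divff ?gt_eqF// powRr1 ?(ltW t0)//.
move=> h'; rewrite {1}bE mulrCA [2 * _ * _]mulrC -mulrA ler_pM2l ?powR_gt0//.
move: h'; rewrite natrM [n%:R * 2]mulrC mulrAC ler_pdivrMr ?mulr_gt0// => /le_trans; apply.
by rewrite [leLHS]mulrC.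
Qed.

(** * From the slicing inequality and the ellipsoid to the measure bound *)

Section MeasureBound.
Variables (R : realType) (k : nat).
Local Notation p := (k.+1 * 2)%N.
Variables (JN : 'M[R]_(2 + p)) (cJN : complex_structure JN).
Variables (L : set 'rV[R]_(2 + p)) (kL : compact L) (cL : convex_set L).
Hypothesis rotL : forall x c s, c ^+ 2 + s ^+ 2 = 1 -> L x -> L (c *: x + s *: (x *m JN)).
Variables (d : R) (d0 : 0 < d) (dL : forall x, nsq x <= d -> L x).
Variables (g : 'rV[R]_(2 + p) -> R) (cg : continuous g) (g0 : forall x, 0 <= g x).

Lemma body_measure_le (M : R) : 0 <= M ->
  (forall xi A, frame JN xi A -> section_mass L g A <= M%:E)%E ->
  (\int[leb R (2 + p)]_x (cut_density L g x)%:E <=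
   (2 * k.+2%:R * (k.+2%:R / k.+1%:R) *
     (ball_volume R (2 + p) `^ ((k.+2%:R - 1) / k.+2%:R) / ball_volume R p) * M *
     fine (leb R (2 + p) L) `^ k.+2%:R^-1)%:E)%E.
Proof.
move=> M0 hM.
have [J [T0 [cJ oT0 JT0]]] := complex_structure_block_form cJN.
have [T [r [JT dT r0 Lr rL]]] := john_ellipsoid (complex_structure_block cJ) oT0 JT0 kL cL rotL d0 dL.
have [c c0 [cE cE']] := cauchy_mass_ratio R k.
have f0 x : (0 <= (cut_density L g x)%:E)%E by rewrite lee_fin cut_density_ge0.
have fL x : ~ L x -> (cut_density L g x)%:E = 0%E by rewrite /cut_density; case: asboolP.
have := @slicing_inequality R k J JN T cJ cJN JT dT L (fun x => (cut_density L g x)%:E) M r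
  (measurable_cut_density kL cg) f0 fL Lr (ltW r0) M0
  (fun xi A xi1 oA AC => hM xi A (And3 xi1 oA AC)).
rewrite cE cE'.
set I := (\int[leb R _]_x _)%E; set b := ball_volume R (2 + k.+1 * 2).
rewrite -[ball_volume R (2 + k * 2)]/(ball_volume R p).
have b0 : 0 < b := ball_volume_gt0 R _; have := ball_volume_gt0 R p.
move: (ball_volume R p) => b' b'0; rewrite -!EFinM => hI.
have {}hI : (I <= (r * b * (M / b' * (k.+2%:R / k.+1%:R)))%:E)%E.
  rewrite -(@lee_pmul2l _ c%:E) ?lte_fin// -EFinM; apply: le_trans hI _.
  by rewrite lee_fin le_eqVlt; apply/orP; left; apply/eqP; ring.
apply: le_trans hI _; rewrite lee_fin.
(* [t] is the radius of the inner ball; in real dimension 2n its volume factor t^(2n) is the n-th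
   power of r / (2n). *)
set V := fine _; pose t := Num.sqrt (r / (k.+2 * 2)%:R).
have n0 : 0 < (k.+2 * 2)%:R :> R by rewrite ltr0n.
have t0 : 0 < t by rewrite sqrtr_gt0 divr_gt0.
have t2 : t ^+ 2 = r / (k.+2 * 2)%:R by rewrite sqr_sqrtr// divr_ge0// ltW.
have vol : (r / (k.+2 * 2)%:R) ^+ k.+2 * b <= V.
  rewrite -lee_fin /V fineK; last exact: body_volume_fin.
  rewrite -t2 -exprM (mulnC 2 k.+2).
  apply: (ellipsoid_volume dT t0 (body_measurable kL)) => x.
  by rewrite t2 ler_pdivlMr// mulrC => /rL.
have q0 : 0 <= M / b' * (k.+2%:R / k.+1%:R) by rewrite mulr_ge0 ?divr_ge0// ltW.
apply: le_trans (ler_wpM2r q0 (radius_volume_bound (ltn0Sn _) r0 b0 vol)) _.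
set x := b `^ _; set y := powR _ k.+2%:R^-1; move: x y k.+2%:R (k.+1%:R^-1) (b'^-1) => x y u w z.
by rewrite le_eqVlt; apply/orP; left; apply/eqP; ring.
Qed.

End MeasureBound.

Theorem theorem4 (R : realType) (n : nat) (n_ge2 : (2 <= n)%N)
    (L : set 'rV[R]_(n * 2)) (L_body : complex_convex_body L)
    (g : 'rV[R]_(n * 2) -> R) (g_continuous : continuous g)
    (g_ge0 : forall x, 0 <= g x) (g_even : forall x, g (- x) = g x)
    (gamma : {measure set (borel_rV R (n * 2)) -> \bar R})
    (gamma_density : forall B : set (borel_rV R (n * 2)), measurable B ->
      gamma B = (\int[lebesgue_rV R (n * 2)]_(x in B) (g x)%:E)%E) :
  exists xi0 : 'rV[R]_(n * 2),
    [/\ unit_sphere xi0,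
        forall xi, unit_sphere xi ->
          (hyperplane_integral g xi (L `&` complex_hyperplane xi)
           <= hyperplane_integral g xi0 (L `&` complex_hyperplane xi0))%E &
        (gamma L <=
          (2 * n%:R * (n%:R / (n%:R - 1)) * d_const R n)%:E
          * hyperplane_integral g xi0 (L `&` complex_hyperplane xi0)
          * lebesgue_rV R (n * 2) L `^ (n%:R^-1))%E].
Proof.
have [[kL cL L0] sL _] := L_body.
have [d d0 dL] := symmetric_body_ball (And3 kL cL L0) sL.
have gammaE : gamma L = (\int[leb R (n * 2)]_x (cut_density L g x)%:E)%E.
  rewrite gamma_density; last exact: body_measurable.
  by rewrite integral_leb integral_mkcond -cut_densityE.
have cJ := complex_structure_standard R n.
have rotL := fun x c s => @rotation_invariant R n L x c s L_body.
have hE := @hyperplane_integralE R n L g; have hF := @frame_hyperplane R n.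
rewrite gammaE; clear gamma gamma_density gammaE g_even sL L0 L_body.
(* For n = k + 2 the dimensions [n * 2] and [2 + (2 + k * 2)] are convertible, so the block results
   apply without casts. *)
case: n n_ge2 L g g_continuous g_ge0 d d0 kL cL dL cJ rotL hE hF => [|[|k]]// _ L g cg g0 d d0 kL cL dL cJ rotL hE hF.
pose p := (k.+1 * 2)%N; pose JN : 'M[R]_(2 + p) := standard_structure R k.+2.
have hfr (xi : 'rV[R]_(2 + p)) : unit_sphere xi ->
    frame JN xi (hyperplane_frame (xi : 'rV[R]_(k.+2 * 2))).
  by move=> xi1; have [oA AC] := hF _ xi1; split => //; exact/unit_sphereE.
have [xi0 [A [fA Amax]]] := @maximal_frame R p JN cJ L g kL cg g0.
have xi01 : unit_sphere xi0 by have [? _ _] := fA; exact/unit_sphereE.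
have hA : hyperplane_integral g xi0 (L `&` complex_hyperplane (xi0 : 'rV[R]_(k.+2 * 2))) =
    section_mass L g A.
  rewrite (hE _ xi01); exact: (@section_mass_frame R p JN cJ L g xi0 _ _ kL cg g0 (hfr _ xi01) fA).
exists xi0; split => //.
  by move=> xi xi1; rewrite hA (hE _ xi1); exact: (Amax _ _ (hfr _ xi1)).
rewrite hA.
have [C hC] := section_mass_bounded p kL cg g0.
have [M M0 ME] : exists2 M : R, 0 <= M & section_mass L g A = M%:E.
  have s0 : (0 <= section_mass L g A)%E.
    by apply: integral_ge0 => y _; rewrite lee_fin cut_density_ge0.
  exists (fine (section_mass L g A)); first exact: fine_ge0.
  rewrite fineK// ge0_fin_numE//; apply: le_lt_trans (hC _ _) (ltry _).
  by case: fA.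
rewrite ME; rewrite ME in Amax.
have := @body_measure_le R k JN cJ L kL cL rotL d d0 dL g cg g0 M M0 Amax.
move=> /le_trans; apply.
have [V VE] : exists V, lebesgue_rV R (k.+2 * 2) L = V%:E.
  by exists (fine (leb R (2 + p) L)); rewrite fineK//; exact: body_volume_fin.
rewrite [in fine _]/leb VE poweR_EFin -!EFinM /d_const.
have -> : k.+2%:R - 1 = k.+1%:R :> R by rewrite -[k.+2%:R]natr1 addrK.
exact: lexx.
Qed.
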